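(* In the sense of analytic continuation in the parameter $\phi$, $$\int_{0}^{\infty}\left(2\cos(v\ln 2)-\sqrt2\right)\operatorname{Im}\!\left(\zeta\!\left(\tfrac12+iv\right)\right)\tanh(\pi v)\,dv=\sqrt2\left(1-\frac{3\ln 2}{2}-\frac{\gamma}{2}\right);$$ that is, $$\lim_{\phi\to\pi^{-}}\int_{0}^{\infty}\left(2\cos(v\ln 2)-\sqrt2\right)\operatorname{Im}\!\left(\zeta\!\left(\tfrac12+iv\right)\right)\frac{\sinh(\phi v)}{\cosh(\pi v)}\,dv=\sqrt2\left(1-\frac{3\ln 2}{2}-\frac{\gamma}{2}\right).$$
   Context: $\zeta$ is the Riemann zeta function and $\gamma$ is the Euler–Mascheroni constant. The integral with $\tanh(\pi v)$ is not claimed to converge; it is assigned the value, continued to $\phi=\pi$, of the integral with $\tanh(\pi v)$ replaced by $\sinh(\phi v)/\cosh(\pi v)$, which converges for real $|\phi|<\pi$. *)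

(* Defs.v *)
From Stdlib Require Import Reals.
From Coquelicot Require Import Coquelicot.

(* Local expansion in a power series with positive radius; used over both R and C. *)
Definition analytic_at {K : AbsRing} (f : K -> K) (z0 : K) : Prop :=
  exists a : nat -> K,
    locally z0 (fun z => @is_pseries K (AbsRing_NormedModule K) a (minus z z0) (f z)).

(* x^s = exp (s ln x), meant for x > 0; Coquelicot has no complex exponential. *)
Definition Cpower (x : R) (s : C) : C :=
  ((exp (Re s * ln x) * cos (Im s * ln x))%R,
   (exp (Re s * ln x) * sin (Im s * ln x))%R).

(* The analytic continuation to C \ {1} of the Dirichlet series. This determines
   zeta on C \ {1}; its value at the pole is left unconstrained. *)
Definition is_riemann_zeta (zeta : C -> C) : Prop :=
  (forall s : C, (1 < Re s)%R ->
     is_series (fun n : nat => Cpower (INR (S n)) (Copp s)) (zeta s)) /\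
  (forall s : C, s <> RtoC 1 -> @analytic_at C_AbsRing zeta s).

Definition euler_gamma : R :=
  real (Lim_seq (fun n : nat => (sum_n_m (fun k : nat => / INR k) 1 n - ln (INR n))%R)).

Definition zeta_integrand (zeta : C -> C) (phi v : R) : R :=
  ((2 * cos (v * ln 2) - sqrt 2) * Im (zeta (Cplus (RtoC (1 / 2)) (Cmult Ci (RtoC v))))
   * (sinh (phi * v) / cosh (PI * v)))%R.

(* Main.v *)
Require Import Defs.
From Stdlib Require Import Reals Lra Lia.
From Coquelicot Require Import Coquelicot.
Open Scope R_scope.

(* Idea: [zeta] on the critical line is the limit of [sum_{n <= N} n^-s - N^(1-s)/(1-s)],
   with an error [O(|s| N^(-1/2))], so the integral can be computed term by term.
   Every term reduces to the sine transform of [sinh (phi v) / cosh (pi v)], which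
   has a closed form with value [Im] of a multiple of [1 / (n + x)] at
   [x = exp (i phi)], scaled by [2], [1/2] or [1].  The result is the imaginary part of
   [exp (i phi / 2)] times a combination of digamma values at [2x], [x/2] and [x]; the
   poles met at [phi = pi] contribute a real quantity.  Expanding in the functions
   [sin ((k + 1/2) phi)] shows that the sum is analytic across [phi = pi], where it
   telescopes to the stated constant. *)

(** * Improper integrals on the half-line *)

(** The limit is not taken under the integral: every bound on the integrand carries
    [exp (- (PI - phi) v)], so no estimate is uniform as [phi] tends to [PI]. Only the closed form
    [J_value] reaches [PI], and it makes sense for every real [phi].

    The obstacle is then local. The terms live at the scales [t = 2N], [N/2] and [N], with
    denominator [|t + exp (i phi)|^2], which vanishes at [phi = PI] exactly when [t = 1]; the
    geometric expansion behind analyticity needs [t > 1]. Only [N = 1] and [N = 2] produce scales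
    [t <= 1]. There the numerator kills [t = 1], and the inversion of [t] trades [1/2] for [2]. For
    [N >= 3] all scales are at least [3/2], so one radius serves the whole series.

    Both uses of analyticity, in [sigma] for zeta and in [phi] for the integral, are carried out
    with real power series along a line, with explicit Cauchy-type bounds in place of contour
    arguments. *)

Definition improper (f : R -> R) (l : R) : Prop :=
  (forall b, 0 <= b -> ex_RInt f 0 b) /\
  filterlim (fun b => RInt f 0 b) (Rbar_locally p_infty) (locally l).

Lemma eventually_ge (a : R) : Rbar_locally p_infty (fun b => a <= b).
Proof. exists a; intros x Hx; lra. Qed.

Lemma ex_RInt_of_derivable_on (f : R -> R) (a b : R) :
  (forall x, Rmin a b <= x <= Rmax a b -> ex_derive f x) -> ex_RInt f a b.
Proof.
  intros Hf. apply (ex_RInt_continuous (V := R_CompleteNormedModule)).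
  intros z Hz. apply (ex_derive_continuous (V := R_NormedModule)), Hf, Hz.
Qed.

Lemma ex_RInt_of_derivable (f : R -> R) (a b : R) :
  (forall x, ex_derive f x) -> ex_RInt f a b.
Proof. intros Hf. apply ex_RInt_of_derivable_on. auto. Qed.

Lemma improper_is_RInt_gen (f : R -> R) (l : R) :
  improper f l -> is_RInt_gen f (at_point 0) (Rbar_locally p_infty) l.
Proof.
  intros [Hex Hl] P HP.
  specialize (Hl P HP). unfold filtermap in Hl.
  unfold filtermapi.
  apply Filter_prod with (Q := fun a => a = 0)
    (R := fun b => 0 <= b /\ P (RInt f 0 b)).
  - reflexivity.
  - apply filter_and; [apply eventually_ge | exact Hl].
  - intros a b Ha [Hb HPb]; subst a. exists (RInt f 0 b); simpl; split; auto.
    apply (RInt_correct f 0 b). auto.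
Qed.

Lemma improper_ext (f g : R -> R) (l : R) :
  (forall v, 0 < v -> f v = g v) -> improper f l -> improper g l.
Proof.
  intros Hfg [Hex Hl]; split.
  - intros b Hb. apply ex_RInt_ext with f; auto.
    intros x; rewrite Rmin_left by lra; intros Hx; apply Hfg; lra.
  - eapply filterlim_ext_loc; [|exact Hl].
    eapply filter_imp; [|apply (eventually_ge 0)].
    intros b Hb; simpl in Hb. apply RInt_ext.
    intros x; rewrite Rmin_left by lra; intros Hx; apply Hfg; lra.
Qed.

Lemma improper_plus (f g : R -> R) (l m : R) :
  improper f l -> improper g m -> improper (fun v => f v + g v) (l + m).
Proof.
  intros [Hf Hl] [Hg Hm]; split.
  - intros b Hb; apply (ex_RInt_plus f g); auto.
  - apply (filterlim_ext_loc (fun b => plus (RInt f 0 b) (RInt g 0 b))).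
    + eapply filter_imp; [|apply (eventually_ge 0)].
      intros b Hb; symmetry; apply (RInt_plus f g); auto.
    + eapply filterlim_comp_2; [exact Hl|exact Hm|].
      apply (@filterlim_plus R_AbsRing R_NormedModule).
Qed.

Lemma improper_scal (k : R) (f : R -> R) (l : R) :
  improper f l -> improper (fun v => k * f v) (k * l).
Proof.
  intros [Hf Hl]; split.
  - intros b Hb; apply (ex_RInt_scal f); auto.
  - apply (filterlim_ext_loc (fun b => scal k (RInt f 0 b))).
    + eapply filter_imp; [|apply (eventually_ge 0)].
      intros b Hb; symmetry; apply (RInt_scal f); auto.
    + eapply filterlim_comp; [exact Hl|].
      apply (@filterlim_scal_r R_AbsRing R_NormedModule).
Qed.

Lemma improper_minus (f g : R -> R) (l m : R) :
  improper f l -> improper g m -> improper (fun v => f v - g v) (l - m).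
Proof.
  intros Hf Hg.
  apply improper_ext with (fun v => f v + (-1) * g v); [intros; ring|].
  replace (l - m) with (l + (-1) * m) by ring.
  apply improper_plus; [exact Hf | apply improper_scal; exact Hg].
Qed.

Lemma improper_unique (f : R -> R) (l m : R) :
  improper f l -> improper f m -> l = m.
Proof.
  intros [_ Hl] [_ Hm].
  exact (@filterlim_locally_unique R R_AbsRing R_NormedModule (Rbar_locally p_infty) _ _ l m Hl Hm).
Qed.

Lemma improper_Lim (f : R -> R) (l : R) :
  improper f l -> real (Lim (fun b => RInt f 0 b) p_infty) = l.
Proof.
  intros [_ Hl]. rewrite (is_lim_unique (fun b => RInt f 0 b) p_infty l Hl). reflexivity.
Qed.

Lemma improper_le (f g : R -> R) (l m : R) :
  (forall v, 0 < v -> f v <= g v) -> improper f l -> improper g m -> l <= m.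
Proof.
  intros Hfg [Hf Hl] [Hg Hm].
  apply (@filterlim_le R (Rbar_locally p_infty) _ (fun b => RInt f 0 b) (fun b => RInt g 0 b) l m);
    [|exact Hl|exact Hm].
  eapply filter_imp; [|apply (eventually_ge 0)].
  intros b Hb; apply RInt_le; auto. intros x Hx; apply Hfg; lra.
Qed.

Lemma improper_abs_le (f g : R -> R) (l m : R) :
  (forall v, 0 < v -> Rabs (f v) <= g v) -> improper f l -> improper g m -> Rabs l <= m.
Proof.
  intros Hfg Hf Hg. apply Rabs_le; split.
  - replace (- m) with ((-1) * m) by ring.
    apply (improper_le (fun v => (-1) * g v) f); auto using improper_scal.
    intros v Hv; specialize (Hfg v Hv); apply Rabs_le_between in Hfg; lra.
  - apply (improper_le f g); auto.
    intros v Hv; specialize (Hfg v Hv); apply Rabs_le_between in Hfg; lra.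
Qed.

Lemma improper_derive (F f : R -> R) (l : R) :
  (forall x, is_derive F x (f x)) -> (forall x, continuous f x) ->
  filterlim F (Rbar_locally p_infty) (locally l) -> improper f (l - F 0).
Proof.
  intros HF Hf Hl.
  assert (HI : forall b, is_RInt f 0 b (F b - F 0)).
  { intros b. apply (is_RInt_derive F f); auto. }
  split.
  - intros b _; eexists; apply HI.
  - apply (filterlim_ext (fun b => plus (F b) (opp (F 0)))).
    + intros b; symmetry; apply is_RInt_unique; apply HI.
    + eapply filterlim_comp_2; [exact Hl|apply filterlim_const|].
      apply (@filterlim_plus R_AbsRing R_NormedModule).
Qed.

Lemma improper_comp_scal (f : R -> R) (c l : R) :
  0 < c -> improper f l -> improper (fun v => f (c * v)) (/ c * l).
Proof.
  intros Hc [Hf Hl].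
  assert (HI : forall b, 0 <= b -> is_RInt (fun v => f (c * v)) 0 b (/ c * RInt f 0 (c * b))).
  { intros b Hb.
    assert (H := is_RInt_comp_lin f c 0 0 b (RInt f 0 (c * b))).
    replace (c * 0 + 0) with 0 in H by ring. replace (c * b + 0) with (c * b) in H by ring.
    assert (H1 : is_RInt f 0 (c * b) (RInt f 0 (c * b))).
    { apply (RInt_correct f), Hf; nra. }
    specialize (H H1).
    apply (is_RInt_scal _ _ _ (/ c)) in H.
    eapply is_RInt_ext; [|exact H].
    intros x _; unfold scal; simpl; unfold mult; simpl.
    replace (c * x + 0) with (c * x) by ring. field; lra. }
  split.
  - intros b Hb; eexists; apply HI; auto.
  - apply (filterlim_ext_loc (fun b => scal (/ c) (RInt f 0 (c * b)))).
    + eapply filter_imp; [|apply (eventually_ge 0)].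
      intros b Hb; symmetry; apply is_RInt_unique, HI, Hb.
    + eapply filterlim_comp; [|apply (@filterlim_scal_r R_AbsRing R_NormedModule)].
      apply (filterlim_comp _ _ _ (fun b => c * b) (fun b => RInt f 0 b) _ (Rbar_locally p_infty));
        [|exact Hl].
      intros P [M HM]. exists (M / c). intros x Hx. apply HM.
      apply (Rmult_lt_compat_l c) in Hx; [|exact Hc].
      replace (c * (M / c)) with M in Hx by (field; lra). exact Hx.
Qed.

Lemma filterlim_exp_neg (a : R) : 0 < a ->
  filterlim (fun v => exp (- a * v)) (Rbar_locally p_infty) (locally 0).
Proof.
  intros Ha.
  apply (filterlim_comp _ _ _ (fun v => - a * v) exp _ (Rbar_locally m_infty)).
  - intros P [M HM]. exists (- M / a). intros x Hx. apply HM.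
    apply (Rmult_lt_compat_l a) in Hx; [|exact Ha].
    replace (a * (- M / a)) with (- M) in Hx by (field; lra). lra.
  - exact is_lim_exp_m.
Qed.

Lemma filterlim_id_exp_neg (a : R) : 0 < a ->
  filterlim (fun v => v * exp (- a * v)) (Rbar_locally p_infty) (locally 0).
Proof.
  intros Ha.
  assert (H2 : filterlim (fun v => (2 / a) * exp (- (a/2) * v)) (Rbar_locally p_infty) (locally 0)).
  { replace 0 with (2 / a * 0) by ring.
    eapply filterlim_comp; [apply filterlim_exp_neg; lra|].
    apply (@filterlim_scal_r R_AbsRing R_NormedModule). }
  refine (filterlim_le_le (fun _ => 0) _ _ (Finite 0) _ (filterlim_const 0) H2).
  eapply filter_imp; [|apply (eventually_ge 0)].
  intros v Hv; simpl in Hv.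
  assert (0 < exp (- (a / 2) * v)) by apply exp_pos.
  assert (Hs : exp (- a * v) = exp (- (a/2) * v) * exp (- (a/2) * v)).
  { rewrite <- exp_plus; f_equal; field. }
  rewrite Hs.
  (* One half of the exponent absorbs the factor [v], by [1 + x <= exp x]; the other half still
     tends to 0. *)
  assert (a / 2 * v * exp (- (a / 2) * v) <= 1).
  { assert (He : exp (- (a/2) * v) * exp (a/2 * v) = 1).
    { rewrite <- exp_plus. replace (- (a / 2) * v + a / 2 * v) with 0 by ring. apply exp_0. }
    assert (Hi := exp_ineq1_le (a/2*v)). nra. }
  split; [nra|].
  apply Rmult_le_reg_l with (a / 2); [lra|]. 
  replace (a / 2 * (2 / a * exp (- (a / 2) * v))) with (exp (- (a / 2) * v)) by (field; lra).
  nra.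
Qed.

Lemma improper_exp (a : R) : 0 < a -> improper (fun v => exp (- a * v)) (/ a).
Proof.
  intros Ha.
  replace (/ a) with (0 - (fun v => - / a * exp (- a * v)) 0).
  2:{ simpl. rewrite Rmult_0_r, exp_0. ring. }
  apply (improper_derive (fun v => - / a * exp (- a * v))).
  - intros x. auto_derive; auto. field; lra.
  - intros x. apply (ex_derive_continuous (fun v => exp (- a * v))). auto_derive; auto.
  - replace 0 with (- / a * 0) by ring.
    eapply filterlim_comp; [apply filterlim_exp_neg; exact Ha|].
    apply (@filterlim_scal_r R_AbsRing R_NormedModule).
Qed.

Lemma improper_id_exp (a : R) : 0 < a -> improper (fun v => v * exp (- a * v)) (/ a ^ 2).
Proof.
  intros Ha.
  replace (/ a ^ 2) with ((- / a * 0 + - / a ^ 2 * 0)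
     - (fun v => - / a * (v * exp (- a * v)) + - / a ^ 2 * exp (- a * v)) 0).
  2:{ rewrite !Rmult_0_r, exp_0. field; lra. }
  apply (improper_derive (fun v => - / a * (v * exp (- a * v)) + - / a ^ 2 * exp (- a * v))).
  - intros x. auto_derive; auto. field; lra.
  - intros x. apply (ex_derive_continuous (fun v => v * exp (- a * v))). auto_derive; auto.
  - eapply filterlim_comp_2; [ | |apply (@filterlim_plus R_AbsRing R_NormedModule)].
    + eapply filterlim_comp; [apply filterlim_id_exp_neg; exact Ha|].
      apply (@filterlim_scal_r R_AbsRing R_NormedModule).
    + eapply filterlim_comp; [apply filterlim_exp_neg; exact Ha|].
      apply (@filterlim_scal_r R_AbsRing R_NormedModule).
Qed.

Lemma filterlim_bounded_exp (a C : R) (g : R -> R) : 0 < a ->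
  (forall v, 0 < v -> Rabs (g v) <= C * exp (- a * v)) ->
  filterlim g (Rbar_locally p_infty) (locally 0).
Proof.
  intros Ha Hg.
  assert (H : forall k, filterlim (fun v => k * exp (- a * v)) (Rbar_locally p_infty) (locally 0)).
  { intros k; replace 0 with (k * 0) by ring.
    eapply filterlim_comp; [apply filterlim_exp_neg; exact Ha|].
    apply (@filterlim_scal_r R_AbsRing R_NormedModule). }
  refine (filterlim_le_le _ _ _ (Finite 0) _ (H (- C)) (H C)).
  exists 0; intros v Hv; specialize (Hg v Hv); apply Rabs_le_between in Hg; lra.
Qed.

Lemma improper_sin_exp (a u : R) : 0 < a ->
  improper (fun v => sin (u * v) * exp (- a * v)) (u / (a ^ 2 + u ^ 2)).
Proof.
  intros Ha.
  assert (Hp : 0 < a ^ 2 + u ^ 2) by nra.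
  replace (u / (a ^ 2 + u ^ 2)) with (0 -
     (fun v => - / (a ^ 2 + u ^ 2) * (a * sin (u * v) + u * cos (u * v)) * exp (- a * v)) 0).
  2:{ simpl. rewrite !Rmult_0_r, exp_0, sin_0, cos_0. field; nra. }
  apply (improper_derive (fun v => - / (a ^ 2 + u ^ 2) * (a * sin (u * v) + u * cos (u * v)) * exp (- a * v))).
  - intros x. auto_derive; auto. field; lra.
  - intros x. apply (ex_derive_continuous (fun v => sin (u * v) * exp (- a * v))). auto_derive; auto.
  - apply filterlim_bounded_exp with a (/ (a ^ 2 + u ^ 2) * (a + Rabs u)); auto.
    intros v Hv. rewrite !Rabs_mult.
    rewrite (Rabs_pos_eq (exp _)) by (left; apply exp_pos).
    apply Rmult_le_compat_r; [left; apply exp_pos|].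
    rewrite Rabs_Ropp, (Rabs_pos_eq (/ _)) by (left; apply Rinv_0_lt_compat; lra).
    apply Rmult_le_compat_l; [left; apply Rinv_0_lt_compat; lra|].
    eapply Rle_trans; [apply Rabs_triang|]. rewrite !Rabs_mult.
    rewrite (Rabs_pos_eq a) by lra.
    assert (Rabs (sin (u * v)) <= 1) by (apply Rabs_le; apply SIN_bound).
    assert (Rabs (cos (u * v)) <= 1) by (apply Rabs_le; apply COS_bound).
    assert (0 <= Rabs u) by apply Rabs_pos. nra.
Qed.

(** Cauchy criterion: beyond [M'] the integral moves by at most [C / a * exp (- a * M')]. *)
Lemma ex_improper (f : R -> R) (a C : R) : 0 < a ->
  (forall b, 0 <= b -> ex_RInt f 0 b) ->
  (forall v, 0 <= v -> Rabs (f v) <= C * exp (- a * v)) ->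
  exists l, improper f l.
Proof.
  intros Ha Hex Hf.
  assert (HC : 0 <= C).
  { specialize (Hf 0 (Rle_refl 0)). rewrite Rmult_0_r, exp_0 in Hf.
    assert (H := Rabs_pos (f 0)); lra. }
  destruct (proj1 (filterlim_locally_cauchy (U := R_CompleteSpace) (F := Rbar_locally p_infty)
     (fun b => RInt f 0 b))) as [l Hl].
  - intros eps.
    assert (Hlim := filterlim_exp_neg a Ha).
    (* The factor 2 pays for comparing two upper limits through the common point [M']. *)
    assert (Hlim2 : filterlim (fun v => (2 * (C / a)) * exp (- a * v)) (Rbar_locally p_infty) (locally 0)).
    { replace 0 with (2 * (C / a) * 0) by ring.
      eapply filterlim_comp; [exact Hlim|]. apply (@filterlim_scal_r R_AbsRing R_NormedModule). }
    specialize (Hlim2 _ (locally_ball 0 eps)). destruct Hlim2 as [M HM].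
    exists (fun b => 0 <= b /\ Rmax M 0 + 1 <= b). split.
    { apply filter_and; apply eventually_ge. }
    set (M' := Rmax M 0 + 1).
    assert (HM' : M < M' /\ 0 < M').
    { unfold M'; assert (H1 := Rmax_l M 0); assert (H2 := Rmax_r M 0); lra. }
    assert (Hkey : forall b, M' <= b -> Rabs (RInt f 0 b - RInt f 0 M') <= C / a * exp (- a * M')).
    { intros b Hb.
      assert (E1 : ex_RInt f 0 M') by (apply Hex; lra).
      assert (E2 : ex_RInt f M' b).
      { apply (ex_RInt_Chasles_2 f 0); [lra|apply Hex; lra]. }
      assert (Hch : RInt f 0 M' + RInt f M' b = RInt f 0 b) by exact (RInt_Chasles f 0 M' b E1 E2).
      rewrite <- Hch. assert (Hpq : forall p q : R, p + q - p = q) by (intros; ring). rewrite Hpq.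
      assert (HG : is_RInt (fun v => C * exp (- a * v)) M' b
        ((- (C / a) * exp (- a * b)) - (- (C / a) * exp (- a * M')))).
      { apply (is_RInt_derive (fun v => - (C / a) * exp (- a * v))).
        - intros x _; auto_derive; auto. field; lra.
        - intros x _; apply (ex_derive_continuous (fun v => C * exp (- a * v))). auto_derive; auto. }
      assert (Hn := norm_RInt_le f (fun v => C * exp (- a * v)) M' b _ _ Hb
        (fun x Hx => Hf x ltac:(lra)) (RInt_correct f M' b E2) HG).
      unfold norm in Hn; simpl in Hn; unfold abs in Hn; simpl in Hn.
      assert (0 < exp (- a * b)) by apply exp_pos.
      assert (0 <= C / a) by (apply Rdiv_le_0_compat; lra). nra. }
    intros x y [_ Hx] [_ Hy]. fold M' in Hx, Hy.
    assert (K1 := Hkey x Hx). assert (K2 := Hkey y Hy).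
    assert (K3 := HM M' (proj1 HM')). unfold ball in K3; simpl in K3; unfold AbsRing_ball in K3; simpl in K3.
    unfold abs, minus, plus, opp in K3; simpl in K3.
    unfold ball; simpl; unfold AbsRing_ball; simpl. unfold abs, minus, plus, opp; simpl.
    rewrite Ropp_0, Rplus_0_r in K3.
    rewrite Rabs_pos_eq in K3.
    2:{ apply Rmult_le_pos; [|left; apply exp_pos]. assert (0 <= C / a) by (apply Rdiv_le_0_compat; lra). lra. }
    assert (Hpq : forall p q r : R, p + - q = (p - r) - (q - r)) by (intros; ring).
    rewrite (Hpq _ _ (RInt f 0 M')).
    eapply Rle_lt_trans; [apply Rabs_triang|]. rewrite Rabs_Ropp. lra.
  - exists l; split; assumption.
Qed.

(** * The sine transform of sinh/cosh *)

Definition ker (phi v : R) : R := sinh (phi * v) / cosh (PI * v).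

Lemma cosh_pos (x : R) : 0 < cosh x.
Proof. unfold cosh. assert (H1 := exp_pos x). assert (H2 := exp_pos (- x)). lra. Qed.

Lemma exp_le_compat (x y : R) : x <= y -> exp x <= exp y.
Proof. intros [H|H]; [left; apply exp_increasing; exact H | right; f_equal; exact H]. Qed.

Lemma Rabs_sinh_le (x : R) : Rabs (sinh x) <= exp (Rabs x) / 2.
Proof.
  unfold sinh. assert (H1 := exp_pos x). assert (H2 := exp_pos (- x)).
  assert (H3 : exp x <= exp (Rabs x)) by (apply exp_le_compat, Rle_abs).
  assert (H4 : exp (- x) <= exp (Rabs x)).
  { apply exp_le_compat. rewrite <- Rabs_Ropp. apply Rle_abs. }
  apply Rabs_le; lra.
Qed.

(** From [|sinh x| <= exp |x| / 2] and [cosh x >= exp x / 2]. The rate [PI - |phi|] is what makes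
    every integral below converge, and it degenerates at [phi = PI]. *)
Lemma ker_abs (phi v : R) : 0 <= v -> Rabs (ker phi v) <= exp (- (PI - Rabs phi) * v).
Proof.
  intros Hv. unfold ker, Rdiv. rewrite Rabs_mult, Rabs_inv.
  rewrite (Rabs_pos_eq (cosh _)) by (left; apply cosh_pos).
  apply Rmult_le_reg_r with (cosh (PI * v)); [apply cosh_pos|].
  rewrite Rmult_assoc, Rinv_l by (apply Rgt_not_eq, cosh_pos). rewrite Rmult_1_r.
  eapply Rle_trans; [apply Rabs_sinh_le|].
  rewrite Rabs_mult, (Rabs_pos_eq v) by exact Hv.
  replace (Rabs phi * v) with (- (PI - Rabs phi) * v + PI * v) by ring.
  rewrite exp_plus. unfold cosh.
  assert (H1 := exp_pos (- (PI * v))). assert (H2 := exp_pos (- (PI - Rabs phi) * v)). nra.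
Qed.

Lemma ker_derivable (phi v : R) : ex_derive (ker phi) v.
Proof.
  unfold ker, sinh, cosh. auto_derive.
  assert (H := cosh_pos (PI * v)). unfold cosh in H. lra.
Qed.

Lemma Rabs_sin_le (x : R) : Rabs (sin x) <= Rabs x.
Proof.
  assert (Hp : forall y, 0 <= y -> Rabs (sin y) <= y).
  { intros y Hy. apply Rabs_le; split.
    - destruct (Rle_dec y PI) as [H|H].
      + assert (0 <= sin y) by (apply sin_ge_0; lra). lra.
      + assert (H3 := PI2_1). assert (H1 := SIN_bound y). lra.
    - destruct Hy as [Hy|Hy]; [left; apply sin_lt_x; exact Hy|subst; rewrite sin_0; lra]. }
  destruct (Rle_dec 0 x) as [H|H].
  - rewrite (Rabs_pos_eq x) by lra; apply Hp; lra.
  - rewrite <- (Rabs_Ropp x), <- (Rabs_Ropp (sin x)), <- sin_neg, (Rabs_pos_eq (- x)) by lra.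
    apply Hp; lra.
Qed.

Lemma ex_sine_transform (phi u : R) : - PI < phi < PI ->
  exists l, improper (fun v => sin (u * v) * ker phi v) l.
Proof.
  intros Hphi. apply (ex_improper _ (PI - Rabs phi) 1).
  - assert (Rabs phi < PI) by (apply Rabs_def1; lra). lra.
  - intros b _. apply ex_RInt_of_derivable. intros v.
    auto_derive; auto using ker_derivable.
  - intros v Hv. rewrite Rabs_mult.
    assert (H1 : Rabs (sin (u * v)) <= 1) by (apply Rabs_le, SIN_bound).
    assert (H2 := ker_abs phi v Hv). assert (H3 := Rabs_pos (ker phi v)).
    assert (H4 := Rabs_pos (sin (u * v))). nra.
Qed.

(* Equals [- Im (1 / cosh ((u + i phi) / 2)) / 2]; the hyperbolic secant is self-dual under
   the Fourier transform. *)
Definition sech_transform (u phi : R) : R :=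
  sin (phi / 2) * sinh (u / 2) / (2 * (sinh (u / 2) ^ 2 + cos (phi / 2) ^ 2)).

Lemma nonneg_of_derive (f f' : R -> R) (x : R) : 0 <= x ->
  (forall t, 0 <= t <= x -> is_derive f t (f' t)) ->
  (forall t, 0 <= t <= x -> 0 <= f' t) -> 0 <= f 0 -> 0 <= f x.
Proof.
  intros Hx Hd Hp H0.
  destruct (MVT_gen f 0 x f') as [c [Hc E]].
  - intros t; rewrite Rmin_left, Rmax_right by lra; intros; apply Hd; lra.
  - intros t; rewrite Rmin_left, Rmax_right by lra; intros.
    apply derivable_continuous_pt. exists (f' t). apply is_derive_Reals, Hd; lra.
  - rewrite Rmin_left, Rmax_right in Hc by lra.
    assert (H1 := Hp c Hc). nra.
Qed.

Lemma sinh_ge_id (x : R) : 0 <= x -> x <= sinh x.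
Proof.
  intros Hx. cut (0 <= sinh x - x); [lra|].
  apply (nonneg_of_derive (fun x => sinh x - x) (fun t => (exp t + exp (- t)) / 2 - 1)); auto.
  - intros t _. unfold sinh; auto_derive; auto; field.
  - intros t _. assert (H : 0 <= (exp t - 1) ^ 2) by apply pow2_ge_0.
    assert (E : exp t * exp (- t) = 1) by (rewrite <- exp_plus, Rplus_opp_r; apply exp_0).
    assert (H1 := exp_pos t). assert (H2 := exp_pos (- t)). nra.
  - rewrite sinh_0; lra.
Qed.

Lemma exp_half_le_2 (t : R) : t <= / 2 -> exp t <= 2.
Proof.
  intros Ht. assert (H := exp_ineq1_le (- t)). assert (H1 := exp_pos t).
  assert (E : exp t * exp (- t) = 1) by (rewrite <- exp_plus, Rplus_opp_r; apply exp_0). nra.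
Qed.

Lemma sinh_le_cubic (x : R) : 0 <= x <= / 2 -> sinh x <= x + x ^ 3.
Proof.
  intros Hx. cut (0 <= x + x ^ 3 - sinh x); [lra|].
  apply (nonneg_of_derive (fun x => x + x ^ 3 - sinh x) (fun t => 1 + 3 * t ^ 2 - (exp t + exp (- t)) / 2)); try lra.
  - intros t _. unfold sinh; auto_derive; auto; field.
  - intros s Hs.
    apply (nonneg_of_derive (fun t => 1 + 3 * t ^ 2 - (exp t + exp (- t)) / 2) (fun t => 6 * t - (exp t - exp (- t)) / 2)); try lra.
    + intros t _. auto_derive; auto; field.
    + intros r Hr. apply (nonneg_of_derive (fun t => 6 * t - (exp t - exp (- t)) / 2) (fun t => 6 - (exp t + exp (- t)) / 2)); try lra.
      * intros t _. auto_derive; auto; field.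
      * intros t Ht. assert (exp t <= 2) by (apply exp_half_le_2; lra).
        assert (exp (- t) <= 2) by (apply exp_half_le_2; lra). lra.
      * rewrite Ropp_0, exp_0. lra.
    + rewrite Ropp_0, exp_0. lra.
  - rewrite sinh_0; lra.
Qed.

Lemma cos_ge_quadratic (y : R) : 1 - y ^ 2 / 2 <= cos y.
Proof.
  replace (cos y) with (1 - 2 * sin (y / 2) * sin (y / 2)).
  2:{ rewrite <- cos_2a_sin. f_equal. field. }
  assert (H := Rabs_sin_le (y / 2)).
  assert (H1 : (sin (y / 2)) ^ 2 <= (y / 2) ^ 2) by (rewrite <- (pow2_abs (y / 2)); apply pow_maj_Rabs, H).
  nra.
Qed.

Lemma sin_ge_cubic (y : R) : 0 <= y -> y - y ^ 3 / 6 <= sin y.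
Proof.
  intros Hy. cut (0 <= sin y - (y - y ^ 3 / 6)); [lra|].
  apply (nonneg_of_derive (fun y => sin y - (y - y ^ 3 / 6)) (fun t => cos t - (1 - t ^ 2 / 2))); auto.
  - intros t _. auto_derive; auto; field.
  - intros t _. assert (H := cos_ge_quadratic t). lra.
  - rewrite sin_0; lra.
Qed.

(** With [w = (u + i phi) / 6], this comes from the partial fraction identity [3 sech (3w) = sech (w
    + i pi/3) + sech (w - i pi/3) - sech w], over the three factors of [cosh (3w)]. The proof stays
    real and uses the triple-angle formulas for [sin] and [sinh]. *)
Lemma sech_transform_triple (u phi : R) : - PI < phi < PI ->
  sech_transform u phi = / 3 * (sech_transform (u / 3) ((phi + 2 * PI) / 3)
    + sech_transform (u / 3) ((phi - 2 * PI) / 3) - sech_transform (u / 3) (phi / 3)).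
Proof.
  intros Hphi. unfold sech_transform.
  assert (HA : forall t, cos t ^ 2 = 1 - sin t ^ 2).
  { intros t. assert (H := sin2_cos2 t). unfold Rsqr in H. lra. }
  assert (Hc : forall t, - (PI / 2) < t < PI / 2 -> 0 < cos t ^ 2).
  { intros t Ht. apply pow_lt, cos_gt_0; lra. }
  set (x := sinh (u / 3 / 2)). set (y := sin (phi / 3 / 2)). set (z := cos (phi / 3 / 2)).
  assert (Hz : z ^ 2 = 1 - y ^ 2) by apply HA.
  assert (Hr : sqrt 3 ^ 2 = 3) by (apply pow2_sqrt; lra).
  assert (E1 : sin ((phi + 2 * PI) / 3 / 2) = (y + sqrt 3 * z) / 2).
  { replace ((phi + 2 * PI) / 3 / 2) with (phi / 3 / 2 + PI / 3) by field.
    rewrite sin_plus, sin_PI3, cos_PI3. unfold y, z. field. }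
  assert (E2 : sin ((phi - 2 * PI) / 3 / 2) = (y - sqrt 3 * z) / 2).
  { replace ((phi - 2 * PI) / 3 / 2) with (phi / 3 / 2 - PI / 3) by field.
    rewrite sin_minus, sin_PI3, cos_PI3. unfold y, z. field. }
  assert (E3 : sin (phi / 2) = 3 * y - 4 * y ^ 3).
  { replace (phi / 2) with (phi / 3 / 2 + 2 * (phi / 3 / 2)) by field.
    rewrite sin_plus, sin_2a, cos_2a. fold y z.
    replace (y * (z * z - y * y) + z * (2 * y * z)) with (y * (3 * z ^ 2 - y ^ 2)) by ring.
    rewrite Hz. ring. }
  assert (E4 : sinh (u / 2) = 3 * x + 4 * x ^ 3).
  { unfold x, sinh. set (e := exp (u / 3 / 2)). set (e' := exp (- (u / 3 / 2))).
    assert (Hee : e * e' = 1) by (unfold e, e'; rewrite <- exp_plus, Rplus_opp_r; apply exp_0).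
    replace (u / 2) with (u / 3 / 2 + (u / 3 / 2 + u / 3 / 2)) by field.
    rewrite !Ropp_plus_distr, !exp_plus. fold e e'.
    replace (3 * ((e - e') / 2) + 4 * ((e - e') / 2) ^ 3) with
      ((e ^ 3 - e' ^ 3) / 2 + 3 / 2 * (e - e') * (1 - e * e')) by field.
    rewrite Hee. field. }
  assert (D0 : 0 < 1 + x ^ 2 - y ^ 2).
  { assert (0 < cos (phi / 3 / 2) ^ 2) by (apply Hc; lra). rewrite HA in H. fold y in H. nra. }
  assert (D1 : 0 < 1 + x ^ 2 - ((y + sqrt 3 * z) / 2) ^ 2).
  { assert (0 < cos ((phi + 2 * PI) / 3 / 2) ^ 2) by (apply Hc; lra). rewrite HA, E1 in H. nra. }
  assert (D2 : 0 < 1 + x ^ 2 - ((y - sqrt 3 * z) / 2) ^ 2).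
  { assert (0 < cos ((phi - 2 * PI) / 3 / 2) ^ 2) by (apply Hc; lra). rewrite HA, E2 in H. nra. }
  assert (D3 : 0 < 1 + (3 * x + 4 * x ^ 3) ^ 2 - (3 * y - 4 * y ^ 3) ^ 2).
  { assert (0 < cos (phi / 2) ^ 2) by (apply Hc; lra). rewrite HA, E3 in H.
    assert (0 <= (3 * x + 4 * x ^ 3) ^ 2) by apply pow2_ge_0. lra. }
  rewrite !HA, E1, E2, E3, E4, Hz.
  set (p := (y + sqrt 3 * z) / 2) in *. set (q := (y - sqrt 3 * z) / 2) in *.
  (* Only the symmetric functions [p + q] and [p * q] enter the sum of the two shifted terms, so
     [sqrt 3] disappears. *)
  assert (Hs : p + q = y) by (unfold p, q; field).
  assert (Hpq : p * q = y ^ 2 - 3 / 4).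
  { unfold p, q. replace ((y + sqrt 3 * z) / 2 * ((y - sqrt 3 * z) / 2))
      with ((y ^ 2 - sqrt 3 ^ 2 * z ^ 2) / 4) by field. rewrite Hr, Hz. field. }
  set (A := 1 + x ^ 2) in *.
  assert (Hcomb : p * x / (2 * (x ^ 2 + (1 - p ^ 2))) + q * x / (2 * (x ^ 2 + (1 - q ^ 2)))
     = x * (y * (A - (y ^ 2 - 3 / 4))) / (2 * ((A - p ^ 2) * (A - q ^ 2)))).
  { rewrite <- Hpq, <- Hs. unfold A. unfold A in D1, D2. field. split; lra. }
  assert (Hden : (A - p ^ 2) * (A - q ^ 2) = A ^ 2 - A * (3 / 2 - y ^ 2) + (y ^ 2 - 3 / 4) ^ 2).
  { rewrite <- Hpq. replace (3 / 2 - y ^ 2) with ((p + q) ^ 2 - 2 * (p * q)) by (rewrite Hs, Hpq; field). ring. }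
  assert (D4 : 0 < (A - p ^ 2) * (A - q ^ 2)) by (apply Rmult_lt_0_compat; lra).
  rewrite Hcomb, Hden. rewrite Hden in D4. unfold A in *. clear - D4 D0 D3.
  field. repeat split; nra.
Qed.

(** The subtracted fraction is the singular part at [u = 0], [phi = PI]. Uniformity in [phi] is
    essential: repeated triplication sends [phi] to points such as [(phi + 2 PI) / 3], which
    accumulate at [PI] and [- PI]. *)
Lemma sech_transform_near (u phi : R) : 0 <= u <= 1 -> 0 <= phi < PI ->
  Rabs (sech_transform u phi - u / ((PI - phi) ^ 2 + u ^ 2)) <= 14 * u.
Proof.
  intros Hu Hphi. unfold sech_transform.
  set (y := (PI - phi) / 2).
  replace (sin (phi / 2)) with (cos y) by (unfold y; rewrite <- cos_shift; f_equal; field).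
  replace (cos (phi / 2)) with (sin y) by (unfold y; rewrite <- sin_shift; f_equal; field).
  set (x := u / 2). replace u with (2 * x) by (unfold x; field).
  replace (PI - phi) with (2 * y) by (unfold y; field).
  assert (Hy : 0 < y <= PI / 2) by (unfold y; lra).
  assert (HPI : PI <= 4) by apply PI_4.
  assert (Hx : 0 <= x <= / 2) by (unfold x; lra).
  set (X := sinh x). set (Y := sin y).
  assert (X1 : x <= X) by (apply sinh_ge_id; lra).
  assert (X2 : X <= x + x ^ 3) by (apply sinh_le_cubic; lra).
  assert (Y1 : y - y ^ 3 / 6 <= Y) by (apply sin_ge_cubic; lra).
  assert (Y2 : Y <= y) by (left; apply sin_lt_x; lra).
  assert (C1 := cos_ge_quadratic y). assert (C2 := COS_bound y).
  assert (C3 : 0 <= cos y) by (apply cos_ge_0; lra).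
  (* Since [y <= PI / 2 <= 2], the cubic lower bound for the sine gives the factor [1/3]. The
     denominator is then at least [2 r^2 / 9] against a numerator of size [3 x r^2]. *)
  assert (Y3 : y / 3 <= Y) by nra.
  set (r := x ^ 2 + y ^ 2). assert (Hr : 0 < r) by (unfold r; nra).
  assert (HXY : r / 9 <= X ^ 2 + Y ^ 2) by (unfold r; nra).
  replace (cos y * X / (2 * (X ^ 2 + Y ^ 2)) - 2 * x / ((2 * y) ^ 2 + (2 * x) ^ 2))
    with ((cos y * X * r - x * (X ^ 2 + Y ^ 2)) / (2 * (r * (X ^ 2 + Y ^ 2)))).
  2:{ unfold r; field. repeat split; unfold r in *; nra. }
  assert (HN : Rabs (cos y * X * r - x * (X ^ 2 + Y ^ 2)) <= 3 * x * r ^ 2).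
  { apply Rabs_le; split.
    - assert ((1 - y ^ 2 / 2) * x <= cos y * X).
      { apply Rle_trans with (cos y * x); [apply Rmult_le_compat_r; lra|apply Rmult_le_compat_l; lra]. }
      assert (X ^ 2 + Y ^ 2 <= (x + x ^ 3) ^ 2 + y ^ 2).
      { apply Rplus_le_compat; apply pow_incr; nra. }
      apply Rle_trans with ((1 - y ^ 2 / 2) * x * r - x * ((x + x ^ 3) ^ 2 + y ^ 2)); [|nra].
      replace ((1 - y ^ 2 / 2) * x * r - x * ((x + x ^ 3) ^ 2 + y ^ 2))
        with (- x * (y ^ 2 / 2 * r + (2 + x ^ 2) * (x ^ 2 * x ^ 2))) by (unfold r; ring).
      assert (0 <= x ^ 2 <= r) by (unfold r; nra). assert (0 <= y ^ 2 <= r) by (unfold r; nra).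
      assert (y ^ 2 / 2 * r + (2 + x ^ 2) * (x ^ 2 * x ^ 2) <= 3 * r ^ 2).
      { assert (x ^ 2 * x ^ 2 <= r * r) by nra. assert (x ^ 2 <= / 4) by nra. nra. }
      nra.
    - assert (cos y * X <= x + x ^ 3) by nra.
      assert (x ^ 2 + (y ^ 2 - y ^ 4 / 3) <= X ^ 2 + Y ^ 2).
      { assert (0 <= y - y ^ 3 / 6) by nra.
        assert ((y - y ^ 3 / 6) ^ 2 <= Y ^ 2) by (apply pow_incr; lra).
        assert (x ^ 2 <= X ^ 2) by (apply pow_incr; lra).
        assert (0 <= y ^ 6) by (apply pow_le; lra). nra. }
      apply Rle_trans with ((x + x ^ 3) * r - x * (x ^ 2 + (y ^ 2 - y ^ 4 / 3))); [nra|].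
      replace ((x + x ^ 3) * r - x * (x ^ 2 + (y ^ 2 - y ^ 4 / 3)))
        with (x * (x ^ 2 * r + y ^ 2 * y ^ 2 / 3)) by (unfold r; field).
      assert (0 <= x ^ 2 <= r) by (unfold r; nra). assert (0 <= y ^ 2 <= r) by (unfold r; nra).
      assert (x ^ 2 * r + y ^ 2 * y ^ 2 / 3 <= 3 * r ^ 2) by nra.
      nra. }
  assert (HD : 0 < 2 * (r * (X ^ 2 + Y ^ 2))) by nra.
  unfold Rdiv. rewrite Rabs_mult, Rabs_inv, (Rabs_pos_eq (2 * _)) by lra.
  apply Rmult_le_reg_r with (2 * (r * (X ^ 2 + Y ^ 2))); [exact HD|].
  rewrite Rmult_assoc, Rinv_l, Rmult_1_r by lra.
  eapply Rle_trans; [exact HN|].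
  assert (r ^ 2 / 9 <= r * (X ^ 2 + Y ^ 2)) by nra. nra.
Qed.

(** Replacing the kernel by [exp (- (PI - phi) v)], whose sine transform is the elementary fraction,
    costs at most [2 exp (- PI v)]. The bound [|sin (u v)| <= u v] then supplies the factor [u],
    uniformly in [phi]. *)
Lemma sine_transform_near (u phi l : R) : 0 <= u -> 0 <= phi < PI ->
  improper (fun v => sin (u * v) * ker phi v) l ->
  Rabs (l - u / ((PI - phi) ^ 2 + u ^ 2)) <= 2 * u.
Proof.
  intros Hu Hphi Hl.
  assert (HPI : 2 < PI) by (assert (H := PI2_1); lra).
  apply Rle_trans with (2 * u * / PI ^ 2).
  2:{ assert (/ PI ^ 2 <= 1). { rewrite <- Rinv_1. apply Rinv_le_contravar; nra. } nra. }
  apply (improper_abs_le (fun v => sin (u * v) * ker phi v - sin (u * v) * exp (- (PI - phi) * v))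
    (fun v => 2 * u * (v * exp (- PI * v)))).
  - intros v Hv. rewrite <- Rmult_minus_distr_l, Rabs_mult.
    assert (H1 : Rabs (sin (u * v)) <= u * v).
    { eapply Rle_trans; [apply Rabs_sin_le|]. rewrite Rabs_pos_eq by nra. lra. }
    assert (H2 : Rabs (ker phi v - exp (- (PI - phi) * v)) <= 2 * exp (- PI * v)).
    { unfold ker. assert (Hch := cosh_pos (PI * v)).
      replace (sinh (phi * v) / cosh (PI * v) - exp (- (PI - phi) * v))
        with ((sinh (phi * v) - exp (- (PI - phi) * v) * cosh (PI * v)) / cosh (PI * v)) by (field; lra).
      unfold Rdiv. rewrite Rabs_mult, Rabs_inv, (Rabs_pos_eq (cosh _)) by lra.
      apply Rmult_le_reg_r with (cosh (PI * v)); [lra|].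
      rewrite Rmult_assoc, Rinv_l, Rmult_1_r by lra.
      replace (sinh (phi * v) - exp (- (PI - phi) * v) * cosh (PI * v))
        with (- ((exp (- (phi * v)) + exp (phi * v - 2 * PI * v)) / 2)).
      2:{ unfold sinh, cosh. 
          replace (phi * v - 2 * PI * v) with (- (PI - phi) * v + - (PI * v)) by ring.
          replace (phi * v) with (- (PI - phi) * v + PI * v) at 2 by ring.
          rewrite !exp_plus. field. }
      assert (E : exp (- PI * v) * exp (PI * v) = 1).
      { rewrite <- exp_plus. replace (- PI * v + PI * v) with 0 by ring. apply exp_0. }
      assert (P1 := exp_pos (- PI * v)). assert (P2 := exp_pos (- (PI * v))).
      assert (P3 := exp_pos (- (phi * v))). assert (P4 := exp_pos (phi * v - 2 * PI * v)).
      assert (exp (- (phi * v)) <= 1) by (rewrite <- exp_0; apply exp_le_compat; nra).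
      assert (exp (phi * v - 2 * PI * v) <= 1) by (rewrite <- exp_0; apply exp_le_compat; nra).
      rewrite Rabs_Ropp, Rabs_pos_eq by lra. unfold cosh. nra. }
    replace (2 * u * (v * exp (- PI * v))) with (u * v * (2 * exp (- PI * v))) by ring.
    apply Rmult_le_compat; auto using Rabs_pos.
  - apply improper_minus; [exact Hl|]. apply improper_sin_exp; lra.
  - apply improper_scal, improper_id_exp; lra.
Qed.

Lemma sine_transform_opp_arg (u phi l : R) :
  improper (fun v => sin (u * v) * ker phi v) l ->
  improper (fun v => sin (- u * v) * ker phi v) (- l).
Proof.
  intros H. replace (- l) with (-1 * l) by ring.
  apply (improper_ext (fun v => -1 * (sin (u * v) * ker phi v))); [|apply improper_scal, H].
  intros v _. rewrite Ropp_mult_distr_l_reverse, sin_neg. ring.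
Qed.

Lemma ker_opp (phi v : R) : ker (- phi) v = - ker phi v.
Proof.
  unfold ker, sinh. rewrite Ropp_mult_distr_l_reverse, Ropp_involutive.
  unfold Rdiv. ring.
Qed.

Lemma sine_transform_opp (u phi l : R) :
  improper (fun v => sin (u * v) * ker phi v) l ->
  improper (fun v => sin (u * v) * ker (- phi) v) (- l).
Proof.
  intros H. replace (- l) with (-1 * l) by ring.
  apply (improper_ext (fun v => -1 * (sin (u * v) * ker phi v))); [|apply improper_scal, H].
  intros v _. rewrite ker_opp. ring.
Qed.

Lemma sech_transform_opp_arg (u phi : R) : sech_transform (- u) phi = - sech_transform u phi.
Proof.
  unfold sech_transform. replace (- u / 2) with (- (u / 2)) by field.
  replace (sinh (- (u / 2))) with (- sinh (u / 2)) by (unfold sinh; rewrite Ropp_involutive; field).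
  replace ((- sinh (u / 2)) ^ 2) with (sinh (u / 2) ^ 2) by ring. unfold Rdiv; ring.
Qed.

Lemma sech_transform_opp (u phi : R) : sech_transform u (- phi) = - sech_transform u phi.
Proof.
  unfold sech_transform. replace (- phi / 2) with (- (phi / 2)) by field.
  rewrite sin_neg, cos_neg. unfold Rdiv; ring.
Qed.

(** Both quantities are compared with the same singular part [u / ((PI - phi)^2 + u^2)]; the
    constant is [14 + 2]. *)
Lemma sine_transform_crude (u phi l : R) : 0 <= u <= 1 -> - PI < phi < PI ->
  improper (fun v => sin (u * v) * ker phi v) l ->
  Rabs (l - sech_transform u phi) <= 16 * u.
Proof.
  assert (Hpos : forall phi l, 0 <= u <= 1 -> 0 <= phi < PI ->
    improper (fun v => sin (u * v) * ker phi v) l -> Rabs (l - sech_transform u phi) <= 16 * u).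
  { intros p m Hu Hp H.
    assert (H1 := sine_transform_near u p m (proj1 Hu) Hp H).
    assert (H2 := sech_transform_near u p Hu Hp).
    apply Rabs_le. apply Rabs_le_between in H1. apply Rabs_le_between in H2. lra. }
  intros Hu Hphi H. destruct (Rle_dec 0 phi) as [Hp|Hp].
  - apply Hpos; auto; lra.
  - apply sine_transform_opp in H.
    rewrite <- Rabs_Ropp. replace (- (l - sech_transform u phi)) with (- l - sech_transform u (- phi))
      by (rewrite sech_transform_opp; ring).
    apply Hpos; auto; lra.
Qed.

(* Herglotz' trick: both sides satisfy the same triplication rule, which divides
   the discrepancy at [u / 3] by one when passing to [u]. *)
Lemma sine_transform_iter (n : nat) : forall u phi l, 0 <= u -> u / 3 ^ n <= 1 -> - PI < phi < PI ->
  improper (fun v => sin (u * v) * ker phi v) l ->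
  Rabs (l - sech_transform u phi) <= 16 * u / 3 ^ n.
Proof.
  induction n as [|n IH]; intros u phi l Hu Hun Hphi H.
  - simpl in *. rewrite Rdiv_1_r in *. apply sine_transform_crude; auto.
  - destruct (ex_sine_transform ((phi + 2 * PI) / 3) (u / 3)) as [l1 H1]; [lra|].
    destruct (ex_sine_transform ((phi - 2 * PI) / 3) (u / 3)) as [l2 H2]; [lra|].
    destruct (ex_sine_transform (phi / 3) (u / 3)) as [l3 H3]; [lra|].
    (* After substituting [3 v] for [v], the three numerators combine to
       [sinh (phi v) (2 cosh (2 PI v) - 1)], and [cosh (3 PI v) = cosh (PI v) (2 cosh (2 PI v) -
       1)]. *)
    assert (E : l = / 3 * (l1 + l2 - l3)).
    { apply (improper_unique (fun v => sin (u * v) * ker phi v)); [exact H|].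
      apply (improper_ext (fun v => sin (u / 3 * (3 * v)) * ker ((phi + 2 * PI) / 3) (3 * v)
        + sin (u / 3 * (3 * v)) * ker ((phi - 2 * PI) / 3) (3 * v)
        - sin (u / 3 * (3 * v)) * ker (phi / 3) (3 * v))).
      2:{ apply (improper_comp_scal (fun v => sin (u / 3 * v) * ker ((phi + 2 * PI) / 3) v
        + sin (u / 3 * v) * ker ((phi - 2 * PI) / 3) v
        - sin (u / 3 * v) * ker (phi / 3) v)); [lra|].
          apply improper_minus; [apply improper_plus|]; assumption. }
      intros v Hv. replace (u / 3 * (3 * v)) with (u * v) by field.
      rewrite <- Rmult_plus_distr_l, <- Rmult_minus_distr_l. f_equal.
      unfold ker.
      replace ((phi + 2 * PI) / 3 * (3 * v)) with (phi * v + PI * v + PI * v) by field.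
      replace ((phi - 2 * PI) / 3 * (3 * v)) with (phi * v + - (PI * v) + - (PI * v)) by field.
      replace (phi / 3 * (3 * v)) with (phi * v) by field.
      replace (PI * (3 * v)) with (PI * v + (PI * v + PI * v)) by ring.
      unfold sinh, cosh.
      rewrite !Ropp_plus_distr, !Ropp_involutive, !exp_plus.
      set (a := exp (phi * v)). set (a' := exp (- (phi * v))).
      set (e := exp (PI * v)). set (e' := exp (- (PI * v))).
      assert (He : e * e' = 1) by (unfold e, e'; rewrite <- exp_plus, Rplus_opp_r; apply exp_0).
      assert (P1 : 0 < e) by apply exp_pos. assert (P2 : 0 < e') by apply exp_pos.
      replace e' with (/ e) by (field_simplify_eq; lra).
      field. split; [|split]; try lra.
      - nra.
      - assert (0 < e ^ 2) by nra. assert (0 < e ^ 6) by (apply pow_lt; lra). nra. }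
    rewrite E, (sech_transform_triple u phi Hphi).
    assert (Hun' : u / 3 / 3 ^ n <= 1).
    { replace (u / 3 / 3 ^ n) with (u / 3 ^ S n); [exact Hun|].
      simpl. field. apply pow_nonzero; lra. }
    assert (I1 := IH (u / 3) ((phi + 2 * PI) / 3) l1 ltac:(lra) Hun' ltac:(lra) H1).
    assert (I2 := IH (u / 3) ((phi - 2 * PI) / 3) l2 ltac:(lra) Hun' ltac:(lra) H2).
    assert (I3 := IH (u / 3) (phi / 3) l3 ltac:(lra) Hun' ltac:(lra) H3).
    replace (16 * u / 3 ^ S n) with (16 * (u / 3) / 3 ^ n).
    2:{ simpl. field. apply pow_nonzero; lra. }
    apply Rabs_le. apply Rabs_le_between in I1. apply Rabs_le_between in I2. apply Rabs_le_between in I3.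
    lra.
Qed.

Lemma div_pow3_lt (c eps : R) : 0 <= c -> 0 < eps -> exists n, c / 3 ^ n < eps.
Proof.
  intros Hc He. destruct (Pow_x_infinity 3 ltac:(rewrite Rabs_pos_eq; lra) (c / eps + 1)) as [n Hn].
  exists n. specialize (Hn n (le_n n)).
  rewrite Rabs_pos_eq in Hn by (apply pow_le; lra).
  assert (H3 : 0 < 3 ^ n) by (apply pow_lt; lra).
  apply Rmult_lt_reg_r with (3 ^ n); [exact H3|].
  unfold Rdiv at 1. rewrite Rmult_assoc, Rinv_l, Rmult_1_r by lra.
  apply Rlt_le_trans with (eps * (c / eps + 1)); [|apply Rmult_le_compat_l; lra].
  replace (eps * (c / eps + 1)) with (c + eps) by (field; lra). lra.
Qed.

(** For [u >= 0] the discrepancy is at most [16 u / 3^n] for all large [n], hence zero; both sides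
    are odd in [u]. *)
Lemma sine_transform (u phi : R) : - PI < phi < PI ->
  improper (fun v => sin (u * v) * ker phi v) (sech_transform u phi).
Proof.
  intros Hphi.
  assert (Hpos : forall w, 0 <= w -> improper (fun v => sin (w * v) * ker phi v) (sech_transform w phi)).
  { intros w Hw. destruct (ex_sine_transform phi w Hphi) as [l Hl].
    replace (sech_transform w phi) with l; [exact Hl|].
    apply Rminus_diag_uniq. destruct (Req_dec (l - sech_transform w phi) 0) as [H0|H0]; [exact H0|].
    exfalso. apply Rabs_pos_lt in H0.
    destruct (div_pow3_lt w 1 Hw Rlt_0_1) as [n1 Hn1].
    destruct (div_pow3_lt (16 * w) (Rabs (l - sech_transform w phi)) ltac:(lra) H0) as [n2 Hn2].
    assert (Hle : forall c n m, 0 <= c -> (n <= m)%nat -> c / 3 ^ m <= c / 3 ^ n).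
    { intros c n m Hc Hnm. apply Rmult_le_compat_l; [exact Hc|].
      apply Rinv_le_contravar; [apply pow_lt; lra|apply Rle_pow; [lra|exact Hnm]]. }
    assert (H := sine_transform_iter (n1 + n2) w phi l Hw
      (Rle_trans _ _ _ (Hle w n1 (n1 + n2)%nat Hw ltac:(lia)) (Rlt_le _ _ Hn1)) Hphi Hl).
    assert (H' := Hle (16 * w) n2 (n1 + n2)%nat ltac:(lra) ltac:(lia)). lra. }
  destruct (Rle_dec 0 u) as [Hu|Hu]; [auto|].
  rewrite <- (Ropp_involutive u), sech_transform_opp_arg.
  apply sine_transform_opp_arg, Hpos. lra.
Qed.

(** * The transform of the pole term *)

(** The quadratic is [|t + exp (i phi)|^2]. *)
Lemma quad_pos (t phi : R) : - PI < phi < PI -> 0 <= t ->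
  0 < t ^ 2 + 2 * t * cos phi + 1.
Proof.
  intros Hp Ht.
  assert (H := cos_gt_0 (phi / 2) ltac:(lra) ltac:(lra)).
  replace (cos phi) with (2 * cos (phi / 2) * cos (phi / 2) - 1).
  2:{ rewrite <- cos_2a_cos. f_equal. field. }
  assert (0 < cos (phi / 2) ^ 2) by (apply pow_lt; exact H).
  destruct (Req_dec t 1); [subst; nra|].
  assert (0 < (t - 1) ^ 2) by (apply pow2_gt_0; lra). nra.
Qed.

Lemma sech_transform_exp (u phi : R) : - PI < phi < PI ->
  sech_transform u phi = sin (phi / 2) * exp (u / 2) * (exp u - 1)
    / (exp u ^ 2 + 2 * exp u * cos phi + 1).
Proof.
  intros Hp. assert (Hq := quad_pos (exp u) phi Hp (Rlt_le _ _ (exp_pos u))).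
  assert (H := cos_gt_0 (phi / 2) ltac:(lra) ltac:(lra)).
  unfold sech_transform, sinh.
  replace (cos phi) with (2 * cos (phi / 2) * cos (phi / 2) - 1) in *.
  2:{ rewrite <- cos_2a_cos. f_equal. field. }
  rewrite (exp_Ropp (u / 2)).
  replace (exp u) with (exp (u / 2) * exp (u / 2)) in *.
  2:{ rewrite <- exp_plus. f_equal. field. }
  assert (Hw := exp_pos (u / 2)). set (w := exp (u / 2)) in *.
  set (c := cos (phi / 2)) in *.
  assert (0 < c ^ 2) by (apply pow_lt; exact H).
  assert (0 < w ^ 2) by (apply pow_lt; exact Hw).
  field. repeat split; nra.
Qed.

Lemma Rabs_sub_le_of_derive (f f' : R -> R) (a b M : R) :
  (forall t, Rmin a b <= t <= Rmax a b -> is_derive f t (f' t)) ->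
  (forall t, Rmin a b <= t <= Rmax a b -> Rabs (f' t) <= M) ->
  Rabs (f b - f a) <= M * Rabs (b - a).
Proof.
  intros Hd HM.
  destruct (MVT_gen f a b f') as [c [Hc E]].
  - intros t Ht; apply Hd; lra.
  - intros t Ht. apply derivable_continuous_pt. exists (f' t). apply is_derive_Reals, Hd, Ht.
  - rewrite E, Rabs_mult. apply Rmult_le_compat_r; [apply Rabs_pos|]. apply HM, Hc.
Qed.

(* [v cos(vL) - sin(vL) / 2] over [1/4 + v^2] is the imaginary part of
   [exp (- i v L) / (1/2 - i v)], the pole term of zeta on the critical line. *)
Definition pole_term (L v : R) : R := (v * cos (v * L) - sin (v * L) / 2) / (/ 4 + v ^ 2).

Lemma pole_term_abs (L v : R) : 0 <= v -> Rabs (pole_term L v) <= 3.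
Proof.
  intros Hv. unfold pole_term, Rdiv at 1. assert (0 < / 4 + v ^ 2) by nra.
  rewrite Rabs_mult, Rabs_inv, (Rabs_pos_eq (/ 4 + v ^ 2)) by lra.
  apply Rmult_le_reg_r with (/ 4 + v ^ 2); [lra|].
  rewrite Rmult_assoc, Rinv_l, Rmult_1_r by lra.
  assert (H1 := SIN_bound (v * L)). assert (H2 := COS_bound (v * L)).
  assert (- v <= v * cos (v * L) <= v) by (split; nra).
  assert (0 <= (v - / 6) ^ 2) by apply pow2_ge_0.
  apply Rabs_le; split; nra.
Qed.

(** The integral from 0 to [t] of [sin (phi / 2) (s - 1) / |s + exp (i phi)|^2]. Under [t = exp x]
    it becomes a primitive of [exp (x / 2) * sech_transform x phi]. *)
Definition pole_primitive (phi t : R) : R :=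
  sin (phi / 2) / 2 * ln (t ^ 2 + 2 * t * cos phi + 1)
  - cos (phi / 2) * (atan ((t + cos phi) / sin phi) - atan (cos phi / sin phi)).

Lemma pole_primitive_derive (phi t : R) : 0 < phi < PI -> 0 <= t ->
  is_derive (pole_primitive phi) t
    (sin (phi / 2) * (t - 1) / (t ^ 2 + 2 * t * cos phi + 1)).
Proof.
  intros Hp Ht. assert (Hq := quad_pos t phi ltac:(lra) Ht).
  assert (Hs := sin_gt_0 phi (proj1 Hp) (proj2 Hp)).
  unfold pole_primitive. auto_derive; [lra|].
  assert (Hcs : cos phi ^ 2 = 1 - sin phi ^ 2).
  { assert (H := sin2_cos2 phi). unfold Rsqr in H. lra. }
  assert (E1 : cos phi = 2 * cos (phi / 2) ^ 2 - 1).
  { replace phi with (2 * (phi / 2)) at 1 by field. rewrite cos_2a_cos. ring. }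
  assert (E2 : sin phi = 2 * sin (phi / 2) * cos (phi / 2)).
  { replace phi with (2 * (phi / 2)) at 1 by field. apply sin_2a. }
  assert (Hd : 1 + ((t + cos phi) * / sin phi) ^ 2 = (t ^ 2 + 2 * t * cos phi + 1) / sin phi ^ 2).
  { replace (t ^ 2 + 2 * t * cos phi + 1) with ((t + cos phi) ^ 2 + sin phi ^ 2) by nra.
    field. lra. }
  replace (t * (t * 1)) with (t ^ 2) by ring.
  replace ((t + cos phi) * / sin phi * ((t + cos phi) * / sin phi * 1)) with (((t + cos phi) * / sin phi) ^ 2) by ring.
  rewrite ?Rdiv_def, ?Hd.
  transitivity ((sin (phi / 2) * (t + cos phi) - cos (phi / 2) * sin phi) / (t ^ 2 + 2 * t * cos phi + 1)).
  - change (phi * / 2) with (phi / 2). field. split; lra.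
  - change (phi * / 2) with (phi / 2). unfold Rdiv. apply (f_equal (fun x => x * _)).
    change (phi * / 2) with (phi / 2). rewrite E2, E1. ring.
Qed.

Lemma pole_primitive_0 (phi : R) : pole_primitive phi 0 = 0.
Proof.
  unfold pole_primitive. rewrite Rplus_0_l.
  replace (0 ^ 2 + 2 * 0 * cos phi + 1) with 1 by ring. rewrite ln_1. ring.
Qed.

Lemma ex_pole_transform (phi L : R) : - PI < phi < PI ->
  exists l, improper (fun v => pole_term L v * ker phi v) l.
Proof.
  intros Hp. apply (ex_improper _ (PI - Rabs phi) 3).
  - assert (Rabs phi < PI) by (apply Rabs_def1; lra). lra.
  - intros b _. apply ex_RInt_of_derivable. intros v.
    unfold pole_term. auto_derive.
    split; [|auto using ker_derivable]. nra.
  - intros v Hv. rewrite Rabs_mult.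
    apply Rmult_le_compat; auto using Rabs_pos, pole_term_abs, ker_abs.
Qed.

(** The factor [exp (L / 2)] turns [pole_term] into the imaginary part of
    [exp ((1/2 - i v) L) / (1/2 - i v)], whose derivative in [L] has imaginary part
    [- exp (L / 2) sin (L v)], with no denominator left. The remainder is second order in [h] and
    only linear in [v], hence integrable against [ker]; this licenses differentiation under the
    integral. *)
Lemma pole_term_taylor (L h v : R) : Rabs h <= 1 -> 0 <= v ->
  Rabs (exp ((L + h) / 2) * pole_term (L + h) v - exp (L / 2) * pole_term L v
    + h * (exp (L / 2) * sin (L * v))) <= h ^ 2 * exp ((L + 1) / 2) * (/ 2 + v).
Proof.
  intros Hh Hv. set (M := exp ((L + 1) / 2) * (/ 2 + v)).
  assert (HM : 0 <= M).
  { unfold M. apply Rmult_le_pos; [left; apply exp_pos|lra]. }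
  assert (Hs : forall x, Rabs (x - L) <= 1 ->
    Rabs (exp (x / 2) * sin (v * x) - exp (L / 2) * sin (v * L)) <= M * Rabs (x - L)).
  { intros x Hx.
    apply (Rabs_sub_le_of_derive (fun x => exp (x / 2) * sin (v * x))
      (fun x => exp (x / 2) * (sin (v * x) / 2 + v * cos (v * x)))).
    - intros t _. auto_derive; auto. unfold Rdiv. field.
    - intros t Ht. rewrite Rabs_mult, Rabs_pos_eq by (left; apply exp_pos).
      unfold M. apply Rmult_le_compat; [left; apply exp_pos|apply Rabs_pos| |].
      + apply exp_le_compat.
        assert (t <= L + 1).
        { destruct Ht as [_ Ht]. eapply Rle_trans; [exact Ht|].
          apply Rabs_le_between in Hx. apply Rmax_lub; lra. }
        lra.
      + assert (H1 := SIN_bound (v * t)). assert (H2 := COS_bound (v * t)).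
        apply Rabs_le; split; nra. }
  replace (exp ((L + h) / 2) * pole_term (L + h) v - exp (L / 2) * pole_term L v
    + h * (exp (L / 2) * sin (L * v)))
   with ((fun x => exp (x / 2) * pole_term x v + x * (exp (L / 2) * sin (v * L))) (L + h)
       - (fun x => exp (x / 2) * pole_term x v + x * (exp (L / 2) * sin (v * L))) L)
   by (simpl; rewrite (Rmult_comm L v); ring).
  eapply Rle_trans.
  - apply (Rabs_sub_le_of_derive (fun x => exp (x / 2) * pole_term x v + x * (exp (L / 2) * sin (v * L))) (fun x => - (exp (x / 2) * sin (v * x) - exp (L / 2) * sin (v * L))) L (L + h) (M * Rabs h)).
    + intros t _. unfold pole_term. auto_derive; auto. unfold Rdiv. field. nra.
    + intros t Ht. rewrite Rabs_Ropp.
      assert (Htl : Rabs (t - L) <= Rabs h).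
      { revert Ht. unfold Rmin, Rmax, Rabs. destruct (Rle_dec L (L + h)); destruct (Rcase_abs (t - L)), (Rcase_abs h); lra. }
      eapply Rle_trans; [apply Hs; lra|]. apply Rmult_le_compat_l; assumption.
  - replace (L + h - L) with h by ring. right.
    rewrite Rmult_assoc, <- Rabs_mult, Rabs_pos_eq by nra. unfold M. ring.
Qed.

(** Differentiating [exp (L / 2)] times the transform in [L] reduces it to the sine transform
    already known, which is minus the derivative of [pole_primitive phi (exp L)]. The two therefore
    have a constant sum [D]. As [L] tends to minus infinity the transform stays bounded and both
    parts of [D] vanish, so the constant is 0. *)
Lemma pole_transform (phi L : R) : 0 < phi < PI ->
  improper (fun v => pole_term L v * ker phi v) (- exp (- L / 2) * pole_primitive phi (exp L)).
Proof.
  intros Hp.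
  set (B := fun L => real (Lim (fun b => RInt (fun v => pole_term L v * ker phi v) 0 b) p_infty)).
  assert (HB : forall L, improper (fun v => pole_term L v * ker phi v) (B L)).
  { intros x. destruct (ex_pole_transform phi x ltac:(lra)) as [l Hl].
    replace (B x) with l; [exact Hl|]. symmetry.
    exact (improper_Lim _ _ Hl). }
  set (a := PI - phi). assert (Ha : 0 < a) by (unfold a; lra).
  assert (Hker : forall v, 0 <= v -> Rabs (ker phi v) <= exp (- a * v)).
  { intros v Hv. assert (H := ker_abs phi v Hv). rewrite (Rabs_pos_eq phi) in H by lra. exact H. }
  assert (HBb : forall x, Rabs (B x) <= 3 * / a).
  { intros x. apply (improper_abs_le (fun v => pole_term x v * ker phi v) (fun v => 3 * exp (- a * v))); auto.
    - intros v Hv. rewrite Rabs_mult. 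
      apply Rmult_le_compat; auto using Rabs_pos. apply pole_term_abs; lra. apply Hker; lra.
    - apply improper_scal, improper_exp, Ha. }
  set (G := fun L => exp (L / 2) * B L).
  assert (HG : forall x, is_derive G x (- (exp (x / 2) * sech_transform x phi))).
  (* [K] integrates the remainder bound of [pole_term_taylor] against [exp (- a v)]; the difference
     quotient is then off by at most [|h| K]. *)
  { intros x. set (K := exp ((x + 1) / 2) * (/ 2 * / a + / a ^ 2)).
    assert (HK : forall h, Rabs h <= 1 ->
      Rabs (G (x + h) - G x + h * (exp (x / 2) * sech_transform x phi)) <= h ^ 2 * K).
    { intros h Hh. 
      apply (improper_abs_le (fun v => (exp ((x + h) / 2) * (pole_term (x + h) v * ker phi v)
          - exp (x / 2) * (pole_term x v * ker phi v))
          + h * (exp (x / 2) * (sin (x * v) * ker phi v)))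
        (fun v => h ^ 2 * (exp ((x + 1) / 2) * (/ 2 * exp (- a * v) + v * exp (- a * v))))).
      - intros v Hv.
        replace (exp ((x + h) / 2) * (pole_term (x + h) v * ker phi v)
          - exp (x / 2) * (pole_term x v * ker phi v)
          + h * (exp (x / 2) * (sin (x * v) * ker phi v)))
         with ((exp ((x + h) / 2) * pole_term (x + h) v - exp (x / 2) * pole_term x v
            + h * (exp (x / 2) * sin (x * v))) * ker phi v) by ring.
        rewrite Rabs_mult.
        replace (h ^ 2 * (exp ((x + 1) / 2) * (/ 2 * exp (- a * v) + v * exp (- a * v))))
          with (h ^ 2 * exp ((x + 1) / 2) * (/ 2 + v) * exp (- a * v)) by ring.
        apply Rmult_le_compat; auto using Rabs_pos.
        + apply pole_term_taylor; lra.
        + apply Hker; lra.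
      - unfold G. apply improper_plus; [apply improper_minus; apply improper_scal, HB|].
        apply improper_scal, improper_scal, sine_transform; lra.
      - unfold K. apply improper_scal, improper_scal, improper_plus; [apply improper_scal, improper_exp|apply improper_id_exp]; exact Ha. }
    apply is_derive_Reals. intros eps Heps.
    assert (HK0 : 0 <= K).
    { unfold K. apply Rmult_le_pos; [left; apply exp_pos|].
      assert (0 < / a) by (apply Rinv_0_lt_compat; lra).
      assert (0 < / a ^ 2) by (apply Rinv_0_lt_compat, pow_lt; lra). lra. }
    assert (Hd : 0 < Rmin 1 (eps / (K + 1))).
    { apply Rmin_pos; [lra|]. apply Rdiv_lt_0_compat; lra. }
    exists (mkposreal _ Hd). intros h Hh0 Hh. simpl in Hh.
    assert (Hh1 : Rabs h < 1) by (eapply Rlt_le_trans; [exact Hh|apply Rmin_l]).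
    assert (Hh2 : Rabs h < eps / (K + 1)) by (eapply Rlt_le_trans; [exact Hh|apply Rmin_r]).
    replace ((G (x + h) - G x) / h - - (exp (x / 2) * sech_transform x phi))
      with ((G (x + h) - G x + h * (exp (x / 2) * sech_transform x phi)) / h) by (field; exact Hh0).
    unfold Rdiv. rewrite Rabs_mult, Rabs_inv.
    assert (Hh3 : 0 < Rabs h) by (apply Rabs_pos_lt, Hh0).
    apply Rle_lt_trans with (Rabs h * K).
    - apply Rmult_le_reg_r with (Rabs h); [exact Hh3|].
      rewrite Rmult_assoc, Rinv_l, Rmult_1_r by lra.
      eapply Rle_trans; [apply HK; lra|]. rewrite <- (pow2_abs h). right; ring.
    - apply Rle_lt_trans with (Rabs h * (K + 1)); [nra|].
      apply Rlt_le_trans with (eps / (K + 1) * (K + 1)); [apply Rmult_lt_compat_r; lra|].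
      right; field; lra. }
  set (D := fun x => G x + pole_primitive phi (exp x)).
  assert (HD : forall x, is_derive D x 0).
  { intros x. unfold D.
    replace 0 with (plus (- (exp (x / 2) * sech_transform x phi))
       (scal (exp x) (sin (phi / 2) * (exp x - 1) / (exp x ^ 2 + 2 * exp x * cos phi + 1)))).
    - apply (is_derive_plus (V := R_NormedModule) G (fun x => pole_primitive phi (exp x))); [apply HG|].
      apply (is_derive_comp (V := R_NormedModule) (pole_primitive phi) exp).
      + apply pole_primitive_derive; [exact Hp|left; apply exp_pos].
      + apply is_derive_Reals, derivable_pt_lim_exp.
    - rewrite sech_transform_exp by lra.
      assert (Hq := quad_pos (exp x) phi ltac:(lra) (Rlt_le _ _ (exp_pos x))).
      unfold plus, scal; simpl; unfold mult; simpl.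
      replace (exp x) with (exp (x / 2) * exp (x / 2)) in *.
      2:{ rewrite <- exp_plus. f_equal. field. }
      field. lra. }
  assert (Hconst : forall x y, D x = D y).
  { intros x y. assert (H := Rabs_sub_le_of_derive D (fun _ => 0) y x 0 (fun t _ => HD t)
      (fun _ _ => Req_le _ _ Rabs_R0)).
    rewrite Rmult_0_l in H. assert (H1 := Rabs_pos (D x - D y)).
    assert (H2 : Rabs (D x - D y) = 0) by lra. apply Rminus_diag_uniq.
    destruct (Req_dec (D x - D y) 0) as [E|E]; [exact E|]. apply Rabs_no_R0 in E. lra. }
  assert (HlimG : filterlim G (Rbar_locally m_infty) (locally 0)).
  { assert (He : forall k, filterlim (fun x => k * exp (x / 2)) (Rbar_locally m_infty) (locally 0)).
    { intros k. replace 0 with (k * 0) by ring.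
      eapply filterlim_comp; [|apply (@filterlim_scal_r R_AbsRing R_NormedModule)].
      apply (filterlim_comp _ _ _ (fun x => x / 2) exp _ (Rbar_locally m_infty)); [|exact is_lim_exp_m].
      intros P [M HM]. exists (2 * M). intros x Hx. apply HM. lra. }
    refine (filterlim_le_le _ _ _ (Finite 0) _ (He (- (3 * / a))) (He (3 * / a))).
    apply filter_forall. intros x. unfold G. assert (H := HBb x). apply Rabs_le_between in H.
    assert (H1 := exp_pos (x / 2)). nra. }
  assert (HlimE : filterlim (fun x => pole_primitive phi (exp x)) (Rbar_locally m_infty) (locally 0)).
  { eapply filterlim_comp; [exact is_lim_exp_m|].
    assert (Hc : continuous (pole_primitive phi) 0).
    { apply (ex_derive_continuous (V := R_NormedModule)). eexists. apply pole_primitive_derive; lra. }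
    unfold continuous in Hc. rewrite pole_primitive_0 in Hc. exact Hc. }
  assert (HD0 : D L = 0).
  { apply (@filterlim_locally_unique R R_AbsRing R_NormedModule (Rbar_locally m_infty) _ D).
    - apply (filterlim_ext (fun _ => D L)); [intros y; apply Hconst|apply filterlim_const].
    - replace 0 with (plus 0 0) by (unfold plus; simpl; ring).
      eapply filterlim_comp_2; [exact HlimG|exact HlimE|].
      apply (@filterlim_plus R_AbsRing R_NormedModule). }
  replace (- exp (- L / 2) * pole_primitive phi (exp L)) with (B L); [apply HB|].
  unfold D, G in HD0.
  assert (E : exp (- L / 2) * exp (L / 2) = 1).
  { rewrite <- exp_plus. replace (- L / 2 + L / 2) with 0 by field. apply exp_0. }
  replace (pole_primitive phi (exp L)) with (- (exp (L / 2) * B L)) by lra.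
  replace (- exp (- L / 2) * - (exp (L / 2) * B L)) with (exp (- L / 2) * exp (L / 2) * B L) by ring.
  rewrite E. ring.
Qed.

Lemma is_lim_Rinv_p_infty : is_lim (fun t => / t) p_infty 0.
Proof. apply (is_lim_inv (fun t => t) p_infty p_infty); [apply is_lim_id|discriminate]. Qed.

Lemma is_lim_atan_p_infty : is_lim atan p_infty (PI / 2).
Proof.
  apply (filterlim_ext_loc (fun t => PI / 2 - atan (/ t))).
  - exists 0. intros t Ht.
    rewrite <- (atan_inv (/ t)), Rinv_inv by (apply Rinv_0_lt_compat, Ht). reflexivity.
  - apply (filterlim_comp _ _ _ (fun t => / t) (fun x => PI / 2 - atan x) _ (locally 0));
      [exact is_lim_Rinv_p_infty|].
    replace (Rbar_locally (PI / 2)) with (locally (PI / 2 - atan 0)).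
    + apply (ex_derive_continuous (V := R_NormedModule) (fun x => PI / 2 - atan x)).
      auto_derive. auto.
    + rewrite atan_0, Rminus_0_r. reflexivity.
Qed.

(** The logarithm behaves like [2 ln t], and the arctangents differ in the limit by
    [PI/2 - (PI/2 - phi) = phi]. *)
Lemma pole_primitive_infty (phi : R) : 0 < phi < PI ->
  filterlim (fun t => pole_primitive phi t - sin (phi / 2) * ln t) (Rbar_locally p_infty)
    (locally (- phi * cos (phi / 2))).
Proof.
  intros Hp. assert (Hs := sin_gt_0 phi (proj1 Hp) (proj2 Hp)).
  assert (Hat : atan (cos phi / sin phi) = PI / 2 - phi).
  { rewrite <- (atan_tan (PI / 2 - phi)) by lra. f_equal.
    unfold tan. rewrite sin_shift, cos_shift. reflexivity. }
  assert (H1 : is_lim (fun t => ln (1 + 2 * cos phi * / t + / t * / t)) p_infty 0).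
  { replace 0 with (ln (1 + 2 * cos phi * 0 + 0 * 0)) by (replace (1 + 2 * cos phi * 0 + 0 * 0) with 1 by ring; apply ln_1).
    apply (filterlim_comp _ _ _ (fun t => / t) (fun x => ln (1 + 2 * cos phi * x + x * x)) _ (locally 0)); [exact is_lim_Rinv_p_infty|].
    apply (ex_derive_continuous (V := R_NormedModule) (fun x => ln (1 + 2 * cos phi * x + x * x))).
    auto_derive. lra. }
  assert (H2 : is_lim (fun t => atan ((t + cos phi) / sin phi)) p_infty (PI / 2)).
  { apply (filterlim_comp _ _ _ (fun t => (t + cos phi) / sin phi) atan _ (Rbar_locally p_infty)).
    - intros P [M HM]. exists (M * sin phi - cos phi). intros x Hx. apply HM.
      apply Rmult_lt_reg_r with (sin phi); [exact Hs|]. unfold Rdiv.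
      rewrite Rmult_assoc, Rinv_l, Rmult_1_r by lra. lra.
    - exact is_lim_atan_p_infty. }
  apply (filterlim_ext_loc (fun t => plus (scal (sin (phi / 2) / 2) (ln (1 + 2 * cos phi * / t + / t * / t)))
     (plus (scal (- cos (phi / 2)) (atan ((t + cos phi) / sin phi))) (cos (phi / 2) * (PI / 2 - phi))))).
  - exists 0. intros t Ht. unfold plus, scal; simpl; unfold mult; simpl.
    assert (Hq := quad_pos t phi ltac:(lra) (Rlt_le _ _ Ht)).
    replace (1 + 2 * cos phi * / t + / t * / t) with ((t ^ 2 + 2 * t * cos phi + 1) / (t * t)) by (field; exact (Rgt_not_eq _ _ Ht)).
    rewrite ln_div, ln_mult by nra. unfold pole_primitive. rewrite Hat. field.
  - replace (- phi * cos (phi / 2)) with (plus (scal (sin (phi / 2) / 2) 0)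
     (plus (scal (- cos (phi / 2)) (PI / 2)) (cos (phi / 2) * (PI / 2 - phi)))).
    2:{ unfold plus, scal; simpl; unfold mult; simpl. field. }
    eapply filterlim_comp_2; [| |apply (@filterlim_plus R_AbsRing R_NormedModule)].
    + eapply filterlim_comp; [exact H1|apply (@filterlim_scal_r R_AbsRing R_NormedModule)].
    + eapply filterlim_comp_2; [| |apply (@filterlim_plus R_AbsRing R_NormedModule)].
      * eapply filterlim_comp; [exact H2|apply (@filterlim_scal_r R_AbsRing R_NormedModule)].
      * apply filterlim_const.
Qed.

(** * Power series expansions with uniform bounds *)

(* A Taylor expansion at [x0] with Cauchy-type bounds; the bound [M] is what makes
   expansions summable over a family. *)
Definition expansion (alpha : nat -> R) (f : R -> R) (x0 M r : R) : Prop :=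
  (forall j, Rabs (alpha j) * r ^ j <= M) /\
  (forall h, Rabs h <= r / 2 -> is_series (fun j => alpha j * h ^ j) (f (x0 + h))).

Lemma half_pow_lim (M : R) : is_lim_seq (fun J => M * (/ 2) ^ J) 0.
Proof.
  replace (Finite 0) with (Rbar_mult M 0) by (simpl; f_equal; ring).
  apply is_lim_seq_scal_l, is_lim_seq_geom. rewrite Rabs_pos_eq; lra.
Qed.

Lemma expansion_coef_le (alpha : nat -> R) (f : R -> R) (x0 M r h : R) (j : nat) : 0 < r ->
  expansion alpha f x0 M r -> Rabs h <= r / 2 -> Rabs (alpha j * h ^ j) <= M * (/ 2) ^ j.
Proof.
  intros Hr [Ha _] Hh. rewrite Rabs_mult, <- RPow_abs.
  apply Rle_trans with (Rabs (alpha j) * (r * / 2) ^ j).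
  - apply Rmult_le_compat_l; [apply Rabs_pos|]. apply pow_incr. split; [apply Rabs_pos|lra].
  - rewrite Rpow_mult_distr, <- Rmult_assoc. apply Rmult_le_compat_r; [apply pow_le; lra|apply Ha].
Qed.

(** At half the radius the terms are at most [M / 2^j], so the tail after [J] is at most [M / 2^J].
    Since [M] is explicit and [h] does not occur in the bound, it can be summed or integrated over a
    family. *)
Lemma expansion_tail (alpha : nat -> R) (f : R -> R) (x0 M r h : R) (J : nat) : 0 < r ->
  expansion alpha f x0 M r -> Rabs h <= r / 2 ->
  Rabs (f (x0 + h) - sum_n (fun j => alpha j * h ^ j) J) <= M * (/ 2) ^ J.
Proof.
  intros Hr He Hh.
  assert (HM : 0 <= M).
  { destruct He as [Ha _]. specialize (Ha O). rewrite Rmult_1_r in Ha.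
    assert (H := Rabs_pos (alpha O)). lra. }
  assert (Hs := proj2 He h Hh).
  assert (Hk : forall k, Rabs (sum_n (fun j => alpha j * h ^ j) (J + k) - sum_n (fun j => alpha j * h ^ j) J)
     <= M * (/ 2) ^ J - M * (/ 2) ^ (J + k)).
  { induction k as [|k IH].
    - rewrite Nat.add_0_r, !Rminus_diag, Rabs_R0. lra.
    - rewrite Nat.add_succ_r, sum_Sn. unfold plus; simpl.
      assert (H := expansion_coef_le alpha f x0 M r h (S (J + k)) Hr He Hh). simpl in H.
      set (A := sum_n _ (J + k)) in *. set (B := sum_n _ J) in *.
      set (c := alpha (S (J + k)) * (h * h ^ (J + k))) in *.
      replace (A + c - B) with ((A - B) + c) by ring.
      eapply Rle_trans; [apply Rabs_triang|]. lra. }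
  assert (Hl : is_lim_seq (fun k => Rabs (sum_n (fun j => alpha j * h ^ j) (k + J) - sum_n (fun j => alpha j * h ^ j) J))
    (Rabs (f (x0 + h) - sum_n (fun j => alpha j * h ^ j) J))).
  { apply (is_lim_seq_abs (fun k => sum_n (fun j => alpha j * h ^ j) (k + J) - sum_n (fun j => alpha j * h ^ j) J) (Finite _)).
    apply is_lim_seq_minus'; [|apply is_lim_seq_const].
    apply -> is_lim_seq_incr_n. exact Hs. }
  apply (is_lim_seq_le (fun k => Rabs (sum_n (fun j => alpha j * h ^ j) (k + J) - sum_n (fun j => alpha j * h ^ j) J))
    (fun _ => M * (/ 2) ^ J) (Finite _) (Finite _)); [|exact Hl|apply is_lim_seq_const].
  intros k. rewrite Nat.add_comm. eapply Rle_trans; [apply Hk|].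
  assert (0 <= M * (/ 2) ^ (J + k)) by (apply Rmult_le_pos; [exact HM|apply pow_le; lra]). lra.
Qed.

Lemma expansion_abs (alpha : nat -> R) (f : R -> R) (x0 M r h : R) : 0 < r ->
  expansion alpha f x0 M r -> Rabs h <= r / 2 -> Rabs (f (x0 + h)) <= 2 * M.
Proof.
  intros Hr He Hh. assert (H := expansion_tail alpha f x0 M r h 0 Hr He Hh).
  assert (H1 := expansion_coef_le alpha f x0 M r h 0 Hr He Hh).
  rewrite sum_O in H. rewrite pow_O, Rmult_1_r in H, H1.
  apply Rabs_le_between in H. apply Rabs_le_between in H1. simpl in *. apply Rabs_le; lra.
Qed.

Lemma is_series_of_tail (a : nat -> R) (l M : R) :
  (forall J, Rabs (l - sum_n a J) <= M * (/ 2) ^ J) -> is_series a l.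
Proof.
  intros H. change (is_lim_seq (sum_n a) l).
  apply (is_lim_seq_ext (fun J => l - (l - sum_n a J))); [intros; ring|].
  replace (Finite l) with (Finite (l - 0)) by (f_equal; ring).
  apply is_lim_seq_minus'; [apply is_lim_seq_const|].
  apply (is_lim_seq_le_le (fun J => - (M * (/ 2) ^ J)) _ (fun J => M * (/ 2) ^ J)).
  - intros J; apply Rabs_le_between, H.
  - replace (Finite 0) with (Rbar_opp 0) by (simpl; f_equal; ring).
    apply -> is_lim_seq_opp. apply half_pow_lim.
  - apply half_pow_lim.
Qed.

Lemma Series_sum_n (a : nat -> nat -> R) (J : nat) :
  (forall j, ex_series (fun n => a n j)) ->
  is_series (fun n => sum_n (a n) J) (sum_n (fun j => Series (fun n => a n j)) J).
Proof.
  intros H. induction J as [|J IH].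
  - rewrite sum_O. apply (is_series_ext (fun n => a n O)); [intros n; rewrite sum_O; reflexivity|].
    apply Series_correct, H.
  - rewrite sum_Sn. apply (is_series_ext (fun n => plus (sum_n (a n) J) (a n (S J)))).
    + intros n; rewrite sum_Sn; reflexivity.
    + apply (is_series_plus (V := R_NormedModule)); [exact IH|apply Series_correct, H].
Qed.

Lemma ex_series_Rabs_le (a b : nat -> R) :
  (forall n, Rabs (a n) <= b n) -> ex_series b -> ex_series a.
Proof. intros H. apply (ex_series_le (V := R_CompleteNormedModule) a b H). Qed.

Lemma Series_Rabs_le (a b : nat -> R) :
  (forall n, Rabs (a n) <= b n) -> ex_series b -> Rabs (Series a) <= Series b.
Proof.
  intros H Hb. assert (Ha : ex_series (fun n => Rabs (a n))).
  { apply (ex_series_Rabs_le _ b); [|exact Hb]. intros n; rewrite Rabs_Rabsolu; apply H. }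
  eapply Rle_trans; [apply Series_Rabs, Ha|]. apply Series_le; [|exact Hb].
  intros n; split; [apply Rabs_pos|apply H].
Qed.

Lemma expansion_series_ex (alpha : nat -> nat -> R) (f : nat -> R -> R) (x0 r h : R) (M : nat -> R) :
  0 < r -> (forall n, expansion (alpha n) (f n) x0 (M n) r) -> ex_series M ->
  Rabs h <= r / 2 -> ex_series (fun n => f n (x0 + h)).
Proof.
  intros Hr He HM Hh. apply (ex_series_Rabs_le _ (fun n => 2 * M n)).
  - intros n. apply (expansion_abs (alpha n)) with r; auto.
  - apply (ex_series_scal 2 M HM).
Qed.

(** The interchange of the two sums avoids double series: the sum over [n] commutes with partial
    sums in [j], and the remainders [M n / 2^J] are summable in [n]. [expansion_RInt] follows the
    same scheme with an integral. *)
Lemma expansion_series (alpha : nat -> nat -> R) (f : nat -> R -> R) (x0 r : R) (M : nat -> R) :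
  0 < r -> (forall n, expansion (alpha n) (f n) x0 (M n) r) -> ex_series M ->
  expansion (fun j => Series (fun n => alpha n j)) (fun x => Series (fun n => f n x)) x0 (Series M) r.
Proof.
  intros Hr He HM.
  assert (Hpow : forall j, 0 < r ^ j) by (intros; apply pow_lt, Hr).
  assert (Hc : forall j, ex_series (fun n => alpha n j)).
  { intros j. apply (ex_series_Rabs_le _ (fun n => / r ^ j * M n)).
    - intros n. apply Rmult_le_reg_r with (r ^ j); [apply Hpow|].
      rewrite (Rmult_comm (/ _)), Rmult_assoc, Rinv_l, Rmult_1_r by (apply Rgt_not_eq, Hpow).
      apply He.
    - apply (ex_series_scal (/ r ^ j) M HM). }
  split.
  - intros j. rewrite <- (Rabs_pos_eq (r ^ j)) by (left; apply Hpow).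
    rewrite <- Rabs_mult, <- Series_scal_r. apply Series_Rabs_le; [|exact HM].
    intros n. rewrite Rabs_mult, (Rabs_pos_eq (r ^ j)) by (left; apply Hpow). apply He.
  - intros h Hh. apply is_series_of_tail with (Series M). intros J.
    assert (Hcj : forall j, ex_series (fun n => alpha n j * h ^ j)).
    { intros j. apply ex_series_scal_r, Hc. }
    assert (Hsum := Series_sum_n (fun n j => alpha n j * h ^ j) J Hcj).
    replace (sum_n (fun j => Series (fun n => alpha n j) * h ^ j) J)
      with (Series (fun n => sum_n (fun j => alpha n j * h ^ j) J)).
    2:{ rewrite (is_series_unique _ _ Hsum). apply sum_n_ext. intros j. apply Series_scal_r. }
    assert (Hf := expansion_series_ex alpha f x0 r h M Hr He HM Hh).
    rewrite <- Series_minus; [|exact Hf|eexists; exact Hsum].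
    rewrite <- Series_scal_r. apply Series_Rabs_le.
    + intros n. apply (expansion_tail (alpha n)) with r; auto.
    + apply ex_series_scal_r, HM.
Qed.

Lemma sum_n_RInt (a : R -> nat -> R) (J : nat) (u v : R) :
  (forall j, ex_RInt (fun x => a x j) u v) ->
  is_RInt (fun x => sum_n (a x) J) u v (sum_n (fun j => RInt (fun x => a x j) u v) J).
Proof.
  intros H. induction J as [|J IH].
  - rewrite sum_O. apply (is_RInt_ext (fun x => a x O)); [intros x _; rewrite sum_O; reflexivity|].
    apply (RInt_correct (fun x => a x O)), H.
  - rewrite sum_Sn. apply (is_RInt_ext (fun x => plus (sum_n (a x) J) (a x (S J)))).
    + intros x _; rewrite sum_Sn; reflexivity.
    + apply (is_RInt_plus (V := R_NormedModule)); [exact IH|apply (RInt_correct (fun x => a x (S J))), H].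
Qed.

Lemma expansion_RInt (alpha : R -> nat -> R) (f : R -> R -> R) (x0 r M : R) :
  0 < r -> (forall x, 0 <= x <= 1 -> expansion (alpha x) (f x) x0 M r) ->
  (forall j, ex_RInt (fun x => alpha x j) 0 1) ->
  (forall h, Rabs h <= r / 2 -> ex_RInt (fun x => f x (x0 + h)) 0 1) ->
  expansion (fun j => RInt (fun x => alpha x j) 0 1) (fun s => RInt (fun x => f x s) 0 1) x0 M r.
Proof.
  intros Hr He Hex Hf.
  assert (Hpow : forall j, 0 < r ^ j) by (intros; apply pow_lt, Hr).
  split.
  - intros j. apply Rmult_le_reg_r with (/ r ^ j); [apply Rinv_0_lt_compat, Hpow|].
    rewrite Rmult_assoc, Rinv_r, Rmult_1_r by (apply Rgt_not_eq, Hpow).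
    eapply Rle_trans; [apply (abs_RInt_le_const _ 0 1 (M * / r ^ j)); auto; [lra|]|lra].
    intros t Ht. apply Rmult_le_reg_r with (r ^ j); [apply Hpow|].
    rewrite Rmult_assoc, Rinv_l, Rmult_1_r by (apply Rgt_not_eq, Hpow). apply He, Ht.
  - intros h Hh. apply is_series_of_tail with M. intros J.
    assert (Hcj : forall j, ex_RInt (fun x => alpha x j * h ^ j) 0 1).
    { intros j. apply (ex_RInt_ext (fun x => scal (h ^ j) (alpha x j))); [intros; apply Rmult_comm|].
      apply (ex_RInt_scal (fun x => alpha x j)), Hex. }
    assert (Hsum := sum_n_RInt (fun x j => alpha x j * h ^ j) J 0 1 Hcj).
    replace (sum_n (fun j => RInt (fun x => alpha x j) 0 1 * h ^ j) J)
      with (sum_n (fun j => RInt (fun x => alpha x j * h ^ j) 0 1) J).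
    2:{ apply sum_n_ext. intros j. rewrite Rmult_comm. transitivity (RInt (fun x => scal (h ^ j) (alpha x j)) 0 1).
        { apply RInt_ext. intros; apply Rmult_comm. }
        apply (RInt_scal (fun x => alpha x j) 0 1 (h ^ j) (Hex j)). }
    assert (Hd := is_RInt_minus _ _ _ _ _ _ (RInt_correct _ _ _ (Hf h Hh)) Hsum).
    eapply Rle_trans; [apply (norm_RInt_le_const (V := R_NormedModule)
        (fun x => minus (f x (x0 + h)) (sum_n (fun j => alpha x j * h ^ j) J)) 0 1 _ (M * (/ 2) ^ J));
      [lra| |exact Hd]|lra].
    intros x Hx. apply (expansion_tail (alpha x)) with r; auto.
Qed.

Lemma expansion_scal (c : R) (alpha : nat -> R) (f : R -> R) (x0 M r : R) :
  expansion alpha f x0 M r -> expansion (fun j => c * alpha j) (fun x => c * f x) x0 (Rabs c * M) r.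
Proof.
  intros [Ha Hs]; split.
  - intros j. rewrite Rabs_mult, Rmult_assoc. apply Rmult_le_compat_l; [apply Rabs_pos|apply Ha].
  - intros h Hh. apply (is_series_ext (fun j => scal c (alpha j * h ^ j))).
    + intros j. unfold scal; simpl; unfold mult; simpl. ring.
    + apply (is_series_scal (V := R_NormedModule)), Hs, Hh.
Qed.

Lemma expansion_plus (alpha beta : nat -> R) (f g : R -> R) (x0 M N r : R) : 0 < r ->
  expansion alpha f x0 M r -> expansion beta g x0 N r ->
  expansion (fun j => alpha j + beta j) (fun x => f x + g x) x0 (M + N) r.
Proof.
  intros Hr [Ha Hs] [Hb Ht]; split.
  - intros j. assert (0 < r ^ j) by (apply pow_lt, Hr).
    specialize (Ha j); specialize (Hb j). assert (H1 := Rabs_triang (alpha j) (beta j)). nra.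
  - intros h Hh. apply (is_series_ext (fun j => plus (alpha j * h ^ j) (beta j * h ^ j))).
    + intros j. unfold plus; simpl. ring.
    + apply (is_series_plus (V := R_NormedModule)); auto.
Qed.

Lemma expansion_weaken (alpha : nat -> R) (f : R -> R) (x0 M N r : R) :
  M <= N -> expansion alpha f x0 M r -> expansion alpha f x0 N r.
Proof. intros HMN [Ha Hs]; split; [intros j; eapply Rle_trans; [apply Ha|exact HMN]|exact Hs]. Qed.

Lemma expansion_ext (alpha : nat -> R) (f g : R -> R) (x0 M r : R) :
  (forall x, f x = g x) -> expansion alpha f x0 M r -> expansion alpha g x0 M r.
Proof. intros Hfg [Ha Hs]; split; [exact Ha|]. intros h Hh. rewrite <- Hfg. auto. Qed.

Lemma pow_div_fact_le_exp (y : R) (j : nat) : 0 <= y -> y ^ j / INR (Factorial.fact j) <= exp y.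
Proof.
  intros Hy.
  assert (Hs := proj1 (is_pseries_R _ _ _) (is_exp_Reals y)).
  assert (Hp : forall n, 0 <= / INR (Factorial.fact n) * y ^ n).
  { intros n. apply Rmult_le_pos; [left; apply Rinv_0_lt_compat, INR_fact_lt_0|apply pow_le, Hy]. }
  assert (Hle : forall n, (j <= n)%nat -> y ^ j / INR (Factorial.fact j) <= sum_n (fun n => / INR (Factorial.fact n) * y ^ n) n).
  { intros n Hn. induction Hn.
    - destruct j as [|j]; [rewrite sum_O; unfold Rdiv; lra|]. rewrite sum_Sn. unfold plus; simpl plus.
      assert (0 <= sum_n (fun n => / INR (Factorial.fact n) * y ^ n) j).
      { clear Hs. induction j; [rewrite sum_O; apply Hp|rewrite sum_Sn; apply Rplus_le_le_0_compat; auto]. }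
      unfold Rdiv. rewrite Rmult_comm. simpl. simpl in H. lra.
    - rewrite sum_Sn. unfold plus; simpl. specialize (Hp (S m)). simpl in Hp. lra. }
  apply (is_lim_seq_le_loc (fun _ => y ^ j / INR (Factorial.fact j)) (sum_n (fun n => / INR (Factorial.fact n) * y ^ n))
    (Finite _) (Finite _)); [|apply is_lim_seq_const|exact Hs].
  exists j. exact Hle.
Qed.

Lemma scaled_coef_le (m r : R) (j : nat) : 0 <= m -> 0 < r ->
  m ^ j / INR (Factorial.fact j) * r ^ j <= exp (m * r).
Proof.
  intros Hm Hr. replace (m ^ j / INR (Factorial.fact j) * r ^ j) with ((m * r) ^ j / INR (Factorial.fact j)).
  - apply pow_div_fact_le_exp. nra.
  - rewrite Rpow_mult_distr. unfold Rdiv; ring.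
Qed.

Lemma sin_add_quarter_is_derive_n (A : R) (n : nat) (y : R) :
  is_derive_n (fun y => sin (A + y)) n y (sin (A + y + INR n * (PI / 2))).
Proof.
  revert y. induction n as [|n IH]; intros y.
  - simpl. f_equal. ring.
  - simpl. apply (is_derive_ext (fun y => sin (A + y + INR n * (PI / 2)))).
    + intros t. symmetry. apply is_derive_n_unique, IH.
    + auto_derive; auto.
      change (match n with O => 1 | S _ => INR n + 1 end) with (INR (S n)). rewrite S_INR.
      replace (A + y + (INR n + 1) * (PI / 2)) with (PI / 2 + (A + y + INR n * (PI / 2))) by ring.
      rewrite <- cos_sin. unfold Rdiv; ring.
Qed.

Definition sin_coef (m x0 : R) (j : nat) : R :=
  m ^ j / INR (Factorial.fact j) * sin (m * x0 + INR j * (PI / 2)).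

(** Each derivative of the sine is a quarter-turn shift, hence bounded by 1, and
    [(m r)^j / j! <= exp (m r)]. This growth in [m] is the price that the powers of [1 / t] have to
    outweigh in [ratio_tail_expansion]. *)
Lemma expansion_sin (m x0 r : R) : 0 <= m -> 0 < r ->
  expansion (sin_coef m x0) (fun x => sin (m * x)) x0 (exp (m * r)) r.
Proof.
  intros Hm Hr. split.
  - intros j. unfold sin_coef.
    assert (Hp : 0 <= m ^ j / INR (Factorial.fact j)).
    { apply Rmult_le_pos; [apply pow_le, Hm|left; apply Rinv_0_lt_compat, INR_fact_lt_0]. }
    rewrite Rabs_mult, (Rabs_pos_eq (m ^ j / _)) by exact Hp.
    eapply Rle_trans; [|apply (scaled_coef_le m r j Hm Hr)].
    apply Rmult_le_compat_r; [apply pow_le; lra|].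
    rewrite <- (Rmult_1_r (m ^ j / INR (Factorial.fact j))) at 2.
    apply Rmult_le_compat_l; [exact Hp|]. apply Rabs_le, SIN_bound.
  - intros h _.
    assert (H := mk_pseries (fun y => sin (m * x0 + y)) 1 p_infty).
    assert (Hd : forall (n : nat) (x : R), Rbar_lt (Rabs x) p_infty ->
      ex_derive_n (fun y => sin (m * x0 + y)) n x /\
      Rabs (Derive_n (fun y => sin (m * x0 + y)) n x) <= 1).
    { intros n x _. assert (Hn := sin_add_quarter_is_derive_n (m * x0) n x). split.
      - destruct n as [|n]; [exact I|]. eexists. exact Hn.
      - rewrite (is_derive_n_unique _ _ _ _ Hn). apply Rabs_le, SIN_bound. }
    specialize (H Hd (m * h) I).
    apply is_pseries_R in H.
    replace (m * (x0 + h)) with (m * x0 + m * h) by ring.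
    eapply is_series_ext; [|exact H]. intros n. simpl.
    rewrite (is_derive_n_unique _ _ _ _ (sin_add_quarter_is_derive_n (m * x0) n 0)).
    unfold sin_coef. rewrite Rpow_mult_distr, Rplus_0_r. unfold Rdiv; ring.
Qed.

(** * Real-analytic functions of a real variable *)

(** The real case of [analytic_at], written with plain series in the increment; [real_analytic_at]
    translates. *)
Definition real_analytic (f : R -> R) (x0 : R) : Prop :=
  exists (a : nat -> R) (d : posreal),
    forall h, Rabs h < d -> is_series (fun j => a j * h ^ j) (f (x0 + h)).

Lemma real_analytic_plus (f g : R -> R) (x0 : R) :
  real_analytic f x0 -> real_analytic g x0 -> real_analytic (fun x => f x + g x) x0.
Proof.
  intros [a [d Ha]] [b [e Hb]].
  assert (Hm : 0 < Rmin d e) by (apply Rmin_pos; apply cond_pos).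
  exists (fun j => a j + b j), (mkposreal _ Hm). intros h Hh; simpl in Hh.
  apply (is_series_ext (fun j => plus (a j * h ^ j) (b j * h ^ j))).
  - intros j. unfold plus; simpl; ring.
  - apply (is_series_plus (V := R_NormedModule)).
    + apply Ha. eapply Rlt_le_trans; [exact Hh|apply Rmin_l].
    + apply Hb. eapply Rlt_le_trans; [exact Hh|apply Rmin_r].
Qed.

Lemma real_analytic_scal (c : R) (f : R -> R) (x0 : R) :
  real_analytic f x0 -> real_analytic (fun x => c * f x) x0.
Proof.
  intros [a [d Ha]]. exists (fun j => c * a j), d. intros h Hh.
  apply (is_series_ext (fun j => scal c (a j * h ^ j))).
  - intros j. unfold scal; simpl; unfold mult; simpl; ring.
  - apply (is_series_scal (V := R_NormedModule)), Ha, Hh.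
Qed.

Lemma is_series_cons (a : nat -> R) (l : R) :
  is_series (fun k => a (S k)) (l - a O) -> is_series a l.
Proof. exact (is_series_decr_1 a l). Qed.

Lemma is_series_tail (a : nat -> R) (l : R) :
  is_series a l -> is_series (fun k => a (S k)) (l - a O).
Proof.
  intros H. apply is_series_incr_1.
  change (is_series a (l - a O + a O)). replace (l - a O + a O) with l by ring. exact H.
Qed.

(** A shift of coefficients. The products met below have a polynomial factor, so this takes the
    place of Cauchy products. *)
Lemma real_analytic_mult_id (f : R -> R) (x0 : R) :
  real_analytic f x0 -> real_analytic (fun x => x * f x) x0.
Proof.
  intros [a [d Ha]].
  exists (fun j => x0 * a j + match j with O => 0 | S i => a i end), d.
  intros h Hh.
  replace ((x0 + h) * f (x0 + h)) with (plus (scal x0 (f (x0 + h))) (h * f (x0 + h)))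
    by (unfold plus, scal; simpl; unfold mult; simpl; ring).
  apply (is_series_ext (fun j => plus (scal x0 (a j * h ^ j)) (match j with O => 0 | S i => a i end * h ^ j))).
  - intros j. unfold plus, scal; simpl; unfold mult; simpl; ring.
  - apply (is_series_plus (V := R_NormedModule)).
    + apply (is_series_scal (V := R_NormedModule)), Ha, Hh.
    + apply is_series_cons.
      replace (h * f (x0 + h) - 0 * h ^ 0) with (scal h (f (x0 + h)))
        by (unfold scal; simpl; unfold mult; simpl; ring).
      apply (is_series_ext (fun j => scal h (a j * h ^ j))).
      * intros j. unfold scal; simpl; unfold mult; simpl; ring.
      * apply (is_series_scal (V := R_NormedModule)), Ha, Hh.
Qed.

Lemma real_analytic_const (c x0 : R) : real_analytic (fun _ => c) x0.
Proof.
  exists (fun j => match j with O => c | S _ => 0 end), (mkposreal 1 Rlt_0_1). intros h _.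
  apply is_series_cons.
  replace (c - c * h ^ 0) with 0 by (simpl; ring).
  apply (is_series_ext (fun _ => 0)); [intros; simpl; ring|].
  change (is_lim_seq (sum_n (fun _ => 0)) 0).
  apply (is_lim_seq_ext (fun _ => 0)); [|apply is_lim_seq_const].
  intros n. rewrite sum_n_const. ring.
Qed.

Lemma real_analytic_ext (f g : R -> R) (x0 : R) :
  (forall x, f x = g x) -> real_analytic f x0 -> real_analytic g x0.
Proof.
  intros Hfg [a [d Ha]]. exists a, d. intros h Hh. rewrite <- Hfg. auto.
Qed.

Lemma expansion_real_analytic (alpha : nat -> R) (f : R -> R) (x0 M r : R) : 0 < r ->
  expansion alpha f x0 M r -> real_analytic f x0.
Proof.
  intros Hr [_ H]. assert (Hr2 : 0 < r / 2) by lra.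
  exists alpha, (mkposreal _ Hr2). intros h Hh. apply H. left; exact Hh.
Qed.

Lemma CV_radius_pos (a : nat -> R) (x : R) : 0 < x ->
  ex_series (fun j => a j * x ^ j) -> Rbar_lt 0 (CV_radius a).
Proof.
  intros Hx Hs. destruct (Rbar_lt_dec 0 (CV_radius a)) as [H|H]; [exact H|exfalso].
  apply (CV_disk_outside a x).
  - apply Rbar_not_lt_le in H. eapply Rbar_le_lt_trans; [exact H|].
    simpl. apply Rabs_pos_lt. lra.
  - apply ex_series_lim_0, Hs.
Qed.

(** The sum is continuous at 0 and vanishes along the points [d / 2 * 2^-n]. Dividing by [h] then
    yields the other coefficients by induction. *)
Lemma zero_series_head (a : nat -> R) (d : R) : 0 < d ->
  (forall h, 0 < h < d -> is_series (fun j => a j * h ^ j) 0) -> a O = 0.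
Proof.
  intros Hd Ha.
  assert (HCV : Rbar_lt (Rabs 0) (CV_radius a)).
  { rewrite Rabs_R0. apply (CV_radius_pos a (d / 2)); [lra|].
    eexists. apply Ha. lra. }
  assert (Hc := PSeries_continuity a 0 HCV).
  apply continuity_pt_filterlim in Hc.
  set (u := fun n : nat => d / 2 * (/ 2) ^ n).
  assert (Hu : is_lim_seq u 0) by apply half_pow_lim.
  assert (Hl : is_lim_seq (fun n => PSeries a (u n)) (PSeries a 0)).
  { apply (filterlim_comp _ _ _ u (PSeries a) _ (locally 0)); [exact Hu|exact Hc]. }
  rewrite PSeries_0 in Hl.
  assert (Hl0 : is_lim_seq (fun n => PSeries a (u n)) 0).
  { apply (is_lim_seq_ext (fun _ => 0)); [|apply is_lim_seq_const].
    intros n. symmetry. apply is_pseries_unique, is_pseries_R, Ha.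
    assert (0 < (/ 2) ^ n <= 1).
    { split; [apply pow_lt; lra|]. rewrite <- (pow1 n). apply pow_incr; lra. }
    unfold u. nra. }
  apply is_lim_seq_unique in Hl. apply is_lim_seq_unique in Hl0.
  rewrite Hl in Hl0. injection Hl0; auto.
Qed.

Lemma zero_series_coef (a : nat -> R) (d : R) (j : nat) : 0 < d ->
  (forall h, 0 < h < d -> is_series (fun j => a j * h ^ j) 0) -> a j = 0.
Proof.
  intros Hd. revert a. induction j as [|j IH]; intros a Ha.
  - apply zero_series_head with d; auto.
  - apply (IH (fun j => a (S j))). intros h Hh.
    assert (H0 : a O = 0) by (apply zero_series_head with d; auto).
    assert (H := Ha h Hh). 
    apply is_series_tail in H.
    replace 0 with (scal (/ h) (0 - a O * h ^ 0))
      by (rewrite H0; unfold scal; simpl; unfold mult; simpl; ring).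
    apply (is_series_ext (fun k => scal (/ h) (a (S k) * h ^ S k))).
    + intros k. unfold scal; simpl; unfold mult; simpl. field. lra.
    + apply (is_series_scal (V := R_NormedModule)). exact H.
Qed.

(** If [f] is nonzero somewhere, let [m] be the supremum of such points. The expansion at [m]
    vanishes to the right of [m], so all its coefficients are 0 and [f] vanishes slightly to the
    left as well, against the choice of [m]. *)
Lemma real_analytic_identity (f : R -> R) (lo c : R) :
  (forall x, lo < x -> real_analytic f x) -> (forall x, c < x -> f x = 0) ->
  forall x, lo < x -> f x = 0.
Proof.
  intros Ha H0 x Hx. destruct (Req_dec (f x) 0) as [E|E]; [exact E|exfalso].
  set (P := fun y => f y <> 0).
  destruct (completeness P) as [m [Hub Hlub]].
  - exists c. intros y Hy. destruct (Rle_dec y c) as [H|H]; [exact H|]. exfalso. apply Hy, H0. lra.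
  - exists x. exact E.
  - assert (Hxm : x <= m) by (apply Hub; exact E).
    assert (Hz : forall y, m < y -> f y = 0).
    { intros y Hy. destruct (Req_dec (f y) 0) as [Ey|Ey]; [exact Ey|].
      assert (H := Hub y Ey). lra. }
    destruct (Ha m ltac:(lra)) as [a [d Hd]].
    assert (Hc : forall j, a j = 0).
    { intros j. apply (zero_series_coef a d); [apply cond_pos|].
      intros h Hh. rewrite <- (Hz (m + h)) by lra. apply Hd. rewrite Rabs_pos_eq; lra. }
    assert (Hl : m <= m - d / 2).
    { apply Hlub. intros y Hy. destruct (Rle_dec y (m - d / 2)) as [H|H]; [exact H|].
      exfalso. apply Hy. destruct (Rlt_dec m y) as [H1|H1]; [auto|].
      assert (Hdp := cond_pos d).
      assert (Hs := Hd (y - m) ltac:(apply Rabs_def1; lra)).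
      replace (m + (y - m)) with y in Hs by ring.
      apply is_series_unique in Hs. rewrite <- Hs.
      rewrite <- (Series_ext (fun _ => 0 * 0)); [rewrite Series_scal_l; ring|].
      intros n. rewrite Hc. ring. }
    assert (Hdp := cond_pos d). lra.
Qed.

(** * Real and imaginary parts of complex series *)

Lemma sum_n_C (c : nat -> C) (n : nat) :
  @sum_n C_AbsRing c n = (sum_n (fun k => Re (c k)) n, sum_n (fun k => Im (c k)) n).
Proof.
  induction n as [|n IH].
  - rewrite !sum_O. unfold Re, Im. destruct (c O); reflexivity.
  - rewrite !sum_Sn, IH. reflexivity.
Qed.

Lemma is_series_C (c : nat -> C) (l : C) :
  @is_series C_AbsRing (AbsRing_NormedModule C_AbsRing) c l ->
  is_series (fun k => Re (c k)) (Re l) /\ is_series (fun k => Im (c k)) (Im l).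
Proof.
  intros H.
  assert (Hb : forall eps : posreal, eventually (fun n => Cmod (Cminus (@sum_n C_AbsRing c n) l) < eps)).
  { intros eps. exact (H _ (@locally_ball (AbsRing_UniformSpace C_AbsRing) l eps)). }
  split; intros P [eps HP]; specialize (Hb eps); unfold filtermap;
    (eapply filter_imp; [|exact Hb]); intros n Hn; apply HP; cbv beta in Hn; rewrite sum_n_C in Hn.
  - eapply Rle_lt_trans; [|exact Hn].
    apply (Rle_trans _ _ _ (Rmax_l _ _) (Rmax_Cmod (Cminus (sum_n (fun k => Re (c k)) n, sum_n (fun k => Im (c k)) n) l))).
  - eapply Rle_lt_trans; [|exact Hn].
    apply (Rle_trans _ _ _ (Rmax_r _ _) (Rmax_Cmod (Cminus (sum_n (fun k => Re (c k)) n, sum_n (fun k => Im (c k)) n) l))).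
Qed.

(** Counterpart of [is_series_C] for the second topology carried by [C]: the Dirichlet series is
    stated with the product uniform structure, [analytic_at] with the one induced by the modulus. *)
Lemma is_series_C_prod (c : nat -> C) (l : C) :
  @is_series C_AbsRing C_NormedModule c l ->
  is_series (fun k => Re (c k)) (Re l) /\ is_series (fun k => Im (c k)) (Im l).
Proof.
  intros H. split; intros P [eps HP];
  assert (Hb := H _ (@locally_ball C_UniformSpace l eps)); unfold filtermap in *;
    (eapply filter_imp; [|exact Hb]); intros n Hn; apply HP;
    change (@ball C_UniformSpace l eps (@sum_n C_AbsRing c n)) in Hn; rewrite sum_n_C in Hn; apply Hn.
Qed.

Lemma pow_n_RtoC (h : R) (k : nat) : @pow_n C_AbsRing (RtoC h) k = RtoC (h ^ k).
Proof.
  induction k as [|k IH]; [reflexivity|]. simpl. rewrite IH.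
  change (Cmult (RtoC h) (RtoC (h ^ k)) = RtoC (h * h ^ k)). now rewrite RtoC_mult.
Qed.

Lemma scal_pow_n_RtoC (h : R) (k : nat) (z : C) :
  Cmult (@pow_n C_AbsRing (RtoC h) k) z = (Re z * h ^ k, Im z * h ^ k).
Proof. rewrite pow_n_RtoC. unfold Cmult, RtoC, Re, Im; simpl. f_equal; ring. Qed.

Lemma analytic_at_horizontal (f : C -> C) (v x0 : R) :
  @analytic_at C_AbsRing f (x0, v) ->
  real_analytic (fun x => Re (f (x, v))) x0 /\ real_analytic (fun x => Im (f (x, v))) x0.
Proof.
  intros [a [d Hd]].
  assert (Hs : forall h, Rabs h < d ->
    is_series (fun j => Re (a j) * h ^ j) (Re (f (x0 + h, v)))
    /\ is_series (fun j => Im (a j) * h ^ j) (Im (f (x0 + h, v)))).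
  { intros h Hh.
    assert (Hm : @minus (AbsRing.AbelianGroup C_AbsRing) (x0 + h, v) (x0, v) = RtoC h).
    { unfold minus, plus, opp; simpl. unfold Cplus, Copp, RtoC; simpl. f_equal; ring. }
    assert (Hball : @ball (AbsRing_UniformSpace C_AbsRing) (x0, v) d (x0 + h, v)).
    { change (Cmod (@minus (AbsRing.AbelianGroup C_AbsRing) (x0 + h, v) (x0, v)) < d).
      rewrite Hm, Cmod_R. exact Hh. }
    specialize (Hd _ Hball). rewrite Hm in Hd. apply is_series_C in Hd.
    destruct Hd as [H1 H2]. split; [eapply is_series_ext; [|exact H1]|eapply is_series_ext; [|exact H2]];
    intros j.
    - exact (f_equal Re (scal_pow_n_RtoC h j (a j))).
    - exact (f_equal Im (scal_pow_n_RtoC h j (a j))). }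
  split; [exists (fun j => Re (a j)), d|exists (fun j => Im (a j)), d]; intros h Hh; apply (Hs h Hh).
Qed.

(** * Zeta on the critical line *)

Lemma expansion_exp (l x0 r : R) : 0 <= l -> 0 < r ->
  expansion (fun j => exp (- l * x0) * ((- l) ^ j / INR (Factorial.fact j)))
    (fun x => exp (- l * x)) x0 (exp (- l * x0) * exp (l * r)) r.
Proof.
  intros Hl Hr. split.
  - intros j. rewrite Rabs_mult, Rabs_pos_eq, Rmult_assoc by (left; apply exp_pos).
    apply Rmult_le_compat_l; [left; apply exp_pos|].
    unfold Rdiv. rewrite Rabs_mult, <- RPow_abs, Rabs_Ropp, (Rabs_pos_eq l) by exact Hl.
    rewrite (Rabs_pos_eq (/ _)) by (left; apply Rinv_0_lt_compat, INR_fact_lt_0).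
    apply scaled_coef_le; assumption.
  - intros h _. replace (exp (- l * (x0 + h))) with (scal (exp (- l * x0)) (exp (- l * h))).
    2:{ unfold scal; simpl; unfold mult; simpl. rewrite <- exp_plus. f_equal. ring. }
    assert (H := proj1 (is_pseries_R _ _ _) (is_exp_Reals (- l * h))).
    apply (is_series_scal (V := R_NormedModule) (exp (- l * x0))) in H.
    eapply is_series_ext; [|exact H]. intros j.
    unfold scal; simpl; unfold mult; simpl. rewrite Rpow_mult_distr. unfold Rdiv; ring.
Qed.

(* With [w l = cos (v l)] or [sin (v l)]: up to sign, the parts of the integral of
   [x (n + 1 + x)^(-s-1)] over [0, 1]; [- s] times it is the step from [N = n + 1] to [n + 2]
   of the approximation of [zeta s]. *)
Definition zint (w : R -> R) (n : nat) (sigma : R) : R :=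
  RInt (fun x => x * exp (- (sigma + 1) * ln (INR (S n) + x)) * w (ln (INR (S n) + x))) 0 1.

Definition zint_coef (w : R -> R) (x0 : R) (n j : nat) : R :=
  RInt (fun x => (x * exp (- ln (INR (S n) + x)) * w (ln (INR (S n) + x))) *
    (exp (- ln (INR (S n) + x) * x0) * ((- ln (INR (S n) + x)) ^ j / INR (Factorial.fact j)))) 0 1.

Definition bounded_smooth (w : R -> R) : Prop :=
  (forall x, Rabs (w x) <= 1) /\ (forall x, ex_derive w x).

Lemma ln_shift_bounds (n : nat) (x : R) : 0 <= x -> 0 <= ln (INR (S n)) <= ln (INR (S n) + x).
Proof.
  intros Hx. assert (H1 : 1 <= INR (S n)) by (apply (le_INR 1); lia).
  split.
  - rewrite <- ln_1. apply ln_le; lra.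
  - apply ln_le; lra.
Qed.

Lemma S_INR_pos (n : nat) : 0 < INR (S n).
Proof. apply (lt_INR 0). lia. Qed.

Lemma zint_integrable (w : R -> R) (n : nat) (sigma : R) : bounded_smooth w ->
  ex_RInt (fun x => x * exp (- (sigma + 1) * ln (INR (S n) + x)) * w (ln (INR (S n) + x))) 0 1.
Proof.
  intros [_ Hw]. apply ex_RInt_of_derivable_on. intros x Hx.
  rewrite Rmin_left in Hx by lra. assert (H := S_INR_pos n).
  revert H. generalize (INR (S n)). intros N H.
  auto_derive. repeat split; auto; lra.
Qed.

Lemma zint_expansion (w : R -> R) (n : nat) (x0 r : R) : bounded_smooth w -> 0 < r -> r <= 1 + x0 ->
  expansion (zint_coef w x0 n) (zint w n) x0 (exp (- (1 + x0 - r) * ln (INR (S n)))) r.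
Proof.
  intros Hw Hr Hx0. unfold zint, zint_coef.
  assert (HS := S_INR_pos n).
  apply (expansion_RInt (fun x j => (x * exp (- ln (INR (S n) + x)) * w (ln (INR (S n) + x))) *
    (exp (- ln (INR (S n) + x) * x0) * ((- ln (INR (S n) + x)) ^ j / INR (Factorial.fact j))))
    (fun x s => x * exp (- (s + 1) * ln (INR (S n) + x)) * w (ln (INR (S n) + x)))).
  - exact Hr.
  - intros x Hx. assert (Hl := ln_shift_bounds n x (proj1 Hx)). set (l := ln (INR (S n) + x)) in *.
    apply (expansion_ext _ (fun s => (x * exp (- l) * w l) * exp (- l * s))).
    { intros s. replace (- (s + 1) * l) with (- l + - l * s) by ring. rewrite exp_plus. ring. }
    eapply expansion_weaken; [|apply expansion_scal, expansion_exp; [lra|exact Hr]].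
    rewrite !Rabs_mult, (Rabs_pos_eq x), (Rabs_pos_eq (exp _)) by (lra || (left; apply exp_pos)).
    assert (Hwl := proj1 Hw l). assert (Hp := Rabs_pos (w l)).
    apply Rle_trans with (exp (- l) * (exp (- l * x0) * exp (l * r))).
    + apply Rmult_le_compat_r; [left; apply Rmult_lt_0_compat; apply exp_pos|].
      assert (He := exp_pos (- l)).
      assert (x * exp (- l) <= exp (- l)) by nra. assert (0 <= x * exp (- l)) by nra. nra.
    + rewrite <- !exp_plus. apply exp_le_compat. nra.
  - intros j. apply ex_RInt_of_derivable_on. intros x Hx.
    rewrite Rmin_left in Hx by lra.
    revert HS. generalize (INR (S n)). intros N HS.
    assert (Hd : ex_derive w (ln (N + x))) by apply Hw.
    auto_derive. repeat split; auto; lra.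
  - intros h _. apply zint_integrable, Hw.
Qed.

(** Comparison with a telescoping series: by the mean value theorem
    [p (N + 1)^(-1-p) <= N^-p - (N + 1)^-p]. *)
Lemma ex_series_power (p : R) : 0 < p -> ex_series (fun n => exp (- (1 + p) * ln (INR (S n)))).
Proof.
  intros Hp. apply ex_series_incr_1.
  set (u := fun n => exp (- p * ln (INR (S n)))).
  apply (ex_series_Rabs_le _ (fun n => / p * (u n - u (S n)))).
  - intros n. rewrite Rabs_pos_eq by (left; apply exp_pos).
    apply Rmult_le_reg_l with p; [exact Hp|]. rewrite <- Rmult_assoc, Rinv_r, Rmult_1_l by lra.
    assert (Hn := S_INR_pos n). unfold u. rewrite (S_INR (S n)).
    destruct (MVT_gen (fun y => exp (- p * ln y)) (INR (S n)) (INR (S n) + 1)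
      (fun y => exp (- p * ln y) * (- p * / y))) as [c [Hc E]].
    + intros y. rewrite Rmin_left, Rmax_right by lra. intros Hy. auto_derive; [lra|field; lra].
    + intros y. rewrite Rmin_left, Rmax_right by lra. intros Hy.
      apply derivable_continuous_pt. eexists. apply is_derive_Reals. auto_derive; [lra|reflexivity].
    + rewrite Rmin_left, Rmax_right in Hc by lra.
      replace (exp (- p * ln (INR (S n))) - exp (- p * ln (INR (S n) + 1))) with
        (- (exp (- p * ln (INR (S n) + 1)) - exp (- p * ln (INR (S n))))) by ring.
      rewrite E. replace (INR (S n) + 1 - INR (S n)) with 1 by ring.
      replace (- (exp (- p * ln c) * (- p * / c) * 1)) with (p * (exp (- p * ln c) * / c)) by ring.
      apply Rmult_le_compat_l; [lra|].
      replace (exp (- p * ln c) * / c) with (exp (- (1 + p) * ln c)).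
      * apply exp_le_compat. assert (ln c <= ln (INR (S n) + 1)) by (apply ln_le; lra). nra.
      * replace (- (1 + p) * ln c) with (- p * ln c + - ln c) by ring.
        rewrite exp_plus, exp_Ropp, exp_ln by lra. reflexivity.
  - apply (ex_series_scal (V := R_NormedModule) (/ p) (fun n => u n - u (S n))). exists (u O - 0).
    change (is_lim_seq (sum_n (fun n => u n - u (S n))) (u O - 0)).
    apply (is_lim_seq_ext (fun n => u O - u (S n))).
    + intros n. induction n as [|n IH]; [rewrite sum_O; reflexivity|].
      rewrite sum_Sn, <- IH. unfold plus; simpl. ring.
    + apply is_lim_seq_minus'; [apply is_lim_seq_const|].
      apply -> is_lim_seq_incr_1. 
      apply (filterlim_comp _ _ _ (fun n => ln (INR (S n))) (fun y => exp (- p * y)) _ (Rbar_locally p_infty)).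
      * apply (filterlim_comp _ _ _ (fun n => INR (S n)) ln _ (Rbar_locally p_infty)); [|exact is_lim_ln_p].
        apply (is_lim_seq_incr_1 INR p_infty), is_lim_seq_INR.
      * apply filterlim_exp_neg, Hp.
Qed.

Lemma zint_abs (w : R -> R) (n : nat) (sigma : R) : bounded_smooth w -> 0 < sigma ->
  Rabs (zint w n sigma) <= exp (- (1 + sigma) * ln (INR (S n))).
Proof.
  intros Hw Hs. unfold zint.
  eapply Rle_trans; [apply (abs_RInt_le_const _ 0 1 (exp (- (1 + sigma) * ln (INR (S n)))));
    [lra|apply zint_integrable, Hw|]|lra].
  intros x Hx. assert (Hl := ln_shift_bounds n x (proj1 Hx)).
  assert (Hwl := proj1 Hw (ln (INR (S n) + x))). assert (Hp := Rabs_pos (w (ln (INR (S n) + x)))).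
  rewrite !Rabs_mult, (Rabs_pos_eq x), (Rabs_pos_eq (exp _)) by (lra || (left; apply exp_pos)).
  assert (He : exp (- (sigma + 1) * ln (INR (S n) + x)) <= exp (- (1 + sigma) * ln (INR (S n)))).
  { apply exp_le_compat. nra. }
  assert (H0 := exp_pos (- (sigma + 1) * ln (INR (S n) + x))).
  set (e := exp (- (sigma + 1) * ln (INR (S n) + x))) in *.
  assert (x * e <= e) by nra. assert (0 <= x * e) by nra. nra.
Qed.

Lemma ex_series_zint (w : R -> R) (sigma : R) : bounded_smooth w -> 0 < sigma ->
  ex_series (fun n => zint w n sigma).
Proof.
  intros Hw Hs. eapply ex_series_Rabs_le; [|apply (ex_series_power sigma Hs)].
  intros n. apply zint_abs; assumption.
Qed.

(** The radius [sigma / 2] leaves the bound [N^-(1 + sigma / 2)] for the expansion of the [N]-th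
    term, which is still summable. This is where the half-plane moves from [sigma > 1] to
    [sigma > 0]. *)
Lemma zint_series_analytic (w : R -> R) (sigma : R) : bounded_smooth w -> 0 < sigma ->
  real_analytic (fun s => Series (fun n => zint w n s)) sigma.
Proof.
  intros Hw Hs.
  apply (expansion_real_analytic (fun j => Series (fun n => zint_coef w sigma n j)) _ _
    (Series (fun n => exp (- (1 + sigma - sigma / 2) * ln (INR (S n))))) (sigma / 2)); [lra|].
  apply (expansion_series (zint_coef w sigma) (zint w)); [lra| |].
  - intros n. apply zint_expansion; [exact Hw|lra|lra].
  - apply (ex_series_ext (fun n => exp (- (1 + sigma / 2) * ln (INR (S n))))).
    + intros n. f_equal. field.
    + apply ex_series_power. lra.
Qed.

(** * Euler-Maclaurin approximation and continuation of zeta *)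

Definition dirichlet_cos (v sigma : R) (n : nat) : R :=
  exp (- sigma * ln (INR (S n))) * cos (v * ln (INR (S n))).
Definition dirichlet_sin (v sigma : R) (n : nat) : R :=
  exp (- sigma * ln (INR (S n))) * sin (v * ln (INR (S n))).

(* Real and imaginary parts of [(1 - s) sum_{n <= N} n^-s - N^(1-s)] for
   [s = sigma + i v] and [N = m + 1]. *)
Definition euler_maclaurin_re (v sigma : R) (m : nat) : R :=
  (1 - sigma) * sum_n (dirichlet_cos v sigma) m - v * sum_n (dirichlet_sin v sigma) m
  - INR (S m) * dirichlet_cos v sigma m.
Definition euler_maclaurin_im (v sigma : R) (m : nat) : R :=
  - ((1 - sigma) * sum_n (dirichlet_sin v sigma) m + v * sum_n (dirichlet_cos v sigma) m)
  + INR (S m) * dirichlet_sin v sigma m.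

Lemma bounded_smooth_cos (v : R) : bounded_smooth (fun l => cos (v * l)).
Proof. split; [intros; apply Rabs_le, COS_bound|intros; auto_derive; auto]. Qed.

Lemma bounded_smooth_sin (v : R) : bounded_smooth (fun l => sin (v * l)).
Proof. split; [intros; apply Rabs_le, SIN_bound|intros; auto_derive; auto]. Qed.

(** Here [p + i q = s (1 - s)] and [c - i d] is the integral of [x (N + x)^(-s-1)] over [0, 1].
    Times [- s (1 - s)], that integrand is the derivative of
    [(1 - s) x (N + x)^(-s) - (N + x)^(1-s)], whose increment over [0, 1] is the step. *)
Lemma euler_maclaurin_step (v sigma : R) (m : nat) :
  let p := sigma * (1 - sigma) + v ^ 2 in
  let q := v * (1 - 2 * sigma) in
  let c := zint (fun l => cos (v * l)) m sigma in
  let d := zint (fun l => sin (v * l)) m sigma in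
  euler_maclaurin_re v sigma (S m) = euler_maclaurin_re v sigma m - (p * c + q * d) /\
  euler_maclaurin_im v sigma (S m) = euler_maclaurin_im v sigma m - (q * c - p * d).
Proof.
  intros p q c d.
  assert (HS := S_INR_pos m). 
  assert (Ic : is_RInt (fun x => x * exp (- (sigma + 1) * ln (INR (S m) + x)) * cos (v * ln (INR (S m) + x))) 0 1 c)
    by exact (RInt_correct _ _ _ (zint_integrable _ m sigma (bounded_smooth_cos v))).
  assert (Is : is_RInt (fun x => x * exp (- (sigma + 1) * ln (INR (S m) + x)) * sin (v * ln (INR (S m) + x))) 0 1 d)
    by exact (RInt_correct _ _ _ (zint_integrable _ m sigma (bounded_smooth_sin v))).
  unfold euler_maclaurin_re, euler_maclaurin_im. rewrite !sum_Sn.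
  set (SC := sum_n (dirichlet_cos v sigma) m : R). set (SS := sum_n (dirichlet_sin v sigma) m : R).
  unfold dirichlet_cos, dirichlet_sin. rewrite (S_INR (S m)).
  clearbody c d SC SS. revert HS Ic Is. generalize (INR (S m)). intros N HS Ic Is.
  assert (He : forall x, 0 <= x -> exp (- (sigma + 1) * ln (N + x)) = exp (- sigma * ln (N + x)) / (N + x)).
  { intros x Hx. replace (- (sigma + 1) * ln (N + x)) with (- sigma * ln (N + x) + - ln (N + x)) by ring.
    rewrite exp_plus, exp_Ropp, exp_ln by lra. reflexivity. }
  assert (Hcont : forall w, bounded_smooth w -> forall x, 0 <= x ->
    continuous (fun x => x * exp (- (sigma + 1) * ln (N + x)) * w (ln (N + x))) x).
  { intros w [_ Hw] x Hx. apply (ex_derive_continuous (V := R_NormedModule)).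
    auto_derive. repeat split; auto; lra. }
  assert (Hcomb : forall a b x, 0 <= x -> continuous (fun x =>
     a * (x * exp (- (sigma + 1) * ln (N + x)) * cos (v * ln (N + x)))
     + b * (x * exp (- (sigma + 1) * ln (N + x)) * sin (v * ln (N + x)))) x).
  { intros a b x Hx. 
    apply (continuous_plus (V := R_NormedModule)); apply (continuous_scal_r (V := R_NormedModule)).
    - apply (Hcont (fun l => cos (v * l)) (bounded_smooth_cos v) x Hx).
    - apply (Hcont (fun l => sin (v * l)) (bounded_smooth_sin v) x Hx). }
  assert (HI : forall a b, is_RInt (fun x =>
     a * (x * exp (- (sigma + 1) * ln (N + x)) * cos (v * ln (N + x)))
     + b * (x * exp (- (sigma + 1) * ln (N + x)) * sin (v * ln (N + x)))) 0 1 (a * c + b * d)).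
  { intros a b. apply (is_RInt_plus (V := R_NormedModule)); apply (is_RInt_scal (V := R_NormedModule)); [exact Ic|exact Is]. }
  split.
  - assert (H := is_RInt_derive (fun x => x * exp (- sigma * ln (N + x)) * ((1 - sigma) * cos (v * ln (N + x)) - v * sin (v * ln (N + x)))
       - (N + x) * (exp (- sigma * ln (N + x)) * cos (v * ln (N + x))))
       (fun x => - p * (x * exp (- (sigma + 1) * ln (N + x)) * cos (v * ln (N + x)))
     + - q * (x * exp (- (sigma + 1) * ln (N + x)) * sin (v * ln (N + x)))) 0 1).
    rewrite Rmin_left, Rmax_right in H by lra.
    specialize (H ltac:(intros x Hx; rewrite (He x) by lra; auto_derive; [repeat split; lra|unfold p, q; field; lra])
      (fun x Hx => Hcomb (- p) (- q) x (proj1 Hx))).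
    assert (E := is_RInt_unique _ _ _ _ H). rewrite (is_RInt_unique _ _ _ _ (HI (- p) (- q))) in E.
    unfold minus, plus, opp in E; simpl in E. rewrite Rplus_0_r in E. unfold plus; simpl. lra.
  - assert (H := is_RInt_derive (fun x => - (x * exp (- sigma * ln (N + x)) * ((1 - sigma) * sin (v * ln (N + x)) + v * cos (v * ln (N + x))))
       + (N + x) * (exp (- sigma * ln (N + x)) * sin (v * ln (N + x))))
       (fun x => - q * (x * exp (- (sigma + 1) * ln (N + x)) * cos (v * ln (N + x)))
     + p * (x * exp (- (sigma + 1) * ln (N + x)) * sin (v * ln (N + x)))) 0 1).
    rewrite Rmin_left, Rmax_right in H by lra.
    specialize (H ltac:(intros x Hx; rewrite (He x) by lra; auto_derive; [repeat split; lra|unfold p, q; field; lra])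
      (fun x Hx => Hcomb (- q) p x (proj1 Hx))).
    assert (E := is_RInt_unique _ _ _ _ H). rewrite (is_RInt_unique _ _ _ _ (HI (- q) p)) in E.
    unfold minus, plus, opp in E; simpl in E. rewrite Rplus_0_r in E. unfold plus; simpl. lra.
Qed.

Definition zcos (v : R) (n : nat) (sigma : R) : R := zint (fun l => cos (v * l)) n sigma.
Definition zsin (v : R) (n : nat) (sigma : R) : R := zint (fun l => sin (v * l)) n sigma.

Lemma euler_maclaurin_sum (v sigma : R) (m : nat) :
  let p := sigma * (1 - sigma) + v ^ 2 in
  let q := v * (1 - 2 * sigma) in
  euler_maclaurin_re v sigma (S m) =
    - sigma - (p * sum_n (fun n => zcos v n sigma) m + q * sum_n (fun n => zsin v n sigma) m) /\
  euler_maclaurin_im v sigma (S m) =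
    - v - (q * sum_n (fun n => zcos v n sigma) m - p * sum_n (fun n => zsin v n sigma) m).
Proof.
  intros p q.
  assert (H0 : euler_maclaurin_re v sigma 0 = - sigma /\ euler_maclaurin_im v sigma 0 = - v).
  { unfold euler_maclaurin_re, euler_maclaurin_im. rewrite !sum_O.
    unfold dirichlet_cos, dirichlet_sin. change (INR 1) with 1.
    rewrite ln_1, !Rmult_0_r, exp_0, cos_0, sin_0. split; ring. }
  induction m as [|m IH].
  - destruct (euler_maclaurin_step v sigma 0) as [E1 E2]. fold p q in E1, E2.
    rewrite E1, E2, !sum_O, (proj1 H0), (proj2 H0). unfold zcos, zsin. split; ring.
  - destruct (euler_maclaurin_step v sigma (S m)) as [E1 E2]. fold p q in E1, E2.
    rewrite E1, E2, (proj1 IH), (proj2 IH), !sum_Sn. unfold plus; simpl plus. unfold zcos, zsin.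
    unfold plus; simpl. split; ring.
Qed.

Definition wcos (v sigma : R) : R := Series (fun n => zcos v n sigma).
Definition wsin (v sigma : R) : R := Series (fun n => zsin v n sigma).

Lemma is_series_zcos (v sigma : R) : 0 < sigma -> is_series (fun n => zcos v n sigma) (wcos v sigma).
Proof. intros Hs. apply Series_correct, (ex_series_zint _ _ (bounded_smooth_cos v) Hs). Qed.

Lemma is_series_zsin (v sigma : R) : 0 < sigma -> is_series (fun n => zsin v n sigma) (wsin v sigma).
Proof. intros Hs. apply Series_correct, (ex_series_zint _ _ (bounded_smooth_sin v) Hs). Qed.

Lemma is_lim_seq_lin2 (a b c d1 d2 : R) (u1 u2 : nat -> R) :
  is_lim_seq u1 d1 -> is_lim_seq u2 d2 ->
  is_lim_seq (fun n => a - (b * u1 n + c * u2 n)) (a - (b * d1 + c * d2)).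
Proof.
  intros H1 H2. apply is_lim_seq_minus'; [apply is_lim_seq_const|].
  apply is_lim_seq_plus'.
  - exact (is_lim_seq_scal_l u1 b d1 H1).
  - exact (is_lim_seq_scal_l u2 c d2 H2).
Qed.

Lemma euler_maclaurin_lim (v sigma : R) : 0 < sigma ->
  let p := sigma * (1 - sigma) + v ^ 2 in
  let q := v * (1 - 2 * sigma) in
  is_lim_seq (euler_maclaurin_re v sigma) (- sigma - (p * wcos v sigma + q * wsin v sigma)) /\
  is_lim_seq (euler_maclaurin_im v sigma) (- v - (q * wcos v sigma + - p * wsin v sigma)).
Proof.
  intros Hs p q. assert (Hc := is_series_zcos v sigma Hs). assert (Hd := is_series_zsin v sigma Hs).
  split; apply is_lim_seq_incr_1.
  - eapply is_lim_seq_ext; [|apply (is_lim_seq_lin2 (- sigma) p q _ _ _ _ Hc Hd)].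
    intros n. symmetry. apply (euler_maclaurin_sum v sigma n).
  - eapply is_lim_seq_ext; [|apply (is_lim_seq_lin2 (- v) q (- p) _ _ _ _ Hc Hd)].
    intros n. rewrite (proj2 (euler_maclaurin_sum v sigma n)). fold p q.
    assert (Hr : forall a b : R, - v - (q * a + - p * b) = - v - (q * a - p * b)) by (intros; ring).
    apply Hr.
Qed.

Lemma zeta_right_half_plane (zeta : C -> C) (v sigma : R) : is_riemann_zeta zeta -> 1 < sigma ->
  is_series (dirichlet_cos v sigma) (Re (zeta (sigma, v))) /\
  is_series (dirichlet_sin v sigma) (- Im (zeta (sigma, v))).
Proof.
  intros [Hz _] Hs. destruct (is_series_C_prod _ _ (Hz (sigma, v) Hs)) as [H1 H2]. split.
  - eapply is_series_ext; [|exact H1]. intros n. unfold Cpower, dirichlet_cos, Copp, Re, Im; cbn [fst snd].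
    rewrite Ropp_mult_distr_l_reverse with (r1 := v), cos_neg. reflexivity.
  - apply (is_series_scal (V := R_NormedModule) (-1)) in H2.
    replace (- Im (zeta (sigma, v))) with (scal (-1) (Im (zeta (sigma, v))))
      by (unfold scal; simpl; unfold mult; simpl; ring).
    eapply is_series_ext; [|exact H2]. intros n. unfold Cpower, dirichlet_sin, Copp, Re, Im; cbn [fst snd].
    rewrite Ropp_mult_distr_l_reverse with (r1 := v), sin_neg.
    change (-1 * (exp (- sigma * ln (INR (S n))) * - sin (v * ln (INR (S n)))) = exp (- sigma * ln (INR (S n))) * sin (v * ln (INR (S n)))).
    ring.
Qed.

Lemma boundary_term_lim (v sigma : R) : 1 < sigma ->
  is_lim_seq (fun m => INR (S m) * dirichlet_cos v sigma m) 0 /\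
  is_lim_seq (fun m => INR (S m) * dirichlet_sin v sigma m) 0.
Proof.
  intros Hs.
  assert (Hu : is_lim_seq (fun m => exp (- (sigma - 1) * ln (INR (S m)))) 0).
  { apply (filterlim_comp _ _ _ (fun n => ln (INR (S n))) (fun y => exp (- (sigma - 1) * y)) _ (Rbar_locally p_infty)).
    - apply (filterlim_comp _ _ _ (fun n => INR (S n)) ln _ (Rbar_locally p_infty)); [|exact is_lim_ln_p].
      apply (is_lim_seq_incr_1 INR p_infty), is_lim_seq_INR.
    - apply filterlim_exp_neg. lra. }
  assert (He : forall m, INR (S m) * exp (- sigma * ln (INR (S m))) = exp (- (sigma - 1) * ln (INR (S m)))).
  { intros m. rewrite <- (exp_ln (INR (S m))) at 1 by apply S_INR_pos.
    rewrite <- exp_plus. f_equal. ring. }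
  assert (Hw : forall w : nat -> R, (forall m, Rabs (w m) <= 1) ->
    is_lim_seq (fun m => INR (S m) * (exp (- sigma * ln (INR (S m))) * w m)) 0).
  { intros w Hw. apply is_lim_seq_abs_0.
    apply (is_lim_seq_le_le (fun _ => 0) _ (fun m => exp (- (sigma - 1) * ln (INR (S m)))));
      [|apply is_lim_seq_const|exact Hu].
    intros m. split; [apply Rabs_pos|]. rewrite <- Rmult_assoc, He, Rabs_mult, Rabs_pos_eq by (left; apply exp_pos).
    rewrite <- (Rmult_1_r (exp _)) at 2. apply Rmult_le_compat_l; [left; apply exp_pos|apply Hw]. }
  split; apply Hw; intros m; apply Rabs_le; [apply COS_bound|apply SIN_bound].
Qed.

Ltac real_analytic_auto :=
  repeat match goal with
  | |- real_analytic (fun x => @?f x + @?g x) _ => apply (real_analytic_plus f g)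
  | |- real_analytic (fun x => x * @?f x) _ => apply (real_analytic_mult_id f)
  | |- real_analytic (fun x => ?c * @?f x) _ => apply (real_analytic_scal c f)
  | |- real_analytic (fun _ => ?c) _ => apply (real_analytic_const c)
  | |- _ => assumption
  end.

(** For [sigma > 1] the boundary term [N^(1-s)] tends to 0 and both sides are limits of the same
    sequence. On the horizontal line at height [v > 0], which avoids the pole, both sides are
    real-analytic in [sigma > 0], so the identity theorem extends the equality. *)
Lemma zeta_continuation (zeta : C -> C) (v : R) : is_riemann_zeta zeta -> 0 < v ->
  forall sigma, 0 < sigma ->
  let p := sigma * (1 - sigma) + v ^ 2 in
  let q := v * (1 - 2 * sigma) in
  (1 - sigma) * Re (zeta (sigma, v)) + v * Im (zeta (sigma, v))
    = - sigma - (p * wcos v sigma + q * wsin v sigma) /\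
  (1 - sigma) * Im (zeta (sigma, v)) - v * Re (zeta (sigma, v))
    = - v - (q * wcos v sigma + - p * wsin v sigma).
Proof.
  intros Hz Hv.
  assert (Hana : forall sigma, real_analytic (fun x => Re (zeta (x, v))) sigma /\
    real_analytic (fun x => Im (zeta (x, v))) sigma).
  { intros sigma. apply analytic_at_horizontal, (proj2 Hz). intros E.
    apply (f_equal snd) in E. simpl in E. lra. }
  assert (Hwc : forall sigma, 0 < sigma -> real_analytic (wcos v) sigma).
  { intros s Hs. exact (zint_series_analytic _ s (bounded_smooth_cos v) Hs). }
  assert (Hws : forall sigma, 0 < sigma -> real_analytic (wsin v) sigma).
  { intros s Hs. exact (zint_series_analytic _ s (bounded_smooth_sin v) Hs). }
  (* [A] and [B] are the real and imaginary parts of the difference of the two sides, expanded into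
     sums of terms [s * f s] and [c * f s], the shapes that the closure lemmas recognise. *)
  set (A := fun s => ((Re (zeta (s, v)) + (-1) * (s * Re (zeta (s, v))) + v * Im (zeta (s, v)))
    + (s * 1 + ((s * wcos v s + (-1) * (s * (s * wcos v s)) + v ^ 2 * wcos v s)
       + (v * wsin v s + (- 2 * v) * (s * wsin v s)))))).
  set (B := fun s => ((Im (zeta (s, v)) + (-1) * (s * Im (zeta (s, v))) + (- v) * Re (zeta (s, v)))
    + (v * 1 + ((v * wcos v s + (- 2 * v) * (s * wcos v s))
       + (-1) * (s * wsin v s + (-1) * (s * (s * wsin v s)) + v ^ 2 * wsin v s))))).
  assert (HA0 : forall s, 1 < s -> A s = 0 /\ B s = 0).
  { intros s Hs. destruct (zeta_right_half_plane zeta v s Hz Hs) as [Z1 Z2].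
    change (is_lim_seq (sum_n (dirichlet_cos v s)) (Re (zeta (s, v)))) in Z1.
    change (is_lim_seq (sum_n (dirichlet_sin v s)) (- Im (zeta (s, v)))) in Z2.
    destruct (boundary_term_lim v s Hs) as [T1 T2].
    destruct (euler_maclaurin_lim v s ltac:(lra)) as [L1 L2].
    assert (M1 : is_lim_seq (euler_maclaurin_re v s) ((1 - s) * Re (zeta (s, v)) - v * - Im (zeta (s, v)) - 0)).
    { apply is_lim_seq_minus'; [|exact T1]. apply is_lim_seq_minus'.
      - exact (is_lim_seq_scal_l _ (1 - s) _ Z1).
      - exact (is_lim_seq_scal_l _ v _ Z2). }
    assert (M2 : is_lim_seq (euler_maclaurin_im v s) (- ((1 - s) * - Im (zeta (s, v)) + v * Re (zeta (s, v))) + 0)).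
    { apply is_lim_seq_plus'; [|exact T2].
      apply (is_lim_seq_opp _ (Finite ((1 - s) * - Im (zeta (s, v)) + v * Re (zeta (s, v))))). apply is_lim_seq_plus'.
      - exact (is_lim_seq_scal_l _ (1 - s) _ Z2).
      - exact (is_lim_seq_scal_l _ v _ Z1). }
    apply is_lim_seq_unique in L1, L2, M1, M2. rewrite M1 in L1. rewrite M2 in L2.
    injection L1 as L1. injection L2 as L2. unfold A, B. split; lra. }
  intros sigma Hs p q.
  assert (HA : A sigma = 0).
  { apply (real_analytic_identity A 0 1); [|intros x Hx; apply HA0, Hx|exact Hs].
    intros x Hx. destruct (Hana x) as [Z1 Z2]. specialize (Hwc x Hx). specialize (Hws x Hx). unfold A.
    real_analytic_auto. }
  assert (HB : B sigma = 0).
  { apply (real_analytic_identity B 0 1); [|intros x Hx; apply HA0, Hx|exact Hs].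
    intros x Hx. destruct (Hana x) as [Z1 Z2]. specialize (Hwc x Hx). specialize (Hws x Hx). unfold B.
    real_analytic_auto. }
  unfold A in HA. unfold B in HB. unfold p, q. split; lra.
Qed.

(** At [sigma = 1/2] the product [s (1 - s)] is the real number [1/4 + v^2], so [q = 0]; solving the
    two equations of [zeta_continuation] for the imaginary part gives this formula. *)
Definition zeta_im (v : R) : R :=
  - v / (/ 4 + v ^ 2) - v * wcos v (/ 2) + wsin v (/ 2) / 2.

Lemma zeta_im_correct (zeta : C -> C) (v : R) : is_riemann_zeta zeta -> 0 < v ->
  Im (zeta (Cplus (RtoC (1 / 2)) (Cmult Ci (RtoC v)))) = zeta_im v.
Proof.
  intros Hz Hv.
  replace (Cplus (RtoC (1 / 2)) (Cmult Ci (RtoC v))) with ((/ 2, v) : C).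
  2:{ unfold Cplus, Cmult, Ci, RtoC; simpl. f_equal; field. }
  destruct (zeta_continuation zeta v Hz Hv (/ 2) ltac:(lra)) as [H1 H2].
  unfold zeta_im. set (X := Re (zeta (/ 2, v))) in *. set (Y := Im (zeta (/ 2, v))) in *.
  assert (Hp : 0 < / 4 + v ^ 2) by nra.
  apply Rmult_eq_reg_l with (/ 4 + v ^ 2); [|lra].
  replace ((/ 4 + v ^ 2) * (- v / (/ 4 + v ^ 2) - v * wcos v (/ 2) + wsin v (/ 2) / 2))
    with (- v - (/ 4 + v ^ 2) * (v * wcos v (/ 2) - wsin v (/ 2) / 2)) by (field; lra).
  replace ((/ 4 + v ^ 2) * Y) with (v * ((1 - / 2) * X + v * Y) + ((1 - / 2) * Y - v * X) / 2) by field.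
  rewrite H1, H2. field.
Qed.

Definition zeta_im_approx (m : nat) (v : R) : R :=
  - sum_n (dirichlet_sin v (/ 2)) m
  - INR (S m) * exp (- / 2 * ln (INR (S m))) * pole_term (ln (INR (S m))) v.

Lemma zeta_im_approx_eq (m : nat) (v : R) :
  zeta_im_approx (S m) v = - v / (/ 4 + v ^ 2)
    - v * sum_n (fun n => zcos v n (/ 2)) m + sum_n (fun n => zsin v n (/ 2)) m / 2.
Proof.
  destruct (euler_maclaurin_sum v (/ 2) m) as [E1 E2].
  assert (Hp : 0 < / 4 + v ^ 2) by nra.
  apply Rmult_eq_reg_l with (/ 4 + v ^ 2); [|lra].
  transitivity (v * euler_maclaurin_re v (/ 2) (S m) + euler_maclaurin_im v (/ 2) (S m) / 2).
  - unfold zeta_im_approx, euler_maclaurin_re, euler_maclaurin_im, pole_term.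
    set (SC := sum_n _ _). set (SS := sum_n _ _).
    unfold dirichlet_cos, dirichlet_sin. clearbody SC SS. generalize (INR (S (S m))). intros N.
    field. lra.
  - rewrite E1, E2. field. lra.
Qed.

Definition zeta_tail (m : nat) : R :=
  Series (fun k => exp (- (1 + / 2) * ln (INR (S (S m + k))))).

Lemma zeta_tail_lim : is_lim_seq zeta_tail 0.
Proof.
  set (u := fun n => exp (- (1 + / 2) * ln (INR (S n)))).
  assert (Hu : ex_series u) by (apply ex_series_power; lra).
  apply (is_lim_seq_ext (fun m => Series u - sum_n u m)).
  - intros m. rewrite (Series_incr_n u (S m)) by (lia || exact Hu). simpl Init.Nat.pred.
    rewrite <- sum_n_Reals. unfold zeta_tail, u. ring.
  - replace (Finite 0) with (Finite (Series u - Series u)) by (f_equal; ring).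
    apply is_lim_seq_minus'; [apply is_lim_seq_const|]. exact (Series_correct u Hu).
Qed.

(** The bound separates [m] from [v], and its linear growth in [v] is harmless against the
    exponential decay of [ker]. *)
Lemma zeta_im_approx_error (m : nat) (v : R) :
  Rabs (zeta_im v - zeta_im_approx (S m) v) <= (/ 2 + Rabs v) * zeta_tail m.
Proof.
  assert (Htail : forall w, bounded_smooth w ->
    Rabs (Series (fun n => zint w n (/ 2)) - sum_n (fun n => zint w n (/ 2)) m) <= zeta_tail m).
  { intros w Hw. assert (He := ex_series_zint w (/ 2) Hw ltac:(lra)).
    rewrite (Series_incr_n _ (S m)) by (lia || exact He). simpl Init.Nat.pred.
    rewrite <- sum_n_Reals.
    match goal with |- Rabs (?a + ?b - ?a) <= _ => replace (a + b - a) with b by ring end.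
    apply Series_Rabs_le.
    - intros k. apply zint_abs; [exact Hw|lra].
    - apply (ex_series_incr_n (fun n => exp (- (1 + / 2) * ln (INR (S n)))) (S m)).
      apply ex_series_power; lra. }
  rewrite zeta_im_approx_eq. unfold zeta_im.
  assert (H1 := Htail _ (bounded_smooth_cos v)). assert (H2 := Htail _ (bounded_smooth_sin v)).
  unfold wcos, wsin, zcos, zsin.
  set (a := Series (fun n => zint (fun l => cos (v * l)) n (/ 2))) in *.
  set (b := Series (fun n => zint (fun l => sin (v * l)) n (/ 2))) in *.
  set (c := sum_n (fun n => zint (fun l => cos (v * l)) n (/ 2)) m) in *.
  set (d := sum_n (fun n => zint (fun l => sin (v * l)) n (/ 2)) m) in *.
  match goal with |- Rabs ?x <= _ => replace x with (/ 2 * (b - d) - v * (a - c)) by lra end.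
  eapply Rle_trans; [apply Rabs_triang|]. rewrite Rabs_Ropp, !Rabs_mult, (Rabs_pos_eq (/ 2)) by lra.
  assert (Hv := Rabs_pos v). nra.
Qed.

(** * Termwise integration *)

Lemma improper_partial_le (g : R -> R) (G b : R) : 0 <= b ->
  (forall v, 0 <= v -> 0 <= g v) -> improper g G -> RInt g 0 b <= G.
Proof.
  intros Hb Hg [Hex Hl].
  apply (@filterlim_le R (Rbar_locally p_infty) _ (fun _ => RInt g 0 b) (fun x => RInt g 0 x) (RInt g 0 b) G);
    [|apply filterlim_const|exact Hl].
  eapply filter_imp; [|apply (eventually_ge b)]. intros x Hx; simpl in Hx.
  assert (E1 : ex_RInt g 0 b) by (apply Hex; lra).
  assert (E2 : ex_RInt g b x) by (apply (ex_RInt_Chasles_2 g 0); [lra|apply Hex; lra]).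
  assert (E : RInt g 0 b + RInt g b x = RInt g 0 x) by exact (RInt_Chasles g 0 b x E1 E2).
  assert (H := RInt_ge_0 g b x Hx E2 ltac:(intros y Hy; apply Hg; lra)). lra.
Qed.

(** A substitute for dominated convergence. Boundedness of [g] gives uniform convergence, hence
    integrability of [f] on bounded intervals; integrability of [g] makes the error at most
    [tau m * G] for all upper limits at once. *)
Lemma improper_uniform_limit (f g : R -> R) (fm : nat -> R -> R) (lm tau : nat -> R) (l G K : R) :
  (forall m, improper (fm m) (lm m)) -> is_lim_seq lm l ->
  improper g G -> (forall v, 0 <= v -> 0 <= g v <= K) -> is_lim_seq tau 0 ->
  (forall m v, 0 <= v -> Rabs (f v - fm m v) <= tau m * g v) -> improper f l.
Proof.
  intros Hfm Hlm Hg HgK Htau Hf.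
  assert (HK : 0 <= K) by (destruct (HgK 0 (Rle_refl 0)); lra).
  assert (HG : 0 <= G).
  { assert (H := improper_partial_le g G 0 (Rle_refl 0) (fun v Hv => proj1 (HgK v Hv)) Hg).
    rewrite RInt_point in H. exact H. }
  assert (Htau' : forall C, 0 <= C -> forall eps : posreal, eventually (fun m => Rabs (tau m) * C < eps)).
  { intros C HC eps.
    assert (Hd : 0 < eps / (C + 1)) by (apply Rdiv_lt_0_compat; [apply cond_pos|lra]).
    apply is_lim_seq_spec in Htau. specialize (Htau (mkposreal _ Hd)).
    eapply filter_imp; [|exact Htau]. intros m Hm; simpl in Hm. rewrite Rminus_0_r in Hm.
    apply Rle_lt_trans with (Rabs (tau m) * (C + 1)); [apply Rmult_le_compat_l; [apply Rabs_pos|lra]|].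
    apply Rlt_le_trans with (eps / (C + 1) * (C + 1)); [apply Rmult_lt_compat_r; lra|].
    right; field; lra. }
  assert (Hex : forall b, 0 <= b -> ex_RInt f 0 b).
  { intros b Hb.
    (* [filterlim_RInt] asks for uniform convergence on the whole line, while the bound holds for
       [v >= 0] only; composing with [Rabs] extends it without changing the integrals. *)
    assert (Habs : forall h : R -> R, forall x, Rmin 0 b < x < Rmax 0 b -> h (Rabs x) = h x).
    { intros h x Hx. rewrite Rmin_left in Hx by lra. rewrite Rabs_pos_eq by lra. reflexivity. }
    apply (ex_RInt_ext (fun x => f (Rabs x))); [apply Habs|].
    destruct (filterlim_RInt (V := R_CompleteNormedModule) (fun m x => fm m (Rabs x)) 0 b eventually _ (fun x => f (Rabs x))
      (fun m => RInt (fm m) 0 b)) as [If [_ HIf]].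
    - intros m. apply (is_RInt_ext (fm m)); [intros x Hx; symmetry; apply Habs, Hx|].
      apply (RInt_correct (fm m)), Hfm, Hb.
    - intros P [eps HP]. unfold filtermap. eapply filter_imp; [|apply (Htau' K HK eps)].
      intros m Hm. apply HP. intros x. change (Rabs (fm m (Rabs x) - f (Rabs x)) < eps).
      rewrite Rabs_minus_sym. eapply Rle_lt_trans; [apply Hf, Rabs_pos|].
      assert (H := HgK (Rabs x) (Rabs_pos x)). assert (H1 := Rle_abs (tau m)). assert (H2 := Rabs_pos (tau m)). nra.
    - exists If. exact HIf. }
  split; [exact Hex|].
  intros P [eps HP]. unfold filtermap.
  assert (He3 : 0 < eps / 3) by (assert (H := cond_pos eps); lra).
  assert (Hlm' : eventually (fun m => Rabs (lm m - l) < eps / 3)).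
  { apply is_lim_seq_spec in Hlm. exact (Hlm (mkposreal _ He3)). }
  destruct (filter_and _ _ Hlm' (Htau' G HG (mkposreal _ He3))) as [m Hm].
  destruct (Hm m (le_n m)) as [Hm1 Hm2]. simpl in Hm2. clear Hm.
  destruct (Hfm m) as [Hexm Hlimm].
  assert (Hb := Hlimm _ (locally_ball (lm m) (mkposreal _ He3))). unfold filtermap in Hb.
  eapply filter_imp; [|apply filter_and; [exact Hb|apply (eventually_ge 0)]].
  intros b [Hb1 Hb0]. apply HP. change (Rabs (RInt f 0 b - l) < eps).
  change (Rabs (RInt (fm m) 0 b - lm m) < eps / 3) in Hb1.
  assert (Hd : Rabs (RInt f 0 b - RInt (fm m) 0 b) <= Rabs (tau m) * G).
  { apply Rle_trans with (Rabs (tau m) * RInt g 0 b).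
    2:{ apply Rmult_le_compat_l; [apply Rabs_pos|].
        apply improper_partial_le; auto. intros v Hv; apply HgK, Hv. }
    assert (I1 := is_RInt_minus _ _ _ _ _ _ (RInt_correct f 0 b (Hex b Hb0)) (RInt_correct (fm m) 0 b (Hexm b Hb0))).
    assert (I2 := is_RInt_scal _ _ _ (Rabs (tau m)) _ (RInt_correct g 0 b (proj1 Hg b Hb0))).
    refine (norm_RInt_le (V := R_NormedModule) _ _ 0 b _ _ Hb0 _ I1 I2).
    intros x Hx. eapply Rle_trans; [apply (Hf m x); lra|].
    apply Rmult_le_compat_r; [apply HgK; lra|apply Rle_abs]. }
  set (A := RInt f 0 b) in *. set (B := RInt (fm m) 0 b) in *.
  assert (Htri : forall x y z w : R, Rabs (x - w) <= Rabs (x - y) + Rabs (y - z) + Rabs (z - w)).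
  { intros x y z w. replace (x - w) with ((x - y) + (y - z) + (z - w)) by ring.
    eapply Rle_trans; [apply Rabs_triang|]. apply Rplus_le_compat_r, Rabs_triang. }
  eapply Rle_lt_trans; [apply (Htri A B (lm m) l)|]. lra.
Qed.

(** * Effect of the weight on the sine and pole terms *)

Definition glasser_weight (v : R) : R := 2 * cos (v * ln 2) - sqrt 2.

(** By the product-to-sum formulas, multiplication by [2 cos (v ln 2)] is the sum of the two shifts
    of [x] by [ln 2] and [- ln 2], that is, of the scales [2N] and [N/2]. *)
Lemma weighted_improper (h : R -> R -> R) (l : R -> R) (k : R -> R) (x : R) :
  (forall v, 2 * cos (v * ln 2) * h x v = h (x + ln 2) v + h (x - ln 2) v) ->
  (forall y, improper (fun v => h y v * k v) (l y)) ->
  improper (fun v => glasser_weight v * (h x v * k v)) (l (x + ln 2) + l (x - ln 2) - sqrt 2 * l x).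
Proof.
  intros Hh Hl.
  apply (improper_ext (fun v => h (x + ln 2) v * k v + h (x - ln 2) v * k v - sqrt 2 * (h x v * k v))).
  - intros v _. unfold glasser_weight. rewrite <- Rmult_plus_distr_r, <- Hh. ring.
  - apply improper_minus; [apply improper_plus|apply improper_scal]; apply Hl.
Qed.

Lemma sin_weight_shift (x v : R) :
  2 * cos (v * ln 2) * sin (x * v) = sin ((x + ln 2) * v) + sin ((x - ln 2) * v).
Proof.
  rewrite Rmult_plus_distr_r, Rmult_minus_distr_r, sin_plus, sin_minus, (Rmult_comm (ln 2) v). ring.
Qed.

Lemma pole_weight_shift (x v : R) :
  2 * cos (v * ln 2) * pole_term x v = pole_term (x + ln 2) v + pole_term (x - ln 2) v.
Proof.
  unfold pole_term. rewrite Rmult_plus_distr_l, Rmult_minus_distr_l, sin_plus, sin_minus, cos_plus, cos_minus.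
  field. nra.
Qed.

Lemma improper_sum_n (f : nat -> R -> R) (l : nat -> R) (m : nat) :
  (forall n, improper (f n) (l n)) -> improper (fun v => sum_n (fun n => f n v) m) (sum_n l m).
Proof.
  intros H. induction m as [|m IH].
  - rewrite sum_O. apply (improper_ext (f O)); [intros v _; rewrite sum_O; reflexivity|apply H].
  - rewrite sum_Sn. apply (improper_ext (fun v => sum_n (fun n => f n v) m + f (S m) v)).
    + intros v _; rewrite sum_Sn; reflexivity.
    + apply improper_plus; auto.
Qed.

Definition sech_term (phi : R) (n : nat) : R :=
  exp (- / 2 * ln (INR (S n))) * (sech_transform (ln (INR (S n)) + ln 2) phi
    + sech_transform (ln (INR (S n)) - ln 2) phi - sqrt 2 * sech_transform (ln (INR (S n))) phi).

Definition pole_value (phi L : R) : R := - exp (- L / 2) * pole_primitive phi (exp L).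

Definition approx_value (phi : R) (m : nat) : R :=
  - sum_n (sech_term phi) m
  - INR (S m) * exp (- / 2 * ln (INR (S m))) *
     (pole_value phi (ln (INR (S m)) + ln 2) + pole_value phi (ln (INR (S m)) - ln 2)
      - sqrt 2 * pole_value phi (ln (INR (S m)))).

Lemma approx_transform (phi : R) (m : nat) : 0 < phi < PI ->
  improper (fun v => glasser_weight v * zeta_im_approx m v * ker phi v) (approx_value phi m).
Proof.
  intros Hp.
  set (e := fun n => exp (- / 2 * ln (INR (S n)))).
  apply (improper_ext (fun v =>
    (-1) * sum_n (fun n => e n * (glasser_weight v * (sin (ln (INR (S n)) * v) * ker phi v))) m
    - INR (S m) * e m * (glasser_weight v * (pole_term (ln (INR (S m))) v * ker phi v)))).
  - intros v _. unfold zeta_im_approx.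
    replace (sum_n (fun n => e n * (glasser_weight v * (sin (ln (INR (S n)) * v) * ker phi v))) m)
      with (glasser_weight v * ker phi v * sum_n (dirichlet_sin v (/ 2)) m).
    + unfold e. ring.
    + rewrite <- (sum_n_mult_l (K := R_Ring)). apply sum_n_ext. intros n. unfold dirichlet_sin, e.
      rewrite (Rmult_comm (ln _) v). unfold mult; simpl. ring.
  - unfold approx_value. replace (- sum_n (sech_term phi) m) with (-1 * sum_n (sech_term phi) m) by ring.
    apply improper_minus.
    + apply improper_scal, improper_sum_n. intros n. unfold sech_term. apply improper_scal.
      apply (weighted_improper (fun x v => sin (x * v)) (fun x => sech_transform x phi) (ker phi)).
      * intros v; apply sin_weight_shift.
      * intros y; apply sine_transform; lra.
    + apply improper_scal.
      apply (weighted_improper pole_term (pole_value phi) (ker phi)).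
      * intros v; apply pole_weight_shift.
      * intros y; apply pole_transform, Hp.
Qed.

Lemma glasser_weight_abs (v : R) : Rabs (glasser_weight v) <= 4.
Proof.
  unfold glasser_weight. assert (H := COS_bound (v * ln 2)).
  assert (H1 : 0 <= sqrt 2) by apply sqrt_pos.
  assert (H2 : sqrt 2 <= 2). { rewrite <- (sqrt_pow2 2) at 2 by lra. apply sqrt_le_1; lra. }
  apply Rabs_le; split; lra.
Qed.

Lemma zeta_im_transform (phi l : R) : 0 < phi < PI -> is_lim_seq (approx_value phi) l ->
  improper (fun v => glasser_weight v * zeta_im v * ker phi v) l.
Proof.
  intros Hp Hl. set (a := PI - phi). assert (Ha : 0 < a) by (unfold a; lra).
  apply (improper_uniform_limit _ (fun v => 4 * (/ 2 * exp (- a * v) + v * exp (- a * v)))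
    (fun m v => glasser_weight v * zeta_im_approx (S m) v * ker phi v)
    (fun m => approx_value phi (S m)) zeta_tail l (4 * (/ 2 * / a + / a ^ 2)) (4 * (/ 2 + / a))).
  - intros m. apply approx_transform, Hp.
  - apply -> is_lim_seq_incr_1. exact Hl.
  - apply improper_scal, improper_plus; [apply improper_scal, improper_exp|apply improper_id_exp]; exact Ha.
  - intros v Hv. assert (He := exp_pos (- a * v)).
    assert (E1 : exp (- a * v) <= 1) by (rewrite <- exp_0; apply exp_le_compat; nra).
    assert (E2 : v * exp (- a * v) <= / a).
    { apply Rmult_le_reg_l with a; [exact Ha|]. rewrite Rinv_r by lra.
      assert (H := exp_ineq1_le (a * v)).
      assert (E : exp (- a * v) * exp (a * v) = 1).
      { rewrite <- exp_plus. replace (- a * v + a * v) with 0 by ring. apply exp_0. }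
      nra. }
    split; [nra|lra].
  - exact zeta_tail_lim.
  - intros m v Hv.
    replace (glasser_weight v * zeta_im v * ker phi v - glasser_weight v * zeta_im_approx (S m) v * ker phi v)
      with (glasser_weight v * (zeta_im v - zeta_im_approx (S m) v) * ker phi v) by ring.
    rewrite !Rabs_mult.
    assert (H1 := glasser_weight_abs v). assert (H2 := zeta_im_approx_error m v).
    rewrite (Rabs_pos_eq v) in H2 by exact Hv.
    assert (H3 := ker_abs phi v Hv). rewrite (Rabs_pos_eq phi) in H3 by lra. fold a in H3.
    replace (zeta_tail m * (4 * (/ 2 * exp (- a * v) + v * exp (- a * v))))
      with (4 * ((/ 2 + v) * zeta_tail m) * exp (- a * v)) by ring.
    apply Rmult_le_compat; [apply Rmult_le_pos; apply Rabs_pos|apply Rabs_pos| |exact H3].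
    apply Rmult_le_compat; auto using Rabs_pos.
Qed.

(** * The closed form of the integral *)

Definition harmonic (n : nat) : R := sum_n (fun k => / INR (S k)) n.

Lemma ln_le_sub_1 (x : R) : 0 < x -> ln x <= x - 1.
Proof. intros Hx. assert (H := exp_ineq1_le (ln x)). rewrite exp_ln in H by exact Hx. lra. Qed.

Lemma harmonic_S (n : nat) : harmonic (S n) = harmonic n + / (INR (S n) + 1).
Proof. unfold harmonic. rewrite sum_Sn, (S_INR (S n)). reflexivity. Qed.

(** [euler_gamma] is read off a total [Lim_seq], so convergence must be proved: the sequence
    decreases and is nonnegative, both by [ln x <= x - 1]. *)
Lemma euler_gamma_lim : is_lim_seq (fun n => harmonic n - ln (INR (S n))) euler_gamma.
Proof.
  set (u := fun n => harmonic n - ln (INR (S n))).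
  assert (Hex : ex_finite_lim_seq u).
  { apply (ex_finite_lim_seq_decr u 0).
    - intros n. unfold u. rewrite harmonic_S, (S_INR (S n)). assert (Hn := S_INR_pos n).
      set (N := INR (S n)) in *.
      assert (H := ln_le_sub_1 (N / (N + 1)) ltac:(apply Rdiv_lt_0_compat; lra)).
      rewrite ln_div in H by lra.
      replace (N / (N + 1) - 1) with (- / (N + 1)) in H by (field; lra). lra.
    - intros n. unfold u.
      assert (Hn : ln (INR (S n) + 1) <= harmonic n).
      { induction n as [|n IH].
        - unfold harmonic. rewrite sum_O. assert (H := ln_le_sub_1 (INR 1 + 1) ltac:(simpl; lra)).
          simpl in *. lra.
        - rewrite harmonic_S. assert (HS := S_INR_pos n). rewrite (S_INR (S n)).
          set (N := INR (S n)) in *.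
          assert (H := ln_le_sub_1 ((N + 1 + 1) / (N + 1)) ltac:(apply Rdiv_lt_0_compat; lra)).
          rewrite ln_div in H by lra.
          replace ((N + 1 + 1) / (N + 1) - 1) with (/ (N + 1)) in H by (field; lra). lra. }
      assert (ln (INR (S n)) <= ln (INR (S n) + 1)) by (apply ln_le; [apply S_INR_pos|lra]). lra. }
  apply Lim_seq_correct' in Hex.
  (* The definition is indexed by [n], [u] by [n + 1]; the shift leaves out the term involving
     [ln 0]. *)
  replace euler_gamma with (real (Lim_seq u)); [exact Hex|].
  unfold euler_gamma. rewrite <- (Lim_seq_incr_1 (fun n => sum_n_m (fun k => / INR k) 1 n - ln (INR n))). apply f_equal, Lim_seq_ext. intros n.
  unfold u. f_equal. exact (sum_n_m_S (fun k => / INR k) 0 n).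
Qed.

(* At [t = 1] the numerator vanishes identically, so the junk value [0 / 0 = 0] at
   [phi = PI] is the analytic one. *)
Definition ratio (t phi : R) : R := sin (phi / 2) * (t - 1) * t / (t ^ 2 + 2 * t * cos phi + 1).

(** [sin (phi / 2)] is the limit of [ratio t phi] as [t] grows. The difference is [O(1 / t)], which
    makes the sum over [N] converge once divided by [N]. *)
Definition ratio_tail (t phi : R) : R := ratio t phi - sin (phi / 2).

Lemma sech_transform_ratio (u phi : R) : - PI < phi < PI ->
  sech_transform u phi = exp (- u / 2) * ratio (exp u) phi.
Proof.
  intros Hp. rewrite sech_transform_exp by exact Hp. unfold ratio.
  assert (Hq := quad_pos (exp u) phi Hp (Rlt_le _ _ (exp_pos u))).
  assert (E : exp (u / 2) = exp (- u / 2) * exp u).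
  { rewrite <- exp_plus. f_equal. field. }
  rewrite E. field. lra.
Qed.

Lemma exp_half_ln_2 : exp (ln 2 / 2) = sqrt 2.
Proof.
  rewrite <- (sqrt_pow2 (exp (ln 2 / 2))) by (left; apply exp_pos). f_equal.
  simpl. rewrite Rmult_1_r, <- exp_plus. replace (ln 2 / 2 + ln 2 / 2) with (ln 2) by field.
  apply exp_ln; lra.
Qed.

Lemma exp_opp_half_ln_2 : exp (- (ln 2 / 2)) = sqrt 2 / 2.
Proof.
  rewrite exp_Ropp, exp_half_ln_2.
  assert (H : sqrt 2 * sqrt 2 = 2) by (apply sqrt_sqrt; lra).
  assert (H1 : 0 < sqrt 2) by (apply sqrt_lt_R0; lra).
  apply Rmult_eq_reg_l with (sqrt 2); [|lra]. rewrite Rinv_r by lra. lra.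
Qed.

(** The shifts by [ln 2] and [- ln 2] multiply the amplitude by [sqrt 2 / 2] and [sqrt 2]; relative
    to the constant [sqrt 2] in the weight, the scales [2N], [N/2], [N] receive [1/2], [1], [-1]. *)
Lemma three_scales (N : R) (g : R -> R) : 0 < N ->
  exp (- / 2 * ln N) * (exp (- (ln N + ln 2) / 2) * g (exp (ln N + ln 2))
    + exp (- (ln N - ln 2) / 2) * g (exp (ln N - ln 2))
    - sqrt 2 * (exp (- ln N / 2) * g (exp (ln N))))
  = sqrt 2 / N * (g (2 * N) / 2 + g (N / 2) - g N).
Proof.
  intros HN.
  assert (E1 : exp (ln N + ln 2) = 2 * N) by (rewrite exp_plus, !exp_ln by lra; ring).
  assert (E2 : exp (ln N - ln 2) = N / 2).
  { unfold Rminus. rewrite exp_plus, exp_Ropp, !exp_ln by lra. reflexivity. }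
  rewrite E1, E2, exp_ln by exact HN.
  replace (- (ln N + ln 2) / 2) with (- / 2 * ln N + - (ln 2 / 2)) by field.
  replace (- (ln N - ln 2) / 2) with (- / 2 * ln N + ln 2 / 2) by field.
  replace (- ln N / 2) with (- / 2 * ln N) by field.
  rewrite !exp_plus, exp_half_ln_2, exp_opp_half_ln_2.
  assert (E : exp (- / 2 * ln N) * exp (- / 2 * ln N) = / N).
  { rewrite <- exp_plus. replace (- / 2 * ln N + - / 2 * ln N) with (- ln N) by field.
    rewrite exp_Ropp, exp_ln by exact HN. reflexivity. }
  set (e := exp (- / 2 * ln N)) in *.
  transitivity (e * e * sqrt 2 * (g (2 * N) / 2 + g (N / 2) - g N)); [field|].
  rewrite E. field. lra.
Qed.

Definition level_term (n : nat) (phi : R) : R :=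
  (ratio_tail (2 * INR (S n)) phi / 2 + ratio_tail (INR (S n) / 2) phi - ratio_tail (INR (S n)) phi) / INR (S n).

(** The limits [sin (phi / 2)] of the three ratios add up with total weight [1/2 + 1 - 1 = 1/2] to a
    harmonic term, which diverges alone and is balanced by the logarithm in the pole terms. *)
Lemma sech_term_eq (phi : R) (n : nat) : - PI < phi < PI ->
  sech_term phi n = sqrt 2 * (sin (phi / 2) / 2 * / INR (S n) + level_term n phi).
Proof.
  intros Hp. unfold sech_term. rewrite !sech_transform_ratio by exact Hp.
  rewrite (three_scales (INR (S n)) (fun t => ratio t phi)) by apply S_INR_pos.
  unfold level_term, ratio_tail. assert (H := S_INR_pos n). field. lra.
Qed.

Lemma sum_sech_term (phi : R) (m : nat) : - PI < phi < PI ->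
  sum_n (sech_term phi) m
  = sqrt 2 * (sin (phi / 2) / 2 * harmonic m + sum_n (fun n => level_term n phi) m).
Proof.
  intros Hp. unfold harmonic. induction m as [|m IH].
  - rewrite !sum_O. apply sech_term_eq, Hp.
  - rewrite !sum_Sn, IH, sech_term_eq by exact Hp. unfold plus; simpl plus.
    set (a := sum_n _ m). set (b := sum_n _ m). generalize (/ INR (S (S m))). intros c.
    change (sqrt 2 * (sin (phi / 2) / 2 * a + b) + sqrt 2 * (sin (phi / 2) / 2 * c + level_term (S m) phi)
      = sqrt 2 * (sin (phi / 2) / 2 * (a + c) + (b + level_term (S m) phi))). ring.
Qed.

Definition pole_rest (phi t : R) : R := pole_primitive phi t - sin (phi / 2) * ln t.

(** The logarithms of the three scales give [ln (2N) / 2 + ln (N/2) - ln N = ln N / 2 - ln 2 / 2]: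
    the first part renormalises the harmonic sum, the second is the last summand. *)
Lemma approx_value_eq (phi : R) (m : nat) : - PI < phi < PI ->
  approx_value phi m = sqrt 2 * (- (sin (phi / 2) / 2) * (harmonic m - ln (INR (S m)))
    - sum_n (fun n => level_term n phi) m
    + (/ 2 * pole_rest phi (2 * INR (S m)) + pole_rest phi (/ 2 * INR (S m)) - pole_rest phi (1 * INR (S m)))
    - ln 2 / 2 * sin (phi / 2)).
Proof.
  intros Hp. unfold approx_value. rewrite sum_sech_term by exact Hp.
  assert (HN := S_INR_pos m).
  assert (E := three_scales (INR (S m)) (fun t => - pole_primitive phi t) HN).
  unfold pole_value, pole_rest. set (N := INR (S m)) in *. rewrite Rmult_1_l.
  replace (/ 2 * N) with (N / 2) by (unfold Rdiv; ring).
  rewrite (ln_mult 2 N), (ln_div N 2) by lra.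
  apply (f_equal (Rmult N)) in E.
  match type of E with _ = ?r => match goal with |- ?a - ?b = _ =>
    replace b with r by (rewrite <- E; ring) end end.
  field. lra.
Qed.

(** The limit of [approx_value]; the three copies of [- phi cos (phi / 2)] left by the pole terms
    again have total weight [1/2]. *)
Definition J_value (phi : R) : R :=
  sqrt 2 * (- (sin (phi / 2) / 2) * euler_gamma - Series (fun n => level_term n phi)
    - phi / 2 * cos (phi / 2) - ln 2 / 2 * sin (phi / 2)).

Lemma filterlim_scaled_INR (c : R) : 0 < c ->
  filterlim (fun m => c * INR (S m)) eventually (Rbar_locally p_infty).
Proof.
  intros Hc.
  apply (filterlim_comp _ _ _ (fun m => INR (S m)) (fun t => c * t) _ (Rbar_locally p_infty)).
  - apply (is_lim_seq_incr_1 INR p_infty), is_lim_seq_INR.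
  - intros P [M HM]. exists (M / c). intros t Ht. apply HM.
    apply (Rmult_lt_compat_l c) in Ht; [|exact Hc].
    replace (c * (M / c)) with M in Ht by (field; lra). exact Ht.
Qed.

Lemma approx_value_lim (phi : R) : 0 < phi < PI -> ex_series (fun n => level_term n phi) ->
  is_lim_seq (approx_value phi) (J_value phi).
Proof.
  intros Hp Hex.
  assert (HF : forall c, 0 < c -> is_lim_seq (fun m => pole_rest phi (c * INR (S m))) (- phi * cos (phi / 2))).
  { intros c Hc. apply (filterlim_comp _ _ _ (fun m => c * INR (S m)) (pole_rest phi) _ (Rbar_locally p_infty)).
    - apply filterlim_scaled_INR, Hc.
    - apply pole_primitive_infty, Hp. }
  apply (is_lim_seq_ext (fun m => sqrt 2 * (- (sin (phi / 2) / 2) * (harmonic m - ln (INR (S m)))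
    - sum_n (fun n => level_term n phi) m
    + (/ 2 * pole_rest phi (2 * INR (S m)) + pole_rest phi (/ 2 * INR (S m)) - pole_rest phi (1 * INR (S m)))
    - ln 2 / 2 * sin (phi / 2)))).
  { intros m. symmetry. apply approx_value_eq. lra. }
  replace (J_value phi) with (sqrt 2 * (- (sin (phi / 2) / 2) * euler_gamma
    - Series (fun n => level_term n phi)
    + (/ 2 * (- phi * cos (phi / 2)) + (- phi * cos (phi / 2)) - (- phi * cos (phi / 2)))
    - ln 2 / 2 * sin (phi / 2))) by (unfold J_value; field).
  assert (Hsc : forall (c l : R) (u : nat -> R), is_lim_seq u l -> is_lim_seq (fun n => c * u n) (c * l)).
  { intros c l u Hu. exact (is_lim_seq_scal_l u c l Hu). }
  apply Hsc. apply is_lim_seq_minus'; [|apply is_lim_seq_const].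
  apply is_lim_seq_plus'.
  - apply is_lim_seq_minus'; [apply Hsc, euler_gamma_lim|]. exact (Series_correct _ Hex).
  - apply is_lim_seq_minus'; [|apply HF; lra].
    apply is_lim_seq_plus'; [apply Hsc|]; apply HF; lra.
Qed.

(** * Analyticity and the value at pi *)

Lemma quad_pos_ne1 (t phi : R) : 1 < t -> 0 < t ^ 2 + 2 * t * cos phi + 1.
Proof. intros Ht. assert (H := COS_bound phi). nra. Qed.

(* The three-term recurrence for [sin ((k + 1/2) phi)] turns the geometric sum into
   a linear equation. *)
Lemma ratio_series (t phi : R) : 1 < t ->
  is_series (fun k => (- / t) ^ k * sin ((INR k + / 2) * phi)) (ratio t phi).
Proof.
  intros Ht. set (q := - / t). set (c := fun k => q ^ k * sin ((INR k + / 2) * phi)).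
  assert (Hit : 0 < / t < 1).
  { split; [apply Rinv_0_lt_compat; lra|]. rewrite <- Rinv_1. apply Rinv_lt_contravar; lra. }
  assert (Hex : ex_series c).
  { apply (ex_series_Rabs_le _ (fun k => (/ t) ^ k)).
    - intros k. unfold c. rewrite Rabs_mult, <- RPow_abs. unfold q. rewrite Rabs_Ropp, (Rabs_pos_eq (/ t)) by lra.
      rewrite <- (Rmult_1_r ((/ t) ^ k)) at 2. apply Rmult_le_compat_l; [apply pow_le; lra|].
      apply Rabs_le, SIN_bound.
    - apply ex_series_geom. rewrite Rabs_pos_eq; lra. }
  assert (Hrec : forall k, c (S (S k)) = 2 * q * cos phi * c (S k) - q ^ 2 * c k).
  { intros k. unfold c. rewrite !S_INR.
    replace ((INR k + 1 + 1 + / 2) * phi) with ((INR k + 1 + / 2) * phi + phi) by ring.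
    replace ((INR k + / 2) * phi) with ((INR k + 1 + / 2) * phi - phi) by ring.
    rewrite sin_plus, sin_minus. simpl. ring. }
  assert (Hs := Series_correct c Hex). set (s := Series c) in *.
  assert (H1 := is_series_tail c s Hs). assert (H2 := is_series_tail _ _ H1). cbv beta in H2.
  assert (H3 : is_series (fun k => c (S (S k))) (2 * q * cos phi * (s - c O) - q ^ 2 * s)).
  { apply (is_series_ext (fun k => minus (scal (2 * q * cos phi) (c (S k))) (scal (q ^ 2) (c k)))).
    - intros k. rewrite Hrec. reflexivity.
    - apply (is_series_minus (V := R_NormedModule)); apply (is_series_scal (V := R_NormedModule)); assumption. }
  assert (E : s - c O - c 1%nat = 2 * q * cos phi * (s - c O) - q ^ 2 * s).
  { apply is_series_unique in H2. apply is_series_unique in H3. rewrite <- H2, <- H3. reflexivity. }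
  replace (ratio t phi) with s; [exact Hs|].
  assert (Hq := quad_pos_ne1 t phi Ht).
  assert (C0 : c O = sin (phi / 2)).
  { unfold c. simpl. rewrite Rmult_1_l. f_equal. field. }
  assert (C1 : c 1%nat = q * (sin (phi / 2) * (2 * cos phi + 1))).
  { unfold c. replace (INR 1) with 1 by reflexivity.
    replace ((1 + / 2) * phi) with (phi + phi / 2) by field. rewrite sin_plus.
    replace (sin phi) with (2 * sin (phi / 2) * cos (phi / 2)).
    2:{ rewrite <- sin_2a. f_equal. field. }
    replace (cos phi) with (2 * cos (phi / 2) ^ 2 - 1).
    2:{ replace phi with (2 * (phi / 2)) at 2 by field. rewrite cos_2a_cos. ring. }
    ring. }
  rewrite C0, C1 in E. unfold ratio.
  apply Rmult_eq_reg_r with (t ^ 2 + 2 * t * cos phi + 1); [|lra].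
  set (D := t ^ 2 + 2 * t * cos phi + 1) in *.
  replace (sin (phi / 2) * (t - 1) * t / D * D) with (sin (phi / 2) * (t - 1) * t) by (field; lra).
  unfold D.
  assert (Hqt : q * t = -1) by (unfold q; field; lra).
  apply (f_equal (Rmult (t ^ 2))) in E.
  replace (t ^ 2 * (s - sin (phi / 2) - q * (sin (phi / 2) * (2 * cos phi + 1))))
    with (t ^ 2 * s - t ^ 2 * sin (phi / 2) - (q * t) * t * (sin (phi / 2) * (2 * cos phi + 1))) in E by ring.
  replace (t ^ 2 * (2 * q * cos phi * (s - sin (phi / 2)) - q ^ 2 * s))
    with (2 * (q * t) * t * cos phi * (s - sin (phi / 2)) - (q * t) ^ 2 * s) in E by ring.
  rewrite Hqt in E. lra.
Qed.

Lemma exp_INR_mult (k : nat) (x : R) : exp (INR k * x) = exp x ^ k.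
Proof.
  induction k as [|k IH]; [simpl; rewrite Rmult_0_l; apply exp_0|].
  rewrite S_INR, Rmult_plus_distr_r, exp_plus, IH, Rmult_1_l. simpl. ring.
Qed.

Definition ratio_coef (t x0 : R) (j : nat) : R :=
  Series (fun k => (- / t) ^ S k * sin_coef (INR (S k) + / 2) x0 j).

Lemma ratio_tail_expansion (t x0 : R) : 3 / 2 <= t ->
  expansion (ratio_coef t x0) (ratio_tail t) x0 (12 * / t) (/ 5).
Proof.
  intros Ht.
  assert (Hit : 0 < / t <= 2 / 3).
  { split; [apply Rinv_0_lt_compat; lra|].
    replace (2 / 3) with (/ (3 / 2)) by field. apply Rinv_le_contravar; lra. }
  assert (Hexp : forall x, 0 <= x < 1 -> exp x <= / (1 - x)).
  { intros x Hx. assert (H := exp_ineq1_le (- x)). assert (H0 := exp_pos x).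
    assert (E : exp x * exp (- x) = 1) by (rewrite <- exp_plus, Rplus_opp_r; apply exp_0).
    apply Rmult_le_reg_r with (1 - x); [lra|]. rewrite Rinv_l by lra. nra. }
  assert (Hser : is_series (fun k => 2 * / t * (5 / 6) ^ k) (12 * / t)).
  { replace (12 * / t) with (scal (2 * / t) (/ (1 - 5 / 6))) by (unfold scal; simpl; unfold mult; simpl; field; lra).
    apply (is_series_scal (V := R_NormedModule)), is_series_geom. rewrite Rabs_pos_eq; lra. }
  rewrite <- (is_series_unique _ _ Hser).
  apply (expansion_ext _ (fun x => Series (fun k => (- / t) ^ S k * sin ((INR (S k) + / 2) * x)))).
  { intros x. apply is_series_unique.
    assert (H := is_series_tail _ _ (ratio_series t x ltac:(lra))). cbv beta in H.
    unfold ratio_tail. replace (sin (x / 2)) with ((- / t) ^ 0 * sin ((INR 0 + / 2) * x)); [exact H|].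
    simpl. rewrite Rmult_1_l. f_equal. field. }
  apply (expansion_series (fun k j => (- / t) ^ S k * sin_coef (INR (S k) + / 2) x0 j)
    (fun k x => (- / t) ^ S k * sin ((INR (S k) + / 2) * x))).
  - lra.
  - intros k. eapply expansion_weaken; [|apply expansion_scal, expansion_sin; [|lra]].
    2:{ assert (H := S_INR_pos k). lra. }
    rewrite <- RPow_abs, Rabs_Ropp, (Rabs_pos_eq (/ t)) by lra.
    replace ((INR (S k) + / 2) * / 5) with (INR k * / 5 + 3 / 10) by (rewrite S_INR; field).
    rewrite exp_plus, exp_INR_mult.
    assert (H1 : exp (/ 5) <= 5 / 4) by (replace (5 / 4) with (/ (1 - / 5)) by field; apply Hexp; lra).
    assert (H2 : exp (3 / 10) <= 2).
    { eapply Rle_trans; [apply Hexp; lra|]. replace 2 with (/ / 2) by field. apply Rinv_le_contravar; lra. }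
    assert (H3 : (/ t * exp (/ 5)) ^ k <= (5 / 6) ^ k).
    { assert (H0 := exp_pos (/ 5)). apply pow_incr. nra. }
    rewrite Rpow_mult_distr in H3.
    assert (H4 : 0 <= (5 / 6) ^ k) by (apply pow_le; lra).
    assert (H5 : 0 <= (/ t) ^ k * exp (/ 5) ^ k).
    { apply Rmult_le_pos; apply pow_le; [lra|left; apply exp_pos]. }
    replace ((/ t) ^ S k * (exp (/ 5) ^ k * exp (3 / 10)))
      with (/ t * ((/ t) ^ k * exp (/ 5) ^ k * exp (3 / 10))) by (simpl; ring).
    replace (2 * / t * (5 / 6) ^ k) with (/ t * ((5 / 6) ^ k * 2)) by ring.
    apply Rmult_le_compat_l; [lra|]. assert (H0 := exp_pos (3 / 10)).
    apply Rmult_le_compat; lra.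
  - eexists; exact Hser.
Qed.

Lemma level_term_0 (phi : R) : level_term 0 phi = - / 2 * sin (phi / 2).
Proof.
  unfold level_term, ratio_tail. change (INR 1) with 1.
  assert (H := quad_pos_ne1 2 phi ltac:(lra)).
  assert (E : ratio (1 / 2) phi = - / 2 * ratio 2 phi).
  { unfold ratio. field. repeat split; lra. }
  assert (E1 : ratio 1 phi = 0) by (unfold ratio, Rdiv; ring).
  rewrite E, E1, Rmult_1_r. field.
Qed.

Lemma level_term_1 (phi : R) :
  level_term 1 phi = / 4 * ratio_tail 4 phi - / 2 * sin (phi / 2) - / 2 * ratio_tail 2 phi.
Proof.
  unfold level_term. replace (INR 2) with 2 by (simpl; ring).
  replace (2 * 2) with 4 by ring. replace (2 / 2) with 1 by field.
  replace (ratio_tail 1 phi) with (- sin (phi / 2)).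
  2:{ unfold ratio_tail, ratio, Rdiv. ring. }
  field.
Qed.

Definition level_coef (x0 : R) (n j : nat) : R :=
  / INR (S (S (S n))) * (/ 2 * ratio_coef (2 * INR (S (S (S n)))) x0 j
   + ratio_coef (INR (S (S (S n))) / 2) x0 j + (-1) * ratio_coef (INR (S (S (S n)))) x0 j).

Definition level_bound (n : nat) : R := 39 * exp (- (1 + 1) * ln (INR (S (S (S n))))).

Lemma level_term_expansion (x0 : R) (n : nat) :
  expansion (level_coef x0 n) (level_term (S (S n))) x0 (level_bound n) (/ 5).
Proof.
  assert (HN : 3 <= INR (S (S (S n)))).
  { rewrite !S_INR. assert (H := pos_INR n). lra. }
  unfold level_coef, level_bound. 
  apply (expansion_ext _ (fun x => / INR (S (S (S n))) * (/ 2 * ratio_tail (2 * INR (S (S (S n)))) x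
   + ratio_tail (INR (S (S (S n))) / 2) x + (-1) * ratio_tail (INR (S (S (S n)))) x))).
  { intros x. unfold level_term. field. lra. }
  revert HN. generalize (INR (S (S (S n)))). intros N HN.
  eapply expansion_weaken; [|apply expansion_scal, expansion_plus; [lra|apply expansion_plus; [lra| |]|];
    [apply expansion_scal, ratio_tail_expansion; lra|apply ratio_tail_expansion; lra
    |apply expansion_scal, ratio_tail_expansion; lra]].
  replace (- (1 + 1) * ln N) with (- ln N + - ln N) by ring.
  rewrite exp_plus, exp_Ropp, exp_ln by lra.
  rewrite !Rabs_pos_eq by (lra || (left; apply Rinv_0_lt_compat; lra)).
  replace (Rabs (-1)) with 1 by (rewrite Rabs_left; lra).
  right. field. lra.
Qed.

Lemma ex_series_level_bound : ex_series level_bound.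
Proof.
  apply (ex_series_scal (V := R_NormedModule) 39 (fun n => exp (- (1 + 1) * ln (INR (S (S (S n))))))).
  apply (ex_series_incr_n (fun n => exp (- (1 + 1) * ln (INR (S n)))) 2).
  apply ex_series_power. lra.
Qed.

Lemma ex_series_level_tail (phi : R) : ex_series (fun n => level_term (S (S n)) phi).
Proof.
  replace phi with (phi + 0) by ring.
  apply (expansion_series_ex (level_coef phi) (fun n => level_term (S (S n))) phi (/ 5) 0 level_bound).
  - lra.
  - apply level_term_expansion.
  - apply ex_series_level_bound.
  - rewrite Rabs_R0. lra.
Qed.

Lemma ex_series_level_term (phi : R) : ex_series (fun n => level_term n phi).
Proof. apply ex_series_incr_1, ex_series_incr_1, ex_series_level_tail. Qed.

Lemma J_value_split (phi : R) : J_value phi = sqrt 2 * ((1 - euler_gamma / 2 - ln 2 / 2) * sin (/ 2 * phi)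
   + ((- / 2) * (phi * cos (/ 2 * phi)) + ((- / 4) * ratio_tail 4 phi + (/ 2 * ratio_tail 2 phi
   + (-1) * Series (fun n => level_term (S (S n)) phi))))).
Proof.
  unfold J_value. rewrite Series_incr_1 by apply ex_series_level_term.
  rewrite Series_incr_1 by (apply ex_series_incr_1, ex_series_level_tail).
  rewrite level_term_0, level_term_1. replace (/ 2 * phi) with (phi / 2) by field. field.
Qed.

Lemma real_analytic_shift (f : R -> R) (c x0 : R) :
  real_analytic f (x0 + c) -> real_analytic (fun x => f (x + c)) x0.
Proof.
  intros [a [d H]]. exists a, d. intros h Hh.
  replace (x0 + h + c) with (x0 + c + h) by ring. apply H, Hh.
Qed.

Lemma real_analytic_sin_half (x0 : R) : real_analytic (fun x => sin (/ 2 * x)) x0.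
Proof. apply (expansion_real_analytic _ _ _ _ 1 Rlt_0_1 (expansion_sin (/ 2) x0 1 ltac:(lra) Rlt_0_1)). Qed.

Lemma real_analytic_J_value (phi : R) : real_analytic J_value phi.
Proof.
  apply (real_analytic_ext (fun phi => sqrt 2 * ((1 - euler_gamma / 2 - ln 2 / 2) * sin (/ 2 * phi)
   + ((- / 2) * (phi * cos (/ 2 * phi)) + ((- / 4) * ratio_tail 4 phi + (/ 2 * ratio_tail 2 phi
   + (-1) * Series (fun n => level_term (S (S n)) phi))))))); [intros x; symmetry; apply J_value_split|].
  assert (Hr : forall t, 3 / 2 <= t -> real_analytic (ratio_tail t) phi).
  { intros t Ht. apply (expansion_real_analytic (ratio_coef t phi) _ _ (12 * / t) (/ 5)); [lra|].
    apply ratio_tail_expansion, Ht. }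
  apply real_analytic_scal. apply real_analytic_plus; [apply real_analytic_scal, real_analytic_sin_half|].
  apply real_analytic_plus.
  { apply real_analytic_scal. apply real_analytic_mult_id.
    apply (real_analytic_ext (fun x => sin (/ 2 * (x + PI)))).
    - intros x. rewrite Rmult_plus_distr_l, (Rmult_comm (/ 2) PI), Rplus_comm.
      rewrite <- sin_shift. replace (PI / 2 - / 2 * x) with (PI - (PI * / 2 + / 2 * x)) by field.
      rewrite sin_PI_x. reflexivity.
    - apply (real_analytic_shift (fun x => sin (/ 2 * x))), real_analytic_sin_half. }
  apply real_analytic_plus; [apply real_analytic_scal, Hr; lra|].
  apply real_analytic_plus; [apply real_analytic_scal, Hr; lra|].
  apply real_analytic_scal.
  apply (expansion_real_analytic (fun j => Series (fun n => level_coef phi n j)) _ _ (Series level_bound) (/ 5)); [lra|].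
  apply (expansion_series (level_coef phi) (fun n => level_term (S (S n)))); [lra| |apply ex_series_level_bound].
  apply level_term_expansion.
Qed.

Lemma real_analytic_at (f : R -> R) (x0 : R) : real_analytic f x0 -> @analytic_at R_AbsRing f x0.
Proof.
  intros [a [d H]]. exists a, d. intros z Hz.
  apply (is_pseries_R a (z - x0) (f z)).
  replace (f z) with (f (x0 + (z - x0))) by (f_equal; ring).
  apply H. exact Hz.
Qed.

Lemma real_analytic_continuous (f : R -> R) (x0 : R) : real_analytic f x0 -> continuous f x0.
Proof.
  intros [a [d H]].
  assert (HCV : Rbar_lt (Rabs 0) (CV_radius a)).
  { rewrite Rabs_R0. apply (CV_radius_pos a (d / 2)).
    - assert (Hd := cond_pos d). lra.
    - eexists. apply H. assert (Hd := cond_pos d). rewrite Rabs_pos_eq; lra. }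
  assert (Hc := PSeries_continuity a 0 HCV). apply continuity_pt_filterlim in Hc.
  assert (E : forall h, Rabs h < d -> PSeries a h = f (x0 + h)).
  { intros h Hh. apply is_pseries_unique, is_pseries_R, H, Hh. }
  apply (continuous_ext_loc _ (fun x => PSeries a (x - x0))).
  - exists d. intros y Hy. replace (f y) with (f (x0 + (y - x0))) by (f_equal; ring). apply E. exact Hy.
  - apply (continuous_comp (fun x => x - x0) (PSeries a)).
    + apply (ex_derive_continuous (V := R_NormedModule) (fun x => x - x0)). auto_derive. auto.
    + rewrite Rminus_diag. exact Hc.
Qed.

Lemma ratio_tail_PI (t : R) : t <> 1 -> ratio_tail t PI = / (t - 1).
Proof.
  intros Ht. unfold ratio_tail, ratio. rewrite sin_PI2, cos_PI.
  field. split; [lra|]. replace (t ^ 2 + 2 * t * -1 + 1) with ((t - 1) ^ 2) by ring.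
  apply pow_nonzero. lra.
Qed.

Lemma level_partial_sum_PI (m : nat) :
  sum_n (fun n => level_term n PI) (S m)
  = harmonic (S (S (S (m + m)))) - harmonic (S m) - 1 - / INR (S m).
Proof.
  induction m as [|m IH].
  - rewrite sum_Sn, sum_O, level_term_0, level_term_1, !ratio_tail_PI, sin_PI2 by lra.
    unfold harmonic. simpl Nat.add. rewrite !sum_Sn, !sum_O. unfold plus; simpl. field.
  - rewrite sum_Sn, IH.
    replace (S (S (S (S m + S m)))) with (S (S (S (S (S (m + m)))))) by lia.
    rewrite (harmonic_S (S (S (S (S (m + m)))))), (harmonic_S (S (S (S (m + m))))), (harmonic_S (S m)).
    unfold level_term. rewrite !S_INR, plus_INR. assert (H := pos_INR m). set (x := INR m) in *.
    rewrite !ratio_tail_PI by lra. unfold plus; simpl. field. repeat split; lra.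
Qed.

Lemma level_series_PI : Series (fun n => level_term n PI) = ln 2 - 1.
Proof.
  apply is_series_unique. change (is_lim_seq (sum_n (fun n => level_term n PI)) (ln 2 - 1)).
  apply is_lim_seq_incr_1.
  apply (is_lim_seq_ext (fun m => ((harmonic (S (S (S (m + m)))) - ln (INR (S (S (S (S (m + m)))))))
     - (harmonic (S m) - ln (INR (S (S m)))) + ln 2) - 1 - / INR (S m))).
  { intros m. rewrite level_partial_sum_PI.
    replace (INR (S (S (S (S (m + m)))))) with (2 * INR (S (S m))) by (rewrite !S_INR, plus_INR; ring).
    rewrite ln_mult by (lra || apply S_INR_pos). ring. }
  replace (ln 2 - 1) with ((euler_gamma - euler_gamma + ln 2) - 1 - 0) by ring.
  apply is_lim_seq_minus'.
  - apply is_lim_seq_minus'; [|apply is_lim_seq_const].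
    apply is_lim_seq_plus'; [|apply is_lim_seq_const].
    apply is_lim_seq_minus'.
    + apply (is_lim_seq_subseq (fun n => harmonic n - ln (INR (S n))) _ (fun m => S (S (S (m + m))))).
      * apply eventually_subseq. intros n. lia.
      * apply euler_gamma_lim.
    + apply (is_lim_seq_incr_1 (fun n => harmonic n - ln (INR (S n)))), euler_gamma_lim.
  - apply (filterlim_comp _ _ _ (fun m => INR (S m)) (fun t => / t) _ (Rbar_locally p_infty)).
    + apply (is_lim_seq_incr_1 INR p_infty), is_lim_seq_INR.
    + apply is_lim_Rinv_p_infty.
Qed.

Lemma J_value_PI : J_value PI = sqrt 2 * (1 - 3 * ln 2 / 2 - euler_gamma / 2).
Proof. unfold J_value. rewrite level_series_PI, sin_PI2, cos_PI2. field. Qed.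

Lemma J_value_opp (phi : R) : J_value (- phi) = - J_value phi.
Proof.
  assert (Hs : sin (- phi / 2) = - sin (phi / 2)).
  { replace (- phi / 2) with (- (phi / 2)) by field. apply sin_neg. }
  assert (Hr : forall t, ratio_tail t (- phi) = - ratio_tail t phi).
  { intros t. unfold ratio_tail, ratio. rewrite Hs, cos_neg. unfold Rdiv. ring. }
  assert (Hl : Series (fun n => level_term n (- phi)) = - Series (fun n => level_term n phi)).
  { rewrite <- Series_opp. apply Series_ext. intros n. unfold level_term. rewrite !Hr. unfold Rdiv. ring. }
  unfold J_value. rewrite Hl, Hs. replace (- phi / 2) with (- (phi / 2)) by field. rewrite cos_neg. field.
Qed.

Theorem mainTheorem13 :
  forall zeta : C -> C, is_riemann_zeta zeta ->
  exists J : R -> R,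
    (forall phi : R, - PI < phi < PI ->
       is_RInt_gen (zeta_integrand zeta phi) (at_point 0) (Rbar_locally p_infty) (J phi)) /\
    (forall phi : R, - PI < phi <= PI -> @analytic_at R_AbsRing J phi) /\
    J PI = sqrt 2 * (1 - 3 * ln 2 / 2 - euler_gamma / 2) /\
    filterlim J (at_left PI)
      (locally (sqrt 2 * (1 - 3 * ln 2 / 2 - euler_gamma / 2))).
Proof.
  intros zeta Hz. exists J_value.
  assert (Hpos : forall phi, 0 < phi < PI -> improper (zeta_integrand zeta phi) (J_value phi)).
  { intros phi Hp. apply (improper_ext (fun v => glasser_weight v * zeta_im v * ker phi v)).
    - intros v Hv. unfold zeta_integrand. rewrite (zeta_im_correct zeta v Hz Hv). reflexivity.
    - apply zeta_im_transform; [exact Hp|]. apply approx_value_lim; [exact Hp|apply ex_series_level_term]. }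
  assert (Hopp : forall phi v, zeta_integrand zeta (- phi) v = -1 * zeta_integrand zeta phi v).
  { intros phi v. unfold zeta_integrand. change (sinh (- phi * v) / cosh (PI * v)) with (ker (- phi) v).
    rewrite ker_opp. unfold ker. ring. }
  repeat split.
  - intros phi Hphi. apply improper_is_RInt_gen.
    destruct (Rtotal_order phi 0) as [H|[H|H]].
    + apply (improper_ext (fun v => -1 * zeta_integrand zeta (- phi) v)).
      * intros v _. rewrite <- Hopp, Ropp_involutive. reflexivity.
      * replace (J_value phi) with (-1 * J_value (- phi)) by (rewrite J_value_opp; ring).
        apply improper_scal, Hpos. lra.
    + subst phi. assert (H0 := J_value_opp 0). rewrite Ropp_0 in H0.
      replace (J_value 0) with (0 * / 1) by lra.
      apply (improper_ext (fun v => 0 * exp (- 1 * v))).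
      * intros v _. assert (Hv := Hopp 0 v). rewrite Ropp_0 in Hv. lra.
      * apply improper_scal, improper_exp. lra.
    + apply Hpos. lra.
  - intros phi _. apply real_analytic_at, real_analytic_J_value.
  - exact J_value_PI.
  - rewrite <- J_value_PI. eapply filterlim_filter_le_1; [|apply (real_analytic_continuous J_value PI), real_analytic_J_value].
    apply filter_le_within.
Qed.
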